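(* Let $a\in(-\infty,0)\cup(0,1)$ and let $\omega\in\mathbb D_a$ satisfy $R_a(\omega)=\omega$; let $L_\omega=\sup\{x:\omega(x)>0\}$. Then: (1) if $a<0$, $\omega>0$ on $\mathbb R$ and $\omega'\in H^k(\mathbb R)$ for every integer $k\ge0$; (2) if $0<a<1$, $\omega$ is supported on $[-L_\omega,L_\omega]$ with $L_\omega<\infty$, and $\omega$ is $C^\infty$ on the open interval $(-L_\omega,L_\omega)$.
   Context: Let $\rho(x)=(1+|x|)^{-1/2}$ and $\eta_a=\frac{1}{2^{9/2}(4+|a|)^3}$. $\mathbb D_a$ is the set of continuous even functions $\omega$ on $\mathbb R$ with $\|\rho\omega\|_{L^\infty}<\infty$ such that $\omega(0)=1$; $(1-x^2)_+\le\omega(x)\le1$ for all $x$; $\omega$ is non-increasing on $[0,\infty)$; $s\mapsto\omega(\sqrt s)$ is convex on $[0,\infty)$; and the left derivative satisfies $\omega'_-(1/2)\le-\eta_a$. $T(\omega)(x)=\frac1\pi\int_0^\infty\ln\left|\frac{x^2-y^2}{y^2}\right|\omega(y)\,dy$, $r(\omega)=\frac1\pi\int_0^\infty\frac{\omega(0)-\omega(y)}{y^2}\,dy$, and for $a\ne0$, $R_a(\omega)(x)=\big(1-\frac{aT(\omega)(x)}{r(\omega)}\big)_+^{1/a}$. $H^k$ denotes the $L^2$-based Sobolev space of order $k$. *)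

(* Defs.v *)
From HB Require Import structures.
From mathcomp Require Import all_boot all_order all_algebra.
From mathcomp Require Import all_classical all_reals all_analysis.
Set Implicit Arguments. Unset Strict Implicit. Unset Printing Implicit Defensive.
Import Order.TTheory GRing.Theory Num.Theory.
Import numFieldNormedType.Exports.
Local Open Scope classical_set_scope.
Local Open Scope ring_scope.

Section Defs.
Variable R : realType.

Definition rho (x : R) : R := (Num.sqrt (1 + `|x|))^-1.

Definition eta (a : R) : R := (powR 2 (9 / 2) * (4 + `|a|) ^+ 3)^-1.

Definition in_Da (a : R) (w : R -> R) : Prop :=
  [/\ continuous w,
      (forall x, w (- x) = w x),
      (exists C : R, forall x, `|rho x * w x| <= C) &
      w 0 = 1] /\
  [/\ (forall x, Num.max 0 (1 - x ^+ 2) <= w x /\ w x <= 1),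
      (forall x y, 0 <= x -> x <= y -> w y <= w x) &
      (forall s t l, 0 <= s -> 0 <= t -> 0 <= l -> l <= 1 ->
         w (Num.sqrt (l * s + (1 - l) * t))
           <= l * w (Num.sqrt s) + (1 - l) * w (Num.sqrt t))] /\
  (exists l : R,
     ((fun h : R => (w (2^-1 + h) - w (2^-1)) / h) @ (0 : R)^'- --> l)
     /\ l <= - eta a).

Definition Top (w : R -> R) (x : R) : R :=
  pi^-1 * \int[@lebesgue_measure R]_(y in `[0, +oo[%classic)
            (ln `|(x ^+ 2 - y ^+ 2) / y ^+ 2| * w y).

Definition rop (w : R -> R) : R :=
  pi^-1 * \int[@lebesgue_measure R]_(y in `[0, +oo[%classic)
            ((w 0 - w y) / y ^+ 2).

(* R_a(w)(x) = (1 - a T(w)(x) / r(w))_+^(1/a), valued in the extended reals: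
   when the base is <= 0 its positive part is 0, and 0^(1/a) is 0 if a > 0
   and +oo if a < 0. *)
Definition Ra (a : R) (w : R -> R) (x : R) : \bar R :=
  let b := 1 - a * Top w x / rop w in
  if 0 < b then (powR b a^-1)%:E
  else if 0 < a then 0%E else (+oo)%E.

Definition Lsup (w : R -> R) : \bar R :=
  ereal_sup [set (x%:E)%E | x in [set x : R | 0 < w x]].

Definition test_fun (phi : R -> R) (D : nat -> R -> R) : Prop :=
  [/\ D 0%N = phi,
      (forall (n : nat) (x : R), is_derive x (1 : R) (D n) (D n.+1 x)) &
      exists M : R, forall x, M < `|x| -> phi x = 0].

Definition L2 (f : R -> R) : Prop :=
  measurable_fun setT f /\
  (\int[@lebesgue_measure R]_x ((f x) ^+ 2)%:E < +oo)%E.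

Definition weak_deriv (f g : R -> R) : Prop :=
  forall phi D, test_fun phi D ->
    \int[@lebesgue_measure R]_x (f x * D 1%N x)
      = - \int[@lebesgue_measure R]_x (g x * phi x).

Definition inHk (k : nat) (f : R -> R) : Prop :=
  exists D : nat -> R -> R,
    [/\ D 0%N = f,
        (forall j, (j <= k)%N -> L2 (D j)) &
        (forall j, (j < k)%N -> weak_deriv (D j) (D j.+1))].

Definition smooth_on (f : R -> R) (l u : \bar R) : Prop :=
  exists D : nat -> R -> R,
    D 0%N = f /\
    forall (n : nat) (x : R), (l < x%:E)%E -> (x%:E < u)%E -> is_derive x (1 : R) (D n) (D n.+1 x).

End Defs.

(* Main.v *)
Require Import Defs.
From HB Require Import structures.
From mathcomp Require Import all_boot all_order all_algebra.
From mathcomp Require Import all_classical all_reals all_analysis.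
From mathcomp Require Import measurable_realfun lebesgue_integral_under ring lra.
Set Implicit Arguments. Unset Strict Implicit. Unset Printing Implicit Defensive.
Import Order.TTheory GRing.Theory Num.Theory.
Import numFieldNormedType.Exports.
Local Open Scope classical_set_scope.
Local Open Scope ring_scope.

(* Cutting off the singularity of the logarithm at scale e, differentiating under the
   integral and letting e tend to 0 shows that (pi T(w))' is the Hilbert transform h of w,
   and h is bounded because w (sqrt s) is convex in s.  Put b = 1 - a T(w) / r(w) and
   p = 1 / b.  Where w > 0 the fixed point equation w = b^(1/a) gives
   w' = - (K / a) h w p and p' = K h p^2 with K = a / (pi r(w)), and h inherits the
   Hoelder regularity of w, so w and p gain one derivative at each step.
   For a < 0 one has b >= 1, the argument is global and all derivatives of w are bounded;
   integrating by parts, the square integrals of the derivatives are bounded by the total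
   variation of w.  For 0 < a < 1 the function T(w) grows at least logarithmically, so b
   becomes negative and w vanishes far out. *)

(** * Integrals on the line *)

(** A priori [w] has neither decay nor regularity beyond a Lipschitz bound. The lack of decay is met
    by evenness: pairing [y] with [- y] turns the kernel 1/t, not integrable at infinity, into one
    of size y^-2. The lack of regularity is met by splitting h at a radius d. The far kernel [kap d]
    is differentiated in place of [w]: its powers reproduce themselves under differentiation up to
    bounded kernels supported in |t| <= d. The near kernel is singular but commutes with derivatives
    and sees [w] only within distance d. The radius is free, because the sum is the derivative of a
    function in which d does not occur: d comparable to |x| gives the global bound on h, a small d
    keeps the argument where [w] is positive. Each local step costs a margin d of the domain,
    harmless on the line and paid for by slightly larger intervals when 0 < a < 1. Convexity in s =
    x^2 acts through chords from the origin: they bound the variation of [w] over a distance t near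
    x by a multiple of t / |x|, which is what a bound on h uniform in x requires. *)

Section Toolkit.
Variable R : realType.
Notation mu := (@lebesgue_measure R).
Notation intble D f := (mu.-integrable D (EFin \o f)).
Lemma le_intble (D : set R) (f G : R -> R) : measurable D ->
  measurable_fun D f -> intble D G -> (forall x, D x -> `|f x| <= G x) -> intble D f.
Proof.
move=> mD mf iG fG.
apply: (@le_integrable _ _ _ mu D mD _ _ _ _ iG).
  exact/measurable_EFinP.
move=> x Dx; rewrite /= lee_fin; apply: (le_trans (fG _ Dx)); exact: ler_norm.
Qed.

Lemma le_norm_int (D : set R) (f G : R -> R) : measurable D ->
  measurable_fun D f -> intble D G -> (forall x, D x -> `|f x| <= G x) ->
  `|\int[mu]_(x in D) f x| <= \int[mu]_(x in D) G x.
Proof.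
move=> mD mf iG fG; have iF := le_intble mD mf iG fG.
apply: (le_trans (@le_normr_Rintegral _ _ _ mu D f mD iF)).
by apply: (@le_Rintegral _ _ _ mu) => //; exact: (@integrable_norm _ _ _ mu D f iF).
Qed.

Lemma intble_meas (D : set R) (f : R -> R) : intble D f -> measurable_fun D f.
Proof. by move=> /integrableP[/measurable_EFinP]. Qed.

Lemma reflect_measurable (c : R) : measurable_fun [set: R] (fun y : R => c - y).
Proof. by apply: measurable_funB => //; exact: measurable_cst. Qed.

Definition reflection (c : R) : measurableTypeR R -> measurableTypeR R := fun y => c - y.

Lemma measurable_reflection c : measurable_fun setT (reflection c).
Proof. exact: reflect_measurable. Qed.

Definition reflected_measure c : {measure set (measurableTypeR R) -> \bar R} :=
  measure_function_pushforward__canonical__measure_function_Measure mu (measurable_reflection c).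

(** Lebesgue measure is determined by half-open intervals, and the reflection of one has the same
    length. *)
Lemma reflect_measure (c : R) (A : set R) : measurable A ->
  mu A = pushforward mu (reflection c) A.
Proof.
move=> mA.
refine (@lebesgue_measure_unique R (reflected_measure c) _ _ mA).
move=> _ [[a b] _ <-] /=; rewrite /pushforward.
have -> : (reflection c @^-1` `]a, b]) = `[c - b, c - a[%classic.
  apply/seteqP; split => x /=; rewrite !in_itv/= /reflection; lra.
by rewrite !lebesgue_measure_itv/= !lte_fin ltrD2l ltrN2; case: ifP => // _;
  rewrite -!EFinB; congr (_%:E); lra.
Qed.

Lemma ge0_reflect_integral (c : R) (f : R -> \bar R) : measurable_fun setT f ->
  (forall y, (0 <= f y)%E) -> (\int[mu]_x f x = \int[mu]_x f (c - x)%R)%E.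
Proof.
move=> mf f0.
rewrite -(@ge0_integral_pushforward _ _ _ _ _ (reflection c) (measurable_reflection c) mu setT f) //.
by apply: (@eq_measure_integral _ _ _ _ (reflected_measure c)) => A mA _; exact: reflect_measure.
Qed.

Lemma reflect_intble (c : R) (f : R -> R) : intble setT f ->
  intble setT (fun y => f (c - y)).
Proof.
move=> iF.
have mf := intble_meas iF.
apply/integrableP; split.
  by apply/measurable_EFinP; apply: (measurableT_comp mf); exact: reflect_measurable.
move/integrableP : (iF) => [_].
rewrite (ge0_reflect_integral c)//.
apply/measurable_EFinP/measurableT_comp => //.
Qed.

Lemma reflect_int (c : R) (f : R -> R) : intble setT f ->
  \int[mu]_y f (c - y) = \int[mu]_y f y.
Proof.
move=> iF; rewrite /Rintegral; congr fine; apply/esym.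
rewrite -[RHS](@integral_pushforward _ _ _ _ _ (reflection c) (measurable_reflection c) mu setT (EFin \o f)) //.
- by apply: (@eq_measure_integral _ _ _ _ (reflected_measure c)) => A mA _; exact: reflect_measure.
- by apply/measurable_EFinP; exact: (intble_meas iF).
- exact: (reflect_intble c iF).
Qed.

Lemma Rint_setU (A B : set R) (g : R -> R) : measurable A -> measurable B ->
  intble setT g -> A `&` B = set0 -> A `|` B = setT ->
  \int[mu]_y g y = \int[mu]_(y in A) g y + \int[mu]_(y in B) g y.
Proof.
move=> mA mB ig AB0 ABT.
rewrite -(@Rintegral_setU _ _ _ mu A B g)//.
- by rewrite ABT.
- by rewrite ABT.
- by apply/disj_setPS; rewrite AB0.
Qed.

Lemma intbleS (A : set R) (g : R -> R) : measurable A -> intble setT g -> intble A g.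
Proof.
by move=> mA ig; apply: (@integrableS _ _ _ mu setT A _ _ mA _ ig).
Qed.

Lemma intble_restrict (A : set R) (g : R -> R) : measurable A ->
  intble A g <-> intble setT (g \_ A).
Proof.
move=> mA; have := @integrable_mkcond _ _ _ mu A (EFin \o g) mA.
by rewrite restrict_EFin.
Qed.

Lemma even_half_int (g : R -> R) : (forall y, g (- y) = g y) -> intble setT g ->
  \int[mu]_(y in `[0, +oo[) g y = 2^-1 * \int[mu]_y g y.
Proof.
move=> ev ig.
have e0 : \int[mu]_(y in `]-oo, 0[) g y = \int[mu]_(y in `]0, +oo[) g y.
  rewrite Rintegral_mkcond [RHS]Rintegral_mkcond -(reflect_int 0); last first.
    by apply: (proj1 (intble_restrict _ _)) => //; exact: intbleS.
  apply: eq_Rintegral => x _; rewrite sub0r !patchE !mem_setE !in_itv/= oppr_lt0.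
  by rewrite ev andbT.
rewrite (@Rint_setU `]-oo, 0[ `[0, +oo[)//.
- rewrite e0 Rintegral_itv_obnd_cbnd; last exact: intbleS.
  by lra.
- by apply/seteqP; split => x //=; rewrite !in_itv/=; lra.
- by apply/seteqP; split => x //=; rewrite !in_itv/=; lra.
Qed.
Lemma intble_oneDsqrV : intble setT (fun y : R => (1 + y ^+ 2)^-1).
Proof.
have ce : continuous (fun y : R => (1 + y ^+ 2)^-1) := @continuous_oneDsqrV R.
have e0 : forall y : R, 0 <= (1 + y ^+ 2)^-1.
  by move=> y; rewrite invr_ge0 addr_ge0// sqr_ge0.
apply/integrableP; split.
  apply/measurable_EFinP; exact: continuous_measurable_fun.
rewrite (@eq_integral _ _ _ mu _ (fun y : R => ((1 + y ^+ 2)^-1)%:E)); last first.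
  by move=> y _; rewrite /= ger0_norm.
rewrite ge0_symfun_integralT//; last by move=> y /=; rewrite sqrrN.
have -> : [set x : R | 0 <= x] = `[0, +oo[%classic.
  by apply/seteqP; split => x /=; rewrite in_itv/= andbT.
by rewrite (integral0y_oneDsqr R) -EFinM ltry.
Qed.

Lemma is_derive_cont (f : R -> R) (x l : R) : is_derive x 1 f l -> {for x, continuous f}.
Proof. by move=> [d _]; exact/differentiable_continuous/derivable1_diffP. Qed.

(** For [b < 1] the integrand is singular at 0: it is integrated over [[d / (n + 1), d]] by the
    fundamental theorem, then monotone convergence applies. *)
Lemma intble_powR0 (b d : R) : 0 < b -> 0 < d ->
  intble `]0, d] (fun t => t `^ (b - 1)) /\
  \int[mu]_(t in `]0, d]) (t `^ (b - 1)) <= d `^ b / b.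
Proof.
move=> b0 d0.
have mf : measurable_fun [set: R] (fun t : R => t `^ (b - 1)) by exact: measurable_powR.
pose F (n : nat) : set (measurableTypeR R) := `[d / n.+1%:R, d]%classic.
have UF : \bigcup_n F n = `]0, d]%classic.
  apply/seteqP; split => x /=.
    move=> [n _]; rewrite /F /= !in_itv/= => /andP[h ->]; rewrite andbT.
    by apply: lt_le_trans h; rewrite divr_gt0.
  rewrite in_itv/= => /andP[x0 xd].
  exists (Num.truncn (d / x)); rewrite // /F /= in_itv/= xd andbT.
  have := @truncnS_gt R (d / x).
  by rewrite ler_pdivrMr// ltr_pdivrMr// => /ltW; rewrite mulrC.
have mF n : measurable_fun (F n) (fun t => (t `^ (b - 1))%:E).
  by apply/measurable_EFinP; exact: measurable_funTS.
have der (x : R) : 0 < x -> is_derive x 1 (fun t : R => t `^ b / b) (x `^ (b - 1)).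
  move=> x0; have := is_derive1_powR b x0 => H.
  have -> : (fun t : R => t `^ b / b) = (fun t : R => b^-1 *: (t `^ b)).
    by apply/funext => t; rewrite /GRing.scale /= mulrC.
  by apply: is_derive_eq; rewrite /GRing.scale /= mulrA mulVf ?mul1r// gt_eqF.
have FTC n : (\int[mu]_(t in F n) (t `^ (b - 1))%:E = (d `^ b / b - (d / n.+1%:R) `^ b / b)%:E)%E.
  (* For [n = 0] the interval is the single point [d]. *)
  have [->|n0] := eqVneq n 0%N.
    by rewrite /F divr1 set_itv1 integral_set1 subrr.
  have dn0 : 0 < d / n.+1%:R by rewrite divr_gt0.
  rewrite (@continuous_FTC2 R (fun t => t `^ (b - 1)) (fun t => t `^ b / b)).
  - by rewrite EFinB.
  - by rewrite ltr_pdivrMr// ltr_pMr// ltr1n ltnS lt0n.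
  - apply: continuous_in_subspaceT => x; rewrite inE/= in_itv/= => /andP[x0 _].
    exact: (is_derive_cont (is_derive1_powR (b - 1) (lt_le_trans dn0 x0))).
  - split.
    + by move=> x; rewrite in_itv/= => /andP[x0 _]; have := der x (lt_trans dn0 x0); case.
    + exact: (cvg_at_right_filter (is_derive_cont (der _ dn0))).
    + exact: (cvg_at_left_filter (is_derive_cont (der _ d0))).
  - move=> x; rewrite in_itv/= => /andP[x0 _]; rewrite derive1E; have := der x (lt_trans dn0 x0); by case.
have bnd : (\int[mu]_(t in `]0%R, d]) (t `^ (b - 1))%:E <= (d `^ b / b)%:E)%E.
  rewrite -UF.
  have nd : {homo F : n m / (n <= m)%N >-> (n <= m)%O}.
    move=> n m nm; apply/subsetPset => x; rewrite /F /= !in_itv/= => /andP[h ->]; rewrite andbT.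
    by apply: le_trans h; rewrite ler_pM2l// lef_pV2 ?posrE// ler_nat ltnS.
  have pos i x : F i x -> (0 <= (x `^ (b - 1))%:E)%E by rewrite lee_fin powR_ge0.
  have c := @ge0_nondecreasing_set_cvg_integral _ _ _ F (fun t => (t `^ (b - 1))%:E) mu nd
    (fun i => measurable_itv _) mF pos.
  rewrite -(cvg_lim _ c)//.
  apply: lime_le; first by apply/cvg_ex; eexists; exact: c.
  by apply: nearW => n; rewrite FTC lee_fin gerBl// divr_ge0// ?powR_ge0// ltW.
have iP : intble `]0, d] (fun t => t `^ (b - 1)).
  apply/integrableP; split.
    by apply/measurable_EFinP; exact: measurable_funTS.
  rewrite (@eq_integral _ _ _ mu _ (fun t : R => (t `^ (b - 1))%:E)); last first.
    by move=> y _; rewrite /= ger0_norm// powR_ge0.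
  by apply: le_lt_trans bnd _; rewrite ltry.
split => //.
rewrite -lee_fin /Rintegral fineK//.
exact: (integrable_fin_num _ iP).
Qed.

Lemma is_derive_cvg (F : R -> R) (a l : R) :
  (h^-1 * (F (h + a) - F a) @[h --> 0^'] --> l) -> is_derive a 1 F l.
Proof.
move=> H.
have H' : (fun h => h^-1 *: ((F \o shift a) (h *: 1) - F a)) @ 0^' --> l.
  move: H; apply: cvg_trans; apply: near_eq_cvg; near=> h.
  by rewrite /= /GRing.scale /= mulr1.
apply: DeriveDef; first by apply/cvg_ex; exists l.
exact: (cvg_lim _ H').
Unshelve. all: end_near. Qed.

Lemma is_derive_cvgE (F : R -> R) (a l : R) : is_derive a 1 F l ->
  (h^-1 * (F (h + a) - F a) @[h --> 0^'] --> l).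
Proof.
move=> [d <-].
apply: cvg_trans d; apply: near_eq_cvg; near=> h.
by rewrite /= /GRing.scale /= mulr1.
Unshelve. all: end_near. Qed.

(** Free of quotients and valid at [h = 0]: in this form derivatives can be glued, transported and
    read off from increment estimates. *)
Lemma is_derive_epsP (F : R -> R) (a l : R) : is_derive a 1 F l <->
  (forall e, 0 < e -> exists2 d, 0 < d & forall h, `|h| < d ->
    `|F (a + h) - F a - h * l| <= e * `|h|).
Proof.
split.
  move=> /is_derive_cvgE /cvgrPdist_le H e e0.
  have /= := H e e0.
  rewrite near_withinE => /nbhs_ballP[d d0 Hd].
  exists d => // h hd; have [->|h0] := eqVneq h 0.
    by rewrite addr0 subrr mul0r subrr normr0 mulr0.
  have := Hd h; rewrite /ball /= sub0r normrN => /(_ hd h0).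
  move=> H1.
  have -> : F (a + h) - F a - h * l = - (h * (l - h^-1 * (F (h + a) - F a))).
    by rewrite (addrC h); field.
  by rewrite normrN normrM mulrC ler_wpM2r.
move=> H; apply: is_derive_cvg; apply/cvgrPdist_le => e e0.
have [d d0 Hd] := H e e0.
rewrite near_withinE; apply/nbhs_ballP; exists d => // h.
rewrite /ball /= sub0r normrN => hd h0.
have -> : l - h^-1 * (F (h + a) - F a) = - (h^-1 * (F (a + h) - F a - h * l)).
  by rewrite (addrC h); field.
rewrite normrN normrM normfV mulrC ler_pdivrMr ?normr_gt0//; exact: Hd.
Qed.

(** Dominated convergence for difference quotients along an arbitrary sequence tending to 0. The
    parameter derivative is taken at [a] alone; elsewhere only the increment bound by [G] speaks. *)
Lemma dui (D : set R) (f : R -> R -> R) (a r : R) (g G : R -> R) :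
  measurable D -> 0 < r ->
  (forall x, `|x - a| < r -> intble D (f x)) ->
  intble D G ->
  (forall x y, `|x - a| < r -> D y -> `|f x y - f a y| <= `|x - a| * G y) ->
  (forall y, D y -> is_derive a 1 (f ^~ y) (g y)) ->
  is_derive a 1 (fun x => \int[mu]_(y in D) f x y) (\int[mu]_(y in D) g y).
Proof.
move=> mD r0 iF iG fG fg; apply: is_derive_cvg; apply/cvgr_dnbhsP => t [t0 tc].
(* The sequence enters the ball of radius [r] only from rank [N] on, hence the shift by [N]
   below. *)
have [N _ HN] : \forall n \near \oo, `|t n| < r.
  by move/cvgr0_norm_lt : tc; apply.
rewrite -(cvg_shiftn N).
have HN' n : `|t (n + N)%N + a - a| < r by rewrite addrK; apply: HN; rewrite /= leq_addl.
have ifa : intble D (f a) by apply: iF; rewrite subrr normr0.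
pose gn n y := (t (n + N)%N)^-1 * (f (t (n + N)%N + a) y - f a y).
have ign n : intble D (gn n).
  apply: (@integrableZl _ _ _ mu D mD (t (n + N)%N)^-1 (fun y => (f (t (n + N)%N + a) y - f a y)%:E)).
  apply: (@integrableB _ _ _ mu D mD (EFin \o f (t (n + N)%N + a)) (EFin \o f a)) => //.
  exact: iF.
have E n : (t (n + N)%N)^-1 * ((\int[mu]_(y in D) f (t (n + N)%N + a) y) - \int[mu]_(y in D) f a y) = \int[mu]_(y in D) gn n y.
  rewrite RintegralZl//; last first.
    apply: (@integrableB _ _ _ mu D mD (EFin \o f (t (n + N)%N + a)) (EFin \o f a)) => //.
    exact: iF.
  by rewrite RintegralB//; exact: iF.
rewrite (_ : (fun _ => _) = (fun n => \int[mu]_(y in D) gn n y)); last by apply/funext => n; exact: E.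
have cg y : D y -> gn n y @[n --> \oo] --> g y.
  move=> Dy; have /is_derive_cvgE /cvgr_dnbhsP H := fg y Dy.
  have := H t (conj t0 tc).
  by rewrite -(cvg_shiftn N).
have mgn n : measurable_fun D (EFin \o gn n) by have /integrableP[] := ign n.
have ceg y : D y -> (gn n y)%:E @[n --> \oo] --> (g y)%:E.
  by move=> Dy; apply: cvg_EFin; [exact: nearW|exact: cg].
have mg : measurable_fun D (EFin \o g).
  exact: (emeasurable_fun_cvg _ _ mgn ceg).
have A1 : {ae mu, forall y, D y -> ((gn n y)%:E @[n --> \oo] --> (EFin \o g) y)} by exact: aeW.
have A2 : {ae mu, forall y n, D y -> (`|(gn n y)%:E| <= (EFin \o G) y)%E}.
  apply: aeW => y n Dy; rewrite /= lee_fin /gn normrM normfV mulrC ler_pdivrMr ?normr_gt0//.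
  by apply: le_trans (fG _ _ (HN' n) Dy) _; rewrite addrK mulrC.
have [ig _ c] := @dominated_convergence _ _ _ mu D mD (fun n y => (gn n y)%:E) (EFin \o g)
   (EFin \o G) mgn mg A1 iG A2.
apply: fine_cvg; move: c.
by rewrite -[X in _ --> X -> _]fineK//; exact: (integrable_fin_num _ ig).
Qed.
(** Since [0^-1 = 0], a bound by [|t|^-1] would force a kernel to vanish at 0; that point is left
    out. *)
Definition punctured (d : R) : set R := [set t | 0 < `|t| < d].

Lemma measurable_punctured d : measurable (punctured d).
Proof.
have -> : punctured d = `]-d, d[%classic `\` [set 0].
  apply/seteqP; split => t; rewrite /punctured/= in_itv/= -ltr_norml normr_gt0.
    by move=> /andP[/eqP ? ->].
  by move=> [-> /eqP ->].
by apply: measurableD => //; exact: measurable_itv.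
Qed.

Lemma punctured_powR (b d : R) : 0 < b -> 0 < d ->
  intble (punctured d) (fun t => `|t| `^ (b - 1)) /\
  \int[mu]_(t in punctured d) (`|t| `^ (b - 1)) <= 2 * (d `^ b / b).
Proof.
move=> b0 d0; have [i0 l0] := intble_powR0 b0 d0.
pose f : R -> R := (fun t : R => t `^ (b - 1)) \_ `]0, d].
have iF : intble setT f by apply: (proj1 (intble_restrict _ _)).
have iFr := reflect_intble 0 iF.
have f0 t : 0 <= f t by rewrite /f patchE; case: ifP => // _; exact: powR_ge0.
have iU : intble setT (fun t => f t + f (0 - t)).
  exact: (@integrableD _ _ _ mu setT _ (EFin \o f) (EFin \o (fun t => f (0 - t)))).
have mD := measurable_punctured d.
have bd t : punctured d t -> `|t| `^ (b - 1) <= f t + f (0 - t).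
  rewrite /punctured/= => /andP[]; rewrite normr_gt0 => t0 td.
  have [t1|t1] := ltP 0 t.
    have <- : f t = `|t| `^ (b - 1); last by rewrite lerDl.
    by rewrite /f patchE mem_setE in_itv/= t1 -{1}[t](gtr0_norm t1) (ltW td) gtr0_norm.
  have t2 : 0 < - t by rewrite oppr_gt0 lt_neqAle t0.
  have <- : f (0 - t) = `|t| `^ (b - 1); last by rewrite lerDr.
  by rewrite /f patchE mem_setE in_itv/= sub0r t2 -{1}(ler0_norm t1) (ltW td) ler0_norm.
have mp : measurable_fun (punctured d) (fun t : R => `|t| `^ (b - 1)).
  apply: measurable_funTS; apply: (measurableT_comp (measurable_powR _)).
  by apply: continuous_measurable_fun; exact: norm_continuous.
have bd' t : punctured d t -> `| `|t| `^ (b - 1)| <= f t + f (0 - t).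
  by move=> ?; rewrite ger0_norm ?powR_ge0//; exact: bd.
have ip := le_intble mD mp (intbleS mD iU) bd'.
split => //.
apply: (@le_trans _ _ (\int[mu]_(t in punctured d) (f t + f (0 - t)))).
  by apply: le_Rintegral => //; exact: intbleS.
apply: (@le_trans _ _ (\int[mu]_t (f t + f (0 - t)))).
  rewrite (@Rint_setU (punctured d) (~` punctured d))//.
  - by rewrite lerDl; apply: Rintegral_ge0 => t _; rewrite addr_ge0.
  - exact: measurableC.
  - by rewrite setICr.
  - by rewrite setUCr.
rewrite RintegralD// (@reflect_int 0 f)//.
by move: l0; rewrite Rintegral_mkcond -/f; lra.
Qed.

Lemma Rint_null (N : set R) (g : R -> R) : measurable N -> mu N = 0%E -> intble setT g ->
  \int[mu]_(y in ~` N) g y = \int[mu]_y g y.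
Proof.
move=> mN N0 ig; rewrite /Rintegral; congr fine.
by rewrite (@negligible_integral _ _ _ mu setT N)// setTD.
Qed.

(** Meant for kernels with corners: at the fixed parameter [a] they are met only for [y] in a null
    set, whose removal changes no integral. *)
Lemma dui_null (N : set R) (f : R -> R -> R) (a r : R) (g G : R -> R) :
  measurable N -> mu N = 0%E -> 0 < r ->
  (forall x, `|x - a| < r -> intble setT (f x)) ->
  intble setT G -> intble setT g ->
  (forall x y, `|x - a| < r -> `|f x y - f a y| <= `|x - a| * G y) ->
  (forall y, ~ N y -> is_derive a 1 (f ^~ y) (g y)) ->
  is_derive a 1 (fun x => \int[mu]_y f x y) (\int[mu]_y g y).
Proof.
move=> mN N0 r0 iF iG ig fG fg.
have mC : measurable (~` N) by exact: measurableC.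
have H : is_derive a 1 (fun x => \int[mu]_(y in ~` N) f x y) (\int[mu]_(y in ~` N) g y).
  apply: (@dui _ f a r g G) => //.
  - by move=> x /iF; exact: intbleS.
  - exact: intbleS.
  - by move=> x y xa _; exact: fG.
rewrite -(Rint_null mN N0 ig).
apply/is_derive_epsP => e e0.
have /is_derive_epsP/(_ e e0)[d d0 Hd] := H.
exists (Num.min d r); first by rewrite lt_min d0.
move=> h; rewrite lt_min => /andP[hd hr].
have := Hd h hd.
by rewrite !Rint_null//; apply: iF; rewrite ?subrr ?normr0// [a + h]addrC addrK.
Qed.
End Toolkit.

(** * Hoelder classes *)

Section Hoelder.
Variable R : realType.
Implicit Types (U V : set R) (f g : R -> R) (n : nat).

Definition holder_with U (al C : R) f :=
  [/\ 0 < al <= 1, 0 <= C, (forall x, U x -> `|f x| <= C) &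
      forall x y, U x -> U y -> `|f x - f y| <= C * `|x - y| `^ al].

Definition holder U f := exists al C, holder_with U al C f.

Definition convex U := forall x y z, U x -> U y -> x <= z -> z <= y -> U z.

(** At distance at most 1 a smaller exponent gives a larger power; farther away the supremum bound
    takes over, at the cost of the factor 2. *)
Lemma holder_with_le U al be C D f : 0 < be <= al -> 2 * C <= D ->
  holder_with U al C f -> holder_with U be D f.
Proof.
move=> /andP[b0 ba] CD [/andP[a0 a1] C0 fC fH]; split => //.
- by rewrite b0 (le_trans ba).
- by lra.
- by move=> x /fC; lra.
- move=> x y Ux Uy; have [d1|d1] := leP `|x - y| 1.
    have [->|xy] := eqVneq x y.
      by rewrite subrr normr0 mulr_ge0 ?powR_ge0//; lra.
    apply: (le_trans (fH _ _ Ux Uy)).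
    apply: ler_pM => //; first by lra.
    by apply: ger_powR => //; rewrite normr_gt0 subr_eq0 xy.
  have h1 : 1 <= `|x - y| `^ be by rewrite -(powRr0 `|x - y|) ler_powR// ltW.
  apply: (le_trans (ler_normB _ _)).
  have := fC _ Ux; have := fC _ Uy => h2 h3.
  apply: (@le_trans _ _ (D * 1)); first by lra.
  by rewrite ler_wpM2l//; lra.
Qed.

Lemma holder_common U f g : holder U f -> holder U g ->
  exists al C, holder_with U al C f /\ holder_with U al C g.
Proof.
move=> [a [C fH]] [b [D gH]].
have [/andP[a0 a1] C0 _ _] := fH; have [/andP[b0 b1] D0 _ _] := gH.
exists (Num.min a b), (2 * C + 2 * D); split.
  by apply: holder_with_le fH; rewrite ?lt_min ?a0 ?b0 ?ge_min ?lexx//; lra.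
by apply: holder_with_le gH; rewrite ?lt_min ?a0 ?b0 ?ge_min ?lexx ?orbT//; lra.
Qed.

Lemma holderD U f g : holder U f -> holder U g -> holder U (fun x => f x + g x).
Proof.
move=> fH gH; have [al [C [[a1 C0 fC fL] [_ _ gC gL]]]] := holder_common fH gH.
exists al, (C + C); split => //; first by rewrite addr_ge0.
- by move=> x Ux; apply: (le_trans (ler_normD _ _)); rewrite lerD ?fC ?gC.
- move=> x y Ux Uy; have -> : f x + g x - (f y + g y) = f x - f y + (g x - g y) by ring.
  by apply: (le_trans (ler_normD _ _)); rewrite mulrDl lerD ?fL ?gL.
Qed.

Lemma holderM U f g : holder U f -> holder U g -> holder U (fun x => f x * g x).
Proof.
move=> fH gH; have [al [C [[a1 C0 fC fL] [_ _ gC gL]]]] := holder_common fH gH.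
exists al, (C * C + C * C); split => //; first by rewrite addr_ge0 ?mulr_ge0.
- move=> x Ux; rewrite normrM.
  have h : `|f x| * `|g x| <= C * C by rewrite ler_pM ?fC ?gC.
  by apply: (le_trans h); rewrite lerDl mulr_ge0.
- move=> x y Ux Uy.
  have -> : f x * g x - f y * g y = (f x - f y) * g x + f y * (g x - g y) by ring.
  apply: (le_trans (ler_normD _ _)); rewrite [X in _ <= X]mulrDl !normrM; apply: lerD.
    by rewrite mulrAC ler_pM ?fL ?gC.
  by rewrite -mulrA ler_pM ?fC ?gL.
Qed.

Lemma holder_cst U (c : R) : holder U (fun=> c).
Proof.
exists 1, `|c|; split => //; first by rewrite ltr01 lexx.
by move=> x y _ _; rewrite subrr normr0 mulr_ge0 ?powR_ge0.
Qed.

Lemma holder_lip U f C : 0 <= C -> (forall x, U x -> `|f x| <= C) ->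
  (forall x y, U x -> U y -> `|f x - f y| <= C * `|x - y|) -> holder U f.
Proof.
move=> C0 fC fL; exists 1, C; split => //; first by rewrite ltr01 lexx.
by move=> x y Ux Uy; rewrite powRr1//; exact: fL.
Qed.

Lemma lip_deriv U f g C : convex U ->
  (forall x, U x -> is_derive x 1 f (g x)) -> (forall x, U x -> `|g x| <= C) ->
  forall x y, U x -> U y -> `|f x - f y| <= C * `|x - y|.
Proof.
move=> cU fg gC.
have H x y : U x -> U y -> x < y -> `|f y - f x| <= C * `|y - x|.
  move=> Ux Uy xy.
  have Uz z : x <= z -> z <= y -> U z by move=> *; exact: (cU x y).
  have [||c] := @MVT _ f g _ _ xy.
  - by move=> z; rewrite in_itv/= => /andP[? ?]; apply/fg/Uz; exact: ltW.
  - apply: continuous_in_subspaceT => z; rewrite inE/= in_itv/= => /andP[? ?].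
    by apply: (is_derive_cont (fg z _)); exact: Uz.
  - rewrite in_itv/= => /andP[? ?] ->; rewrite normrM ler_wpM2r// gC//.
    by apply: Uz; exact: ltW.
move=> x y Ux Uy; have [xy|xy|->] := ltgtP x y.
- by rewrite distrC [X in _ * X]distrC; exact: H.
- exact: H.
- by rewrite !subrr normr0 mulr0.
Qed.

Lemma holder_deriv U f g B : convex U -> (forall x, U x -> `|f x| <= B) ->
  (forall x, U x -> is_derive x 1 f (g x)) -> (exists C, forall x, U x -> `|g x| <= C) ->
  holder U f.
Proof.
move=> cU fB fg [C gC].
pose K := `|B| + `|C|.
have BK : B <= K by rewrite /K (le_trans (ler_norm B))// lerDl.
have CK : C <= K by rewrite /K (le_trans (ler_norm C))// lerDr.
apply: (@holder_lip U f K); first by rewrite addr_ge0.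
  by move=> x Ux; apply: le_trans BK; exact: fB.
by apply: (lip_deriv cU fg) => x Ux; apply: le_trans CK; exact: gC.
Qed.

Lemma holder_bnd U f : holder U f -> exists C, forall x, U x -> `|f x| <= C.
Proof. by move=> [al [C [_ _ h _]]]; exists C. Qed.

Lemma holder_sub U V f : V `<=` U -> holder U f -> holder V f.
Proof.
move=> VU [al [C [a C0 h1 h2]]]; exists al, C; split => //.
  by move=> x /VU; exact: h1.
by move=> x y /VU Ux /VU Uy; exact: h2.
Qed.

Lemma holder_cont U f : open U -> holder U f -> forall x, U x -> {for x, continuous f}.
Proof.
move=> oU [al [C [/andP[a0 a1] C0 h1 h2]]] x Ux.
apply/cvgrPdist_le => e e0.
(* Solves [(C + 1) * d ^ al = e]; the added 1 guards against [C = 0]. *)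
pose d := (e / (C + 1)) `^ (al^-1).
have C1 : 0 < C + 1 by rewrite ltr_wpDl.
have d0 : 0 < d by rewrite powR_gt0// divr_gt0.
near=> y.
have Uy : U y by near: y; exact: (open_nbhs_nbhs (conj oU Ux)).
apply: (le_trans (h2 _ _ Ux Uy)).
have xy : `|x - y| <= d by near: y; apply: cvgr_dist_le.
apply: (@le_trans _ _ ((C + 1) * (e / (C + 1)))); last by rewrite mulrC divfK// gt_eqF.
apply: ler_pM => //; first by rewrite lerDl.
rewrite -[X in _ <= X](_ : d `^ al = _); last first.
  by rewrite /d -powRrM mulVf ?powRr1 ?gt_eqF// divr_ge0 ?ltW.
by apply: ge0_ler_powR => //; rewrite ?nnegrE ltW.
Unshelve. all: end_near. Qed.

(* The Hoelder exponent may depend on the derivative: [local_op] below loses half of it. *)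
Fixpoint Cn U n f : Prop :=
  match n with
  | 0%N => holder U f
  | n.+1 => holder U f /\ exists2 g, (forall x, U x -> is_derive x 1 f (g x)) & Cn U n g
  end.

Lemma Cn_holder U n f : Cn U n f -> holder U f.
Proof. by case: n => [|n] //= []. Qed.

Lemma CnS U n f : Cn U n.+1 f -> Cn U n f.
Proof.
elim: n f => [|n IH] f; first by case.
by move=> [fH [g fg gC]]; split => //; exists g => //; exact: IH.
Qed.

Lemma is_deriveD_pt (f g : R -> R) (x a b : R) : is_derive x 1 f a -> is_derive x 1 g b ->
  is_derive x 1 (fun x => f x + g x) (a + b).
Proof. by move=> fa gb; exact: (is_deriveD fa gb). Qed.

Lemma is_deriveM_pt (f g : R -> R) (x a b : R) : is_derive x 1 f a -> is_derive x 1 g b ->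
  is_derive x 1 (fun x => f x * g x) (a * g x + f x * b).
Proof.
move=> fa gb; have := is_deriveM fa gb; rewrite /GRing.scale /= => H.
by apply: (is_derive_eq H); rewrite addrC [g x * a]mulrC.
Qed.

Lemma is_derive_shift_pt (f : R -> R) (a s l : R) : is_derive (a + s) 1 f l ->
  is_derive a 1 (fun x => f (x + s)) l.
Proof.
move=> /is_derive_epsP H; apply/is_derive_epsP => e e0; have [r r0 Hr] := H e e0.
by exists r => // h hr; have := Hr h hr; rewrite (addrAC a h s).
Qed.

Lemma is_deriveZ_pt (f : R -> R) (c a l : R) : is_derive a 1 f l ->
  is_derive a 1 (fun x => c * f x) (c * l).
Proof. by move=> H; exact: (is_deriveZ c H). Qed.

Lemma powR_split (z a b : R) : 0 < z -> z `^ (a + b) = z `^ a * z `^ b.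
Proof. by move=> z0; rewrite powRD// (gt_eqF z0) implybT. Qed.

Lemma is_derive_cst_pt (c x : R) : is_derive x 1 (fun _ : R => c) 0.
Proof. exact: is_derive_cst. Qed.

Lemma CnD U n f g : Cn U n f -> Cn U n g -> Cn U n (fun x => f x + g x).
Proof.
elim: n f g => [|n IH] f g; first exact: holderD.
move=> [fH [f' ff' f'C]] [gH [g' gg' g'C]]; split; first exact: holderD.
exists (fun x => f' x + g' x); last exact: IH.
by move=> x Ux; apply: is_deriveD_pt; [exact: ff'|exact: gg'].
Qed.

Lemma CnM U n f g : Cn U n f -> Cn U n g -> Cn U n (fun x => f x * g x).
Proof.
elim: n f g => [|n IH] f g; first exact: holderM.
move=> fC0 gC0; have [fH [f' ff' f'C]] := fC0; have [gH [g' gg' g'C]] := gC0.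
split; first exact: holderM.
exists (fun x => f' x * g x + f x * g' x).
  by move=> x Ux; apply: is_deriveM_pt; [exact: ff'|exact: gg'].
by apply: CnD; apply: IH => //; exact: CnS.
Qed.

Lemma Cn_cst U n (c : R) : Cn U n (fun=> c).
Proof.
elim: n c => [|n IH] c; first exact: holder_cst.
split; first exact: holder_cst.
by exists (fun=> 0) => // x _; exact: is_derive_cst_pt.
Qed.

Lemma Cn_sub U V n f : V `<=` U -> Cn U n f -> Cn V n f.
Proof.
move=> VU; elim: n f => [|n IH] f; first exact: holder_sub.
move=> [fH [g fg gC]]; split; first exact: holder_sub fH.
by exists g; [by move=> x /VU; exact: fg|exact: IH].
Qed.

End Hoelder.

(** * Singular operators of finite range on Hoelder classes *)

Section LocalOperator.
Variable R : realType.
Notation mu := (@lebesgue_measure R).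
Notation intble D f := (mu.-integrable D (EFin \o f)).
Implicit Types (U V : set R) (f g : R -> R) (n : nat).

Variables (k1 k2 : R -> R) (d M : R).
Hypothesis d0 : 0 < d.
Hypothesis M0 : 0 <= M.
Hypothesis mk1 : measurable_fun (punctured d) k1.
Hypothesis mk2 : measurable_fun (punctured d) k2.
Hypothesis kM : forall t u v, punctured d t ->
  `|k1 t * u + k2 t * v| <= M * (`|u - v| / `|t|) + M * (`|u| + `|v|).

(* The kernels are of size 1/|t|; [kM] encodes the cancellation between the two halves,
   without which the integral would diverge at 0. *)
Definition local_op f (x : R) : R :=
  \int[mu]_(t in punctured d) (k1 t * f (x - t) + k2 t * f (x + t)).

(** Majorant of the integrand when [A] bounds both values of [f] and [B * |t| ^ al] their
    difference: division by [|t|] leaves the integrable power [al - 1]. *)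
Definition dominant (al A B t : R) : R := M * B * `|t| `^ (al - 1) + M * (A + A).

Lemma punctured_intble_cst (c : R) : intble (punctured d) (fun=> c).
Proof.
have [h _] := @punctured_powR R 1 d ltr01 d0.
have mD := @measurable_punctured R d.
apply: (@le_intble R _ _ (fun t => `|c| * `|t| `^ (1 - 1))) => //.
  exact: (@integrableZl _ _ _ mu _ mD `|c| (EFin \o (fun t => `|t| `^ (1 - 1)))).
by move=> x _; rewrite subrr powRr0 mulr1.
Qed.

Lemma intble_dominant (al A B : R) : 0 < al -> intble (punctured d) (dominant al A B).
Proof.
move=> al0; have [h _] := @punctured_powR R al d al0 d0.
have mD := @measurable_punctured R d.
apply: (@integrableD _ _ _ mu _ mD (EFin \o (fun t => M * B * `|t| `^ (al - 1)))
  (EFin \o (fun=> M * (A + A)))); last exact: punctured_intble_cst.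
exact: (@integrableZl _ _ _ mu _ mD (M * B) (EFin \o (fun t => `|t| `^ (al - 1)))).
Qed.

Lemma kernel_dominant (al A B t u v : R) : punctured d t ->
  `|u| <= A -> `|v| <= A -> `|u - v| <= B * `|t| `^ al ->
  `|k1 t * u + k2 t * v| <= dominant al A B t.
Proof.
move=> Dt uA vA uvB; apply: (le_trans (kM _ _ Dt)).
have t0 : 0 < `|t| by move: Dt => /andP[].
rewrite /dominant lerD//; last by rewrite ler_wpM2l// lerD.
rewrite -mulrA ler_wpM2l// ler_pdivrMr// -mulrA.
have E : `|t| `^ (al - 1) * `|t| = `|t| `^ al.
  by rewrite -{2}(powRr1 (ltW t0)) -powR_split// subrK.
by rewrite E.
Qed.

Variables U V : set R.
Hypothesis oU : open U.
Hypothesis oV : open V.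
Hypothesis cU : convex U.
Hypothesis cV : convex V.
Hypothesis VU : forall x t, V x -> `|t| < d -> U (x + t).

Let VUm x t : V x -> `|t| < d -> U (x - t).
Proof. by move=> Vx td; apply: VU; rewrite ?normrN. Qed.

Let VUD x t : V x -> punctured d t -> U (x + t) /\ U (x - t).
Proof. by move=> Vx /andP[_ td]; split; [exact: VU|exact: VUm]. Qed.

Lemma measurable_local_integrand f x : (forall y, U y -> {for y, continuous f}) -> V x ->
  measurable_fun (punctured d) (fun t => k1 t * f (x - t) + k2 t * f (x + t)).
Proof.
move=> fc Vx.
have H (s : R) : (s = 1 \/ s = -1) -> measurable_fun (punctured d) (fun t => f (x + s * t)).
  move=> s1.
  apply: (@measurable_funS _ _ _ _ `]-d, d[).
  - exact: measurable_itv.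
  - by move=> t /andP[_]; rewrite /= in_itv/= -ltr_norml.
  apply: open_continuous_measurable_fun; first exact: interval_open.
  move=> t; rewrite inE/= in_itv/= -ltr_norml => td.
  apply: continuous_comp.
    by apply: cvgD; [exact: cvg_cst|apply: cvgM; [exact: cvg_cst|exact: cvg_id]].
  apply: fc; apply: VU => //; case: s1 => ->; rewrite ?mul1r ?mulN1r ?normrN//.
apply: measurable_funD; apply: measurable_funM => //.
- apply: eq_measurable_fun (H (-1) (or_intror erefl)) => t _; by rewrite mulN1r.
- apply: eq_measurable_fun (H 1 (or_introl erefl)) => t _; by rewrite mul1r.
Qed.

Lemma local_integrand_dominant f al C x : holder_with U al C f -> V x ->
  forall t, punctured d t ->
  `|k1 t * f (x - t) + k2 t * f (x + t)| <= dominant al C (2 * C) t.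
Proof.
move=> [/andP[a0 a1] C0 fC fH] Vx t Dt; have [U1 U2] := VUD Vx Dt.
apply: kernel_dominant => //; [exact: fC|exact: fC|].
apply: (le_trans (fH _ _ U2 U1)).
have -> : x - t - (x + t) = - (2 * t) by ring.
rewrite normrN normrM normr_nat powRM// [2 * C]mulrC -mulrA ler_wpM2l//.
rewrite ler_wpM2r ?powR_ge0//.
by rewrite -[X in _ <= X](@powRr1 R 2)// ler_powR// ler1n.
Qed.

Lemma intble_local_integrand f x : holder U f -> V x ->
  intble (punctured d) (fun t => k1 t * f (x - t) + k2 t * f (x + t)).
Proof.
move=> fH Vx; have [al [C fH']] := fH; have [/andP[a0 _] _ _ _] := fH'.
apply: (le_intble _ _ (intble_dominant C (2 * C) a0)).
- exact: measurable_punctured.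
- by apply: measurable_local_integrand => //; exact: holder_cont.
- exact: local_integrand_dominant.
Qed.

(** With [D = |x - y|], the mixed difference of [f] over the steps [D] and [t] is of order
    [min(D, |t|) ^ al], hence of order [D ^ be * |t| ^ be] with [be = al / 2]. Half of the exponent
    gives the Hoelder bound, the other half keeps the integral in [t] convergent. *)
Lemma local_op_holder f : holder U f -> holder V (local_op f).
Proof.
move=> fH; have [al [C fH']] := fH; have [/andP[a0 a1] C0 fC fL] := fH'.
have mD := @measurable_punctured R d.
pose be := al / 2.
have be0 : 0 < be by rewrite /be; lra.
have [_ _ _ fL2] : holder_with U be (2 * C) f.
  by apply: holder_with_le fH'; rewrite /be; lra.
pose K1 := \int[mu]_(t in punctured d) dominant al C (2 * C) t.
pose K2 := \int[mu]_(t in punctured d) dominant be (2 * C) (4 * C) t.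
have domge0 a A B t : 0 <= A -> 0 <= B -> 0 <= dominant a A B t.
  by move=> A0 B0; rewrite /dominant addr_ge0 ?mulr_ge0 ?powR_ge0 ?addr_ge0.
have K10 : 0 <= K1 by apply: Rintegral_ge0 => t _; rewrite domge0//; lra.
have K20 : 0 <= K2 by apply: Rintegral_ge0 => t _; rewrite domge0//; lra.
have fc := holder_cont oU fH.
exists be, (K1 + K2); split.
- by rewrite be0 /be; lra.
- by rewrite addr_ge0.
- move=> x Vx; apply: (@le_trans _ _ K1); last by rewrite lerDl.
  apply: le_norm_int => //; [exact: measurable_local_integrand|
    exact: intble_dominant|exact: local_integrand_dominant].
- move=> x y Vx Vy; set D : R := `|x - y|.
  apply: (@le_trans _ _ (K2 * D `^ be)); last by rewrite ler_wpM2r ?powR_ge0// lerDr.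
  rewrite /local_op -RintegralB//; [|exact: intble_local_integrand..].
  rewrite /K2 -RintegralZr//; last exact: intble_dominant.
  apply: le_norm_int => //.
  + by apply: measurable_funB; apply: measurable_local_integrand.
  + by apply: (@integrableZr _ _ _ mu _ mD (D `^ be) (EFin \o dominant be (2 * C) (4 * C))) => //;
      exact: intble_dominant.
  move=> t Dt; have [Ux1 Ux2] := VUD Vx Dt; have [Uy1 Uy2] := VUD Vy Dt.
  have -> : k1 t * f (x - t) + k2 t * f (x + t) - (k1 t * f (y - t) + k2 t * f (y + t)) =
     k1 t * (f (x - t) - f (y - t)) + k2 t * (f (x + t) - f (y + t)) by ring.
  have -> : dominant be (2 * C) (4 * C) t * D `^ be =
     dominant be (2 * C * D `^ be) (4 * C * D `^ be) t by rewrite /dominant; ring.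
  have e1 : `|x - t - (y - t)| = D by rewrite /D; congr (`| _ |); ring.
  have e2 : `|x + t - (y + t)| = D by rewrite /D; congr (`| _ |); ring.
  apply: kernel_dominant => //.
  + by rewrite -e1; exact: fL2.
  + by rewrite -e2; exact: fL2.
  have t0 : 0 < `|t| by move: Dt => /andP[].
  have aE (z : R) : 0 <= z -> z `^ al = z `^ be * z `^ be.
    have -> : al = be + be by rewrite /be; lra.
    rewrite le_eqVlt => /predU1P[<-|z0]; last exact: powR_split.
    by rewrite !powR0 ?mulr0 ?gt_eqF// addr_gt0.
  (* The four values are paired across the shift [D] if [D <= |t|], across the shift [2 * t]
     otherwise. *)
  have [Dt1|Dt1] := leP D `|t|.
    apply: (@le_trans _ _ (2 * C * D `^ al)).
      have h1 := fL _ _ Ux2 Uy2; have h2 := fL _ _ Ux1 Uy1.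
      apply: (le_trans (ler_normB _ _)).
      by move: h1 h2; rewrite e1 e2; lra.
    have h : D `^ al <= D `^ be * `|t| `^ be.
      have D0 : 0 <= D by exact: normr_ge0.
      rewrite (aE D D0); apply: ler_wpM2l; first exact: powR_ge0.
      by apply: ge0_ler_powR => //; exact: ltW.
    have := ler_wpM2l C0 h.
    have : 0 <= C * (D `^ be * `|t| `^ be) by rewrite !mulr_ge0 ?powR_ge0.
    by lra.
  apply: (@le_trans _ _ (2 * C * (2 * `|t| `^ al))).
    have h1 := fL _ _ Ux2 Ux1; have h2 := fL _ _ Uy2 Uy1.
    have -> : f (x - t) - f (y - t) - (f (x + t) - f (y + t)) =
      (f (x - t) - f (x + t)) - (f (y - t) - f (y + t)) by ring.
    apply: (le_trans (ler_normB _ _)).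
    have E z : `|z - t - (z + t)| `^ al <= 2 * `|t| `^ al.
      have -> : z - t - (z + t) = - (2 * t) by ring.
      rewrite normrN normrM normr_nat powRM// ler_wpM2r ?powR_ge0//.
      by rewrite -[X in _ <= X](@powRr1 R 2)// ler_powR// ler1n.
    have := ler_wpM2l C0 (E x); have := ler_wpM2l C0 (E y).
    by lra.
  have h : `|t| `^ al <= D `^ be * `|t| `^ be.
    rewrite (aE _ (ltW t0)); apply: ler_wpM2r; first exact: powR_ge0.
    by apply: ge0_ler_powR; rewrite ?nnegrE; [exact: ltW|exact: ltW|exact: normr_ge0|exact: ltW].
  by have := ler_wpM2l C0 h; lra.
Qed.

(** The majorant for [dui] keeps the cancellation: the mixed difference is an increment of
    [s |-> f (s - t) - f (s + t)], whose derivative is a difference of [g] over [2 * t]. *)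
Lemma local_op_derive f g x : holder U f -> (forall y, U y -> is_derive y 1 f (g y)) ->
  holder U g -> V x -> is_derive x 1 (local_op f) (local_op g x).
Proof.
move=> fH fg gH Vx; have [al [C gH']] := gH; have [/andP[a0 a1] C0 gC gL] := gH'.
have [r r0 Vr] : exists2 r, 0 < r & forall y, `|y - x| < r -> V y.
  have /nbhs_ballP[r r0 h] := open_nbhs_nbhs (conj oV Vx).
  by exists r => // y yr; apply: h; rewrite /ball /= distrC.
apply: (@dui R (punctured d) _ x r _ (dominant al C (2 * C))) => //.
- exact: measurable_punctured.
- by move=> y /Vr Vy; exact: intble_local_integrand.
- exact: intble_dominant.
- move=> y t yx Dt; have Vy := Vr _ yx.
  have [Ux1 Ux2] := VUD Vx Dt; have [Uy1 Uy2] := VUD Vy Dt.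
  have -> : k1 t * f (y - t) + k2 t * f (y + t) - (k1 t * f (x - t) + k2 t * f (x + t)) =
     k1 t * (f (y - t) - f (x - t)) + k2 t * (f (y + t) - f (x + t)) by ring.
  have -> : `|y - x| * dominant al C (2 * C) t =
     dominant al (C * `|y - x|) (2 * C * `|y - x|) t by rewrite /dominant; ring.
  have e1 : `|y - t - (x - t)| = `|y - x| by congr (`| _ |); ring.
  have e2 : `|y + t - (x + t)| = `|y - x| by congr (`| _ |); ring.
  apply: kernel_dominant => //.
  + by rewrite -e1; apply: (lip_deriv cU fg gC).
  + by rewrite -e2; apply: (lip_deriv cU fg gC).
  have -> : f (y - t) - f (x - t) - (f (y + t) - f (x + t)) =
      (f (y - t) - f (y + t)) - (f (x - t) - f (x + t)) by ring.
  rewrite mulrAC.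
  apply: (@lip_deriv R V (fun s => f (s - t) - f (s + t)) (fun s => g (s - t) - g (s + t))) => //.
  + move=> s Vs; have [Us1 Us2] := VUD Vs Dt.
    by apply: is_deriveB; apply: is_derive_shift_pt; exact: fg.
  + move=> s Vs; have [Us1 Us2] := VUD Vs Dt.
    apply: (le_trans (gL _ _ Us2 Us1)).
    have -> : s - t - (s + t) = - (2 * t) by ring.
    rewrite normrN normrM normr_nat powRM// [2 * C]mulrC -mulrA ler_wpM2l// ler_wpM2r ?powR_ge0//.
    by rewrite -[X in _ <= X](@powRr1 R 2)// ler_powR// ler1n.
- move=> t Dt; have [U1 U2] := VUD Vx Dt.
  by apply: is_deriveD_pt; apply: is_deriveZ_pt; apply: is_derive_shift_pt; exact: fg.
Qed.

Lemma local_op_Cn n f : Cn U n f -> Cn V n (local_op f).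
Proof.
elim: n f => [|n IH] f; first exact: local_op_holder.
move=> [fH [g fg gC]]; split; first exact: local_op_holder.
exists (local_op g); last exact: IH.
by move=> x Vx; apply: local_op_derive => //; exact: Cn_holder gC.
Qed.

End LocalOperator.

(** * The logarithmic potential and the Hilbert transform *)

Section Kernels.
Variable R : realType.
Notation mu := (@lebesgue_measure R).
Notation intble D f := (mu.-integrable D (EFin \o f)).

(** Each increment of [F] from [a] is an increment of [A] or one of [B], and both have slope [l]. *)
Lemma is_derive_glue (F A B : R -> R) (a r l : R) : 0 < r ->
  (forall t, `|t - a| < r -> F t = A t \/ F t = B t) -> F a = A a -> F a = B a ->
  is_derive a 1 A l -> is_derive a 1 B l -> is_derive a 1 F l.
Proof.
move=> r0 FAB FA FB /is_derive_epsP HA /is_derive_epsP HB; apply/is_derive_epsP => e e0.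
have [d1 d10 H1] := HA e e0; have [d2 d20 H2] := HB e e0.
exists (Num.min r (Num.min d1 d2)); first by rewrite !lt_min r0 d10.
move=> h; rewrite !lt_min => /andP[hr /andP[h1 h2]].
have [|->|->] := FAB (a + h); first by rewrite addrC addKr.
  by rewrite FA; exact: H1.
by rewrite FB; exact: H2.
Qed.

Lemma is_derive_comp_pt (f g : R -> R) (x a b : R) : is_derive x 1 g b ->
  is_derive (g x) 1 f a -> is_derive x 1 (fun x => f (g x)) (a * b).
Proof.
move=> gb fa.
exact: (is_derive1_comp fa gb).
Qed.

Lemma is_derive_local (F A : R -> R) (a r l : R) : 0 < r ->
  (forall t, `|t - a| < r -> F t = A t) -> is_derive a 1 A l -> is_derive a 1 F l.
Proof.
move=> r0 FA Al.
have Fa : F a = A a by apply: FA; rewrite subrr normr0.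
by apply: (@is_derive_glue F A A a r l) => // t /FA ->; left.
Qed.

Lemma lip_continuous (f : R -> R) (C : R) : (forall x y, `|f x - f y| <= C * `|x - y|) ->
  continuous f.
Proof.
move=> fC x; apply/cvgrPdist_le => e e0.
have C1 : 0 < `|C| + 1 by rewrite ltr_wpDl.
near=> y.
have xy : `|x - y| <= e / (`|C| + 1).
  by near: y; apply: cvgr_dist_le; rewrite ?divr_gt0.
apply: (le_trans (fC x y)).
apply: (@le_trans _ _ ((`|C| + 1) * (e / (`|C| + 1)))); last by rewrite mulrC divfK// gt_eqF.
have h : C <= `|C| + 1 by rewrite (le_trans (ler_norm C))// lerDl.
apply: (le_trans (ler_wpM2r _ h)) => //.
by rewrite ler_wpM2l// ltW.
Unshelve. all: end_near. Qed.

Lemma is_derive_sqr (t : R) : is_derive t 1 (fun t : R => t ^+ 2) (2 * t).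
Proof.
have -> : (fun t : R => t ^+ 2) = (fun t : R => t * t) by apply/funext => s; rewrite expr2.
have id1 : is_derive t 1 (fun t : R => t) 1 by exact: is_derive_id.
have := is_deriveM_pt id1 id1; rewrite mul1r mulr1 => h; apply: (is_derive_eq h); ring.
Qed.

(* [kap d] is 1/t outside [|t| < d], continued linearly; its antiderivative [ell d] equals
   ln |t| there. *)
Definition mx (d t : R) : R := Num.max `|t| d.
Definition kap (d t : R) : R := t / mx d t ^+ 2.

Section mx.
Variable d : R.
Hypothesis d0 : 0 < d.

Lemma mx_ged t : d <= mx d t. Proof. by rewrite /mx le_max lexx orbT. Qed.
Lemma mx_genorm t : `|t| <= mx d t. Proof. by rewrite /mx le_max lexx. Qed.
Lemma mx_gt0 t : 0 < mx d t. Proof. exact: lt_le_trans (mx_ged t). Qed.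

Lemma mx_sqr_ge t : t ^+ 2 <= mx d t ^+ 2.
Proof. by rewrite -(real_normK (num_real t)) lerXn2r ?nnegrE ?mx_genorm// ltW// mx_gt0. Qed.

Lemma mx_sqr_ged t : d ^+ 2 <= mx d t ^+ 2.
Proof. by rewrite lerXn2r ?nnegrE ?mx_ged// ltW// mx_gt0. Qed.

Lemma mx_sqr_or t : mx d t ^+ 2 = t ^+ 2 \/ mx d t ^+ 2 = d ^+ 2 .
Proof.
rewrite /mx; case: leP => _; [by right|left]; by rewrite real_normK ?num_real.
Qed.

Lemma kapN t : kap d (- t) = - kap d t.
Proof. by rewrite /kap /mx normrN mulNr. Qed.

Lemma kap_in t : `|t| <= d -> kap d t = t / d ^+ 2.
Proof. by move=> td; rewrite /kap /mx max_r. Qed.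

Lemma kap_out t : d <= `|t| -> kap d t = t^-1.
Proof.
move=> td; rewrite /kap /mx max_l// real_normK ?num_real//.
have t0 : t != 0 by rewrite -normr_gt0 (lt_le_trans d0).
by rewrite expr2 invfM mulrA divff// mul1r.
Qed.

Lemma kap_le t : `|kap d t| <= (mx d t)^-1.
Proof.
rewrite /kap normrM normfV (ger0_norm (sqr_ge0 _)) ler_pdivrMr ?exprn_gt0 ?mx_gt0//.
by rewrite expr2 mulrA mulVf ?mul1r ?mx_genorm// gt_eqF// mx_gt0.
Qed.

Lemma kap_led t : `|kap d t| <= d^-1.
Proof. by apply: (le_trans (kap_le t)); rewrite lef_pV2 ?posrE ?mx_gt0// mx_ged. Qed.

Lemma kap_lenorm t : t != 0 -> `|kap d t| <= `|t|^-1.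
Proof.
move=> t0; apply: (le_trans (kap_le t)).
by rewrite lef_pV2 ?posrE ?mx_gt0 ?normr_gt0// mx_genorm.
Qed.

(** The identity [1/t - 1/s = (s - t) / (t * s)] survives truncation as an inequality, with [mx] in
    the denominator. *)
Lemma kap_lip t s : `|kap d t - kap d s| <= `|t - s| / (mx d t * mx d s).
Proof.
have mt := mx_gt0 t; have ms := mx_gt0 s.
have -> : kap d t - kap d s =
   (t * mx d s ^+ 2 - s * mx d t ^+ 2) / (mx d t * mx d s) ^+ 2.
  by rewrite /kap; field; rewrite !gt_eqF.
have m0 : 0 < mx d t * mx d s by rewrite mulr_gt0.
rewrite normrM normfV (ger0_norm (sqr_ge0 _)) ler_pdivrMr ?exprn_gt0//.
rewrite [X in _ <= X](_ : _ = `|t - s| * (mx d t * mx d s)); last by field; rewrite !gt_eqF.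
suff : `|t * mx d s ^+ 2 - s * mx d t ^+ 2| ^+ 2 <= (`|t - s| * (mx d t * mx d s)) ^+ 2.
  by rewrite ler_sqr ?nnegrE ?mulr_ge0 ?(ltW mt) ?(ltW ms).
rewrite exprMn !real_normK ?num_real// exprMn.
have a1 := mx_sqr_ge t; have b1 := mx_sqr_ge s.
have a2 := mx_sqr_ged t; have b2 := mx_sqr_ged s.
set a := mx d t ^+ 2 in a1 a2 *; set b := mx d s ^+ 2 in b1 b2 *.
have a0 : 0 < a by rewrite exprn_gt0.
have b0 : 0 < b by rewrite exprn_gt0.
(* This product is the left side minus the right side of the squared inequality. *)
suff : (b - a) * (t ^+ 2 * b - s ^+ 2 * a) <= 0 by nra.
have [Ea|Ea] := mx_sqr_or t; have [Eb|Eb] := mx_sqr_or s; rewrite -/a in Ea; rewrite -/b in Eb.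
- by rewrite Ea Eb; nra.
- have -> : t ^+ 2 * b - s ^+ 2 * a = t ^+ 2 * (b - s ^+ 2) by rewrite Ea; ring.
  have : b - a <= 0 by lra.
  have : 0 <= t ^+ 2 * (b - s ^+ 2) by rewrite mulr_ge0 ?sqr_ge0 ?subr_ge0.
  by move=> ? ?; rewrite mulr_le0_ge0.
- have -> : t ^+ 2 * b - s ^+ 2 * a = s ^+ 2 * (t ^+ 2 - a) by rewrite Eb; ring.
  have : 0 <= b - a by lra.
  have : s ^+ 2 * (t ^+ 2 - a) <= 0 by rewrite mulr_ge0_le0 ?sqr_ge0 ?subr_le0.
  by move=> ? ?; rewrite mulr_ge0_le0.
- by rewrite Ea Eb subrr mul0r.
Qed.

(** Dominates [mx d (x - y) ^- 2] for all [|x| <= X] at once by a multiple of the integrable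
    [1 / (1 + y^2)]; see [mx_env]. *)
Definition envC (X : R) : R := (1 + 2 * X ^+ 2) / d ^+ 2 + 2.

Lemma envC_ge0 X : 0 <= envC X.
Proof. by rewrite addr_ge0// divr_ge0 ?sqr_ge0// addr_ge0// mulr_ge0// sqr_ge0. Qed.

Lemma mx_env X x y : `|x| <= X -> (mx d (x - y) ^+ 2)^-1 <= envC X * (1 + y ^+ 2)^-1.
Proof.
move=> xX.
have m0 := mx_gt0 (x - y).
have y0 : 0 < 1 + y ^+ 2 by rewrite ltr_pwDl// sqr_ge0.
rewrite ler_pdivlMr// mulrC ler_pdivrMr ?exprn_gt0//.
have x2 : x ^+ 2 <= X ^+ 2.
  by rewrite -(real_normK (num_real x)) lerXn2r ?nnegrE// (le_trans _ xX).
have h1 := mx_sqr_ge (x - y); have h2 := mx_sqr_ged (x - y).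
have h3 : 1 + 2 * X ^+ 2 <= (1 + 2 * X ^+ 2) / d ^+ 2 * mx d (x - y) ^+ 2.
  rewrite -mulrA ler_peMr//; first by rewrite addr_ge0// mulr_ge0// sqr_ge0.
  by rewrite mulrC ler_pdivlMr ?exprn_gt0// mul1r.
rewrite /envC mulrDl.
have h4 : y ^+ 2 <= 2 * x ^+ 2 + 2 * (x - y) ^+ 2.
  have := sqr_ge0 (2 * x - y); rewrite -subr_ge0. nra.
lra.
Qed.

Lemma kap_pow_le (j : nat) t : (2 <= j)%N -> `|kap d t ^+ j| <= (d^-1) ^+ (j - 2) * (mx d t ^+ 2)^-1.
Proof.
move=> j2; rewrite -{1}(subnK j2) exprD normrM !normrX; apply: ler_pM; rewrite ?exprn_ge0//.
  by apply: lerXn2r; rewrite ?nnegrE ?invr_ge0 ?(ltW d0)//; exact: kap_led.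
by rewrite -exprVn; apply: lerXn2r; rewrite ?nnegrE ?invr_ge0 ?(ltW (mx_gt0 _))//; exact: kap_le.
Qed.

Lemma subrX_le (u v c : R) (j : nat) : `|u| <= c -> `|v| <= c ->
  `|u ^+ j - v ^+ j| <= j%:R * c ^+ j.-1 * `|u - v|.
Proof.
move=> uc vc; have c0 : 0 <= c by exact: le_trans uc.
elim: j => [|j IH]; first by rewrite !expr0 subrr normr0 !mul0r.
have -> : u ^+ j.+1 - v ^+ j.+1 = u ^+ j * (u - v) + v * (u ^+ j - v ^+ j).
  by rewrite !exprS; ring.
apply: (le_trans (ler_normD _ _)); rewrite !normrM.
have h1 : `|u ^+ j| * `|u - v| <= c ^+ j * `|u - v|.
  by rewrite ler_wpM2r// normrX lerXn2r ?nnegrE.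
have h2 : `|v| * `|u ^+ j - v ^+ j| <= c * (j%:R * c ^+ j.-1 * `|u - v|).
  exact: ler_pM.
apply: (le_trans (lerD h1 h2)) => /=.
case: j {IH h1 h2} => [|j] /=; first by rewrite expr0 !mul0r mulr0 addr0 !mul1r.
by rewrite [X in _ <= X](_ : _ = c ^+ j.+1 * `|u - v| + c * (j.+1%:R * c ^+ j * `|u - v|))//
  exprS -(natr1 j.+1); ring.
Qed.

(** A Lipschitz bound in the parameter with constant integrable in [y], the form that [dui_null]
    consumes. The product of two truncations is split by [2 * p * q <= p^2 + q^2]. *)
Lemma kap_pow_lip X x z y (j : nat) : `|x| <= X -> `|z| <= X ->
  `|kap d (z - y) ^+ j - kap d (x - y) ^+ j| <=
    `|z - x| * (j%:R * (d^-1) ^+ j.-1 * envC X * (1 + y ^+ 2)^-1).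
Proof.
move=> xX zX; apply: (le_trans (subrX_le j (kap_led _) (kap_led _))).
have c0 : 0 <= j%:R * (d^-1) ^+ j.-1 by rewrite mulr_ge0// exprn_ge0// invr_ge0 ltW.
rewrite [X in _ <= X](_ : _ = j%:R * (d^-1) ^+ j.-1 * (`|z - x| * (envC X * (1 + y ^+ 2)^-1))); last by ring.
rewrite ler_wpM2l//; apply: (le_trans (kap_lip _ _)).
have -> : z - y - (x - y) = z - x by ring.
rewrite ler_wpM2l//.
have h1 := mx_env y xX; have h2 := mx_env y zX.
have mt := mx_gt0 (z - y); have ms := mx_gt0 (x - y).
have : (mx d (z - y) * mx d (x - y))^-1 <= 2^-1 * ((mx d (z - y) ^+ 2)^-1 + (mx d (x - y) ^+ 2)^-1).
  rewrite invfM -!exprVn; set p := (mx d (z - y))^-1; set q := (mx d (x - y))^-1.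
  have := sqr_ge0 (p - q). nra.
lra.
Qed.

Lemma kap_continuous : continuous (kap d).
Proof.
apply: (@lip_continuous _ (d ^- 2)) => x y; apply: (le_trans (kap_lip _ _)).
rewrite mulrC ler_wpM2r// lef_pV2 ?posrE ?mulr_gt0 ?exprn_gt0 ?mx_gt0//.
by rewrite expr2; apply: ler_pM; rewrite ?(ltW d0)//; exact: mx_ged.
Qed.

Lemma kap_pow_measurable j : measurable_fun setT (fun t => kap d t ^+ j).
Proof.
apply: continuous_measurable_fun => x; apply: (@continuous_comp _ _ _ (kap d) (fun t => t ^+ j)).
  exact: kap_continuous.
exact: exprn_continuous.
Qed.

Definition ell (t : R) : R :=
  if `|t| <= d then ln d - 2^-1 + 2^-1 * t ^+ 2 / d ^+ 2 else 2^-1 * ln (t ^+ 2).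

Lemma is_derive_halfln (t : R) : t != 0 ->
  is_derive t 1 (fun t : R => 2^-1 * ln (t ^+ 2)) t^-1.
Proof.
move=> t0.
have t2 : 0 < t ^+ 2 by rewrite lt_neqAle sqr_ge0 eq_sym expf_neq0.
have H : is_derive t 1 (fun t : R => t ^+ 2) (2 * t).
  exact: is_derive_sqr.
have H2 := is_derive1_ln t2.
have H3 : is_derive t 1 (fun t : R => ln (t ^+ 2)) ((t ^+ 2)^-1 * (2 * t)).
  exact: (is_derive_comp_pt H H2).
have := is_deriveZ_pt 2^-1 H3 => h; apply: (is_derive_eq h); field; exact: t0.
Qed.

(** Parabola and logarithm meet at [|t| = d] with equal values and equal slopes, so that case is a
    gluing. *)
Lemma ell_derive (t : R) : is_derive t 1 ell (kap d t).
Proof.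
pose A (t : R) := ln d - 2^-1 + 2^-1 * t ^+ 2 / d ^+ 2.
pose B (t : R) := 2^-1 * ln (t ^+ 2).
have HA : is_derive t 1 A (t / d ^+ 2).
  have -> : A = (fun t => (ln d - 2^-1) + (2^-1 / d ^+ 2) * t ^+ 2).
    by apply/funext => s; rewrite /A; ring.
  have := is_deriveD_pt (is_derive_cst_pt (ln d - 2^-1) t) (is_deriveZ_pt (2^-1 / d ^+ 2) (is_derive_sqr t)).
  by move=> h; apply: (is_derive_eq h); field; rewrite gt_eqF.
have HB : t != 0 -> is_derive t 1 B t^-1 := @is_derive_halfln t.
have [td|td|td] := ltgtP `|t| d.
- rewrite kap_in ?ltW//; apply: (@is_derive_local _ A t (d - `|t|)) => //; first by rewrite subr_gt0.
  move=> s st; rewrite /ell ifT// -[s](subrK t) (le_trans (ler_normD _ _))//; lra.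
- rewrite kap_out ?ltW//; apply: (@is_derive_local _ B t (`|t| - d)); first by rewrite subr_gt0.
    move=> s st; rewrite /ell ifF//; apply/negbTE; rewrite -ltNge.
    have := ler_normB t (t - s); rewrite subKr.
    have := ler_normD s (t - s); rewrite addrCA subrr addr0 distrC. lra.
  by apply: HB; rewrite -normr_gt0 (lt_trans d0).
- have t0 : t != 0 by rewrite -normr_gt0 td.
  have td2 : t ^+ 2 = d ^+ 2 by rewrite -td real_normK ?num_real.
  rewrite kap_in ?td//; apply: (@is_derive_glue _ A B t 1) => //.
  + by move=> s _; rewrite /ell; case: ifP => _; [left|right].
  + by rewrite /ell td lexx.
  + rewrite /ell td lexx /B td2 -mulrA divff ?gt_eqF ?exprn_gt0// mulr1 expr2 lnM ?posrE//; lra.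
  + have -> : t / d ^+ 2 = t^-1 by rewrite -td2; field.
    exact: HB.
Qed.

End mx.
End Kernels.

(** * Symmetrised convolutions with an even bounded function *)

Section PairIntegral.
Variable R : realType.
Notation mu := (@lebesgue_measure R).
Notation intble D f := (mu.-integrable D (EFin \o f)).

Lemma intbleZl D c (f : R -> R) : measurable D -> intble D f -> intble D (fun y => c * f y).
Proof. by move=> mD h; exact: (@integrableZl _ _ _ mu D mD c (EFin \o f)). Qed.

Lemma intbleD D (f g : R -> R) : measurable D -> intble D f -> intble D g ->
  intble D (fun y => f y + g y).
Proof. by move=> mD h1 h2; exact: (@integrableD _ _ _ mu D mD (EFin \o f) (EFin \o g)). Qed.

Lemma intbleB D (f g : R -> R) : measurable D -> intble D f -> intble D g ->
  intble D (fun y => f y - g y).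
Proof. by move=> mD h1 h2; exact: (@integrableB _ _ _ mu D mD (EFin \o f) (EFin \o g)). Qed.

Lemma norm_neq (z d : R) : z != d -> z != - d -> `|z| != d.
Proof.
by move=> h1 h2; have [z0|z0] := ltP z 0; [rewrite ltr0_norm// eqr_oppLR|rewrite ger0_norm].
Qed.

Lemma eq_intble D (f g : R -> R) : measurable D -> (forall y, f y = g y) -> intble D f -> intble D g.
Proof. by move=> mD /funext ->. Qed.

Lemma shift_measurable (k : R -> R) (x : R) : measurable_fun setT k ->
  measurable_fun setT (fun y : R => k (x + y)).
Proof.
move=> mk; apply: (measurableT_comp mk).
by apply: measurable_funD => //; exact: measurable_cst.
Qed.

Lemma reflect_fun_measurable (k : R -> R) (x : R) : measurable_fun setT k ->
  measurable_fun setT (fun y : R => k (x - y)).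
Proof. by move=> mk; apply: (measurableT_comp mk); exact: reflect_measurable. Qed.

Lemma shift_intble (k : R -> R) (x : R) : intble setT k -> intble setT (fun y => k (x + y)).
Proof.
move=> ik.
by apply: eq_intble (reflect_intble 0 (reflect_intble x ik)) => // y; rewrite sub0r opprK.
Qed.

Lemma shift_int (k : R -> R) (x : R) : intble setT k -> \int[mu]_y k (x + y) = \int[mu]_y k y.
Proof.
move=> ik; rewrite -[RHS](reflect_int x ik) -[RHS](reflect_int 0 (reflect_intble x ik)).
by apply: eq_Rintegral => y _; rewrite sub0r opprK.
Qed.

Lemma ae_int (N : set R) (f g : R -> R) : measurable N -> mu N = 0%E ->
  measurable_fun setT f -> intble setT g -> (forall y, ~ N y -> f y = g y) ->
  intble setT f /\ \int[mu]_y f y = \int[mu]_y g y.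
Proof.
move=> mN N0 mf ig fg.
have mC : measurable (~` N) by exact: measurableC.
have i1 : intble (~` N) f.
  apply: (@eq_integrable _ _ _ mu _ mC (EFin \o g)); last exact: intbleS.
  by move=> y; rewrite inE => yN; rewrite /= fg.
have iF : intble setT f.
  rewrite (@negligible_integrable _ _ _ mu setT N)//.
  - by rewrite setTD.
  - exact/measurable_EFinP.
split => //.
rewrite -(Rint_null mN N0 iF) -(Rint_null mN N0 ig).
by apply: eq_Rintegral => y; rewrite inE => yN; exact: fg.
Qed.

Lemma finite_null (s : seq R) : measurable [set y | y \in s] /\ mu [set y | y \in s] = 0%E.
Proof.
have c : countable [set y : R | y \in s].
  by apply: finite_set_countable; exact: finite_seq.
split; last exact: countable_lebesgue_measure0.
exact: countable_measurable.
Qed.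

Variable w : R -> R.
Hypothesis wev : forall x, w (- x) = w x.
Hypothesis wb : forall x, `|w x| <= 1.
Hypothesis wm : measurable_fun setT w.

(** For even [w] and integrable [k] this is the convolution of [k] with [w]. The symmetrised form
    still converges for [kap d], which is odd and decays only like 1/t: there
    [k (x - y) + k (x + y)] is of order [y^-2]. *)
Definition pair_int (k : R -> R) (x : R) : R := 2^-1 * \int[mu]_y ((k (x - y) + k (x + y)) * w y).

Notation pintble k x := (intble setT (fun y => (k (x - y) + k (x + y)) * w y)).

Lemma pair_measurable (k : R -> R) (x : R) : measurable_fun setT k ->
  measurable_fun setT (fun y : R => (k (x - y) + k (x + y)) * w y).
Proof.
move=> mk; apply: measurable_funM => //; apply: measurable_funD.
  exact: reflect_fun_measurable.
exact: shift_measurable.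
Qed.

Lemma mul_w_le (z y : R) : `|z * w y| <= `|z|.
Proof. by rewrite normrM ler_piMr. Qed.

Lemma le_pintble (k G : R -> R) (x : R) : measurable_fun setT k -> intble setT G ->
  (forall y, `|k (x - y) + k (x + y)| <= G y) -> pintble k x.
Proof.
move=> mk iG kG; apply: (le_intble measurableT (pair_measurable _ mk) iG) => y _.
by apply: (le_trans (mul_w_le _ _)).
Qed.

Lemma pair_intD (k1 k2 : R -> R) (x : R) : pintble k1 x -> pintble k2 x ->
  pair_int (fun t => k1 t + k2 t) x = pair_int k1 x + pair_int k2 x.
Proof.
move=> i1 i2; rewrite /pair_int -mulrDr -RintegralD//; congr (_ * _).
by apply: eq_Rintegral => y _; ring.
Qed.

Lemma pair_intZ (c : R) (k : R -> R) (x : R) : pintble k x ->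
  pair_int (fun t => c * k t) x = c * pair_int k x.
Proof.
move=> i1; rewrite /pair_int [RHS]mulrCA -[in RHS]RintegralZl//; congr (_ * _).
by apply: eq_Rintegral => y _; ring.
Qed.

Lemma pintble_intble (k : R -> R) (x : R) : intble setT k -> pintble k x.
Proof.
move=> ik.
have a1 := @integrable_norm _ _ _ mu setT k ik.
apply: (@le_pintble k (fun y => `|k (x - y)| + `|k (x + y)|)).
- exact: (intble_meas ik).
- apply: intbleD => //.
    exact: (reflect_intble x a1).
  exact: (shift_intble x a1).
- by move=> y; exact: ler_normD.
Qed.

Lemma conv_intble (k : R -> R) (x : R) : intble setT k -> intble setT (fun y => k (x - y) * w y).
Proof.
move=> ik; have a1 := reflect_intble x (@integrable_norm _ _ _ mu setT k ik).
apply: (le_intble measurableT _ a1) => [|y _]; last exact: mul_w_le.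
by apply: measurable_funM => //; apply: reflect_fun_measurable; exact: (intble_meas ik).
Qed.

Lemma pair_int_conv (k : R -> R) (x : R) : intble setT k ->
  pair_int k x = \int[mu]_t (k t * w (x - t)).
Proof.
move=> ik.
have i1 := conv_intble x ik.
have e1 : \int[mu]_y (k (x + y) * w y) = \int[mu]_y (k (x - y) * w y).
  by rewrite -(reflect_int 0 i1); apply: eq_Rintegral => y _; rewrite sub0r opprK wev.
have i2 : intble setT (fun y => k (x + y) * w y).
  by apply: eq_intble (reflect_intble 0 i1) => // y; rewrite sub0r opprK wev.
have i3 : intble setT (fun t => k t * w (x - t)).
  by apply: eq_intble (reflect_intble x i1) => // y; rewrite subKr.
rewrite /pair_int.
have -> : \int[mu]_y ((k (x - y) + k (x + y)) * w y) =
   \int[mu]_y (k (x - y) * w y) + \int[mu]_y (k (x + y) * w y).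
  by rewrite -RintegralD//; apply: eq_Rintegral => y _; ring.
rewrite e1 -(reflect_int x i3).
under [in RHS]eq_Rintegral do rewrite subKr.
lra.
Qed.

Lemma pair_int_loc (c : R -> R) (d x : R) : intble (punctured d) c ->
  pair_int (c \_ (punctured d)) x = \int[mu]_(t in punctured d) (c t * w (x - t)).
Proof.
move=> ic; have mD := @measurable_punctured R d.
rewrite pair_int_conv; last by apply: (proj1 (intble_restrict _ _)).
rewrite [RHS]Rintegral_mkcond; apply: eq_Rintegral => t _.
by rewrite !patchE; case: ifP => // _; rewrite mul0r.
Qed.

Lemma punctured_reflect_int (g : R -> R) (d : R) : intble (punctured d) g ->
  \int[mu]_(t in punctured d) g t = \int[mu]_(t in punctured d) g (- t).
Proof.
move=> ig; have mD := @measurable_punctured R d.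
rewrite Rintegral_mkcond [RHS]Rintegral_mkcond -(reflect_int 0); last by apply: (proj1 (intble_restrict _ _)).
apply: eq_Rintegral => t _; rewrite sub0r !patchE.
congr (if _ then _ else _); apply/idP/idP; rewrite !inE /punctured/= normrN//.
Qed.

(** Averaging over [t] and [- t] moves the cancellation of an odd kernel into the integrand, as
    [local_op] expects. *)
Lemma pair_int_loc_odd (c : R -> R) (d x : R) : (forall t, c (- t) = - c t) ->
  intble (punctured d) c ->
  pair_int (c \_ (punctured d)) x =
  local_op (fun t => 2^-1 * c t) (fun t => - (2^-1 * c t)) d w x.
Proof.
move=> codd ic; have mD := @measurable_punctured R d.
have i1 : intble (punctured d) (fun t => c t * w (x - t)).
  apply: (le_intble mD _ (@integrable_norm _ _ _ mu _ c ic)).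
    apply: measurable_funM; first exact: (intble_meas ic).
    by apply: measurable_funTS; exact: reflect_fun_measurable.
  by move=> t _; exact: mul_w_le.
have i2 : intble (punctured d) (fun t => c t * w (x + t)).
  apply: (le_intble mD _ (@integrable_norm _ _ _ mu _ c ic)).
    apply: measurable_funM; first exact: (intble_meas ic).
    by apply: measurable_funTS; exact: shift_measurable.
  by move=> t _; exact: mul_w_le.
rewrite pair_int_loc// /local_op.
have -> : \int[mu]_(t in punctured d) (2^-1 * c t * w (x - t) + - (2^-1 * c t) * w (x + t)) =
   2^-1 * (\int[mu]_(t in punctured d) (c t * w (x - t)) - \int[mu]_(t in punctured d) (c t * w (x + t))).
  rewrite -RintegralB// -RintegralZl//; last exact: intbleB.
  by apply: eq_Rintegral => t _; ring.
rewrite (punctured_reflect_int i2).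
have -> : \int[mu]_(t in punctured d) (c (- t) * w (x + - t)) = - \int[mu]_(t in punctured d) (c t * w (x - t)).
  rewrite -[RHS]mulN1r -RintegralZl//; apply: eq_Rintegral => t _.
  by rewrite codd; ring.
lra.
Qed.

Section far.
Variable d : R.
Hypothesis d0 : 0 < d.

Notation Q j := (pair_int (fun t => kap d t ^+ j)).

Lemma kap_pow_pair_le (X x y : R) j : `|x| <= X -> (0 < j)%N ->
  `|kap d (x - y) ^+ j + kap d (x + y) ^+ j| <=
     2 * (X + 1) * (j%:R * d^-1 ^+ j.-1 + d^-1 ^+ (j - 2)) * envC d X * (1 + y ^+ 2)^-1.
Proof.
move=> xX j0.
have X0 : 0 <= X by apply: le_trans xX.
have di0 : 0 <= d^-1 by rewrite invr_ge0 ltW.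
have e0 := envC_ge0 d X.
have y0 : 0 <= (1 + y ^+ 2)^-1 by rewrite invr_ge0 addr_ge0// sqr_ge0.
have B0 : 0 <= envC d X * (1 + y ^+ 2)^-1 by rewrite mulr_ge0.
set B := envC d X * (1 + y ^+ 2)^-1 in B0 *.
rewrite -mulrA -/B.
(* For [j = 1] the decay comes from oddness: the sum is [kap d (x - y) - kap d (- x - y)], an
   increment over [2 * x]. From [j = 2] on each term decays by itself. *)
have [j1|j1] := eqVneq j 1%N.
  rewrite j1 (_ : (1 - 2 = 0)%N)// /= !expr0 !expr1.
  have nxX : `|- x| <= X by rewrite normrN.
  have := @kap_pow_lip _ d d0 X (- x) x y 1 nxX xX.
  rewrite !expr1 /= expr0 !mulr1 mul1r -/B.
  have -> : kap d (- x - y) = - kap d (x + y) by rewrite -kapN; congr (kap d _); ring.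
  rewrite opprK => /le_trans; apply.
  have -> : x - - x = 2 * x by ring.
  rewrite normrM normr_nat.
  by nra.
have j2 : (2 <= j)%N by case: j j0 j1 => [|[|]].
have h1 := kap_pow_le d0 (x - y) j2.
have h2 := kap_pow_le d0 (x + y) j2.
have h3 := mx_env d0 y xX.
have h4 := mx_env d0 (- y) xX.
rewrite opprK sqrrN in h4.
have p0 : 0 <= d^-1 ^+ (j - 2) by rewrite exprn_ge0.
have p1 : 0 <= d^-1 ^+ j.-1 by rewrite exprn_ge0.
have pj : 0 <= j%:R * d^-1 ^+ j.-1 by rewrite mulr_ge0.
apply: (le_trans (ler_normD _ _)).
have h5 := ler_wpM2l p0 h3; have h6 := ler_wpM2l p0 h4.
rewrite -/B in h5 h6.
apply: (@le_trans _ _ (2 * (d^-1 ^+ (j - 2) * B))); first by lra.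
rewrite -!mulrA ler_pM2l// mulrA ler_wpM2r//.
set p := d^-1 ^+ (j - 2) in p0 *; set q := j%:R * _ in pj *.
by nra.
Qed.

Lemma kap_pow_pintble j (x : R) : (0 < j)%N -> pintble (fun t => kap d t ^+ j) x.
Proof.
move=> j0; apply: (le_pintble _ (intbleZl _ measurableT (@intble_oneDsqrV R))).
  exact: kap_pow_measurable.
move=> y; exact: kap_pow_pair_le.
Qed.

(** Correction on [|t| < d] to the rule that the derivative of [kap ^ j] is [- j * kap ^ (j + 1)]:
    there [kap d] has slope [d^-2] and not [- kap ^ 2]. *)
Definition jump (j : nat) (t : R) : R := j%:R * kap d t ^+ j.-1 * (kap d t ^+ 2 + d ^- 2).

Lemma jump_measurable j : measurable_fun setT (jump j).
Proof.
apply: measurable_funM; last by apply: measurable_funD => //; exact: kap_pow_measurable.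
by apply: measurable_funM => //; exact: kap_pow_measurable.
Qed.

Lemma jump_bound j : exists M, forall t, `|jump j t| <= M.
Proof.
exists (j%:R * d^-1 ^+ j.-1 * (d^-1 ^+ 2 + d ^- 2)) => t.
have di0 : 0 <= d^-1 by rewrite invr_ge0 ltW.
have H n : `|kap d t ^+ n| <= d^-1 ^+ n.
  by rewrite normrX lerXn2r ?nnegrE// kap_led.
rewrite /jump !normrM; apply: ler_pM => //.
  by rewrite normr_nat ler_wpM2l.
apply: (le_trans (ler_normD _ _)); rewrite lerD//.
by rewrite ger0_norm// invr_ge0 sqr_ge0.
Qed.

Lemma intble_jump j : intble (punctured d) (jump j).
Proof.
have [M HM] := jump_bound j; have mD := @measurable_punctured R d.
apply: (@le_intble R _ _ (fun=> M)) => //.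
- by apply: measurable_funTS; exact: jump_measurable.
- exact: punctured_intble_cst.
Qed.

Definition dkap_pow j (t : R) : R := - j%:R * kap d t ^+ j.+1 + (jump j \_ (punctured d)) t.

Lemma kap_pow_derive j (t : R) : (0 < j)%N -> t != 0 -> `|t| != d ->
  is_derive t 1 (fun t => kap d t ^+ j) (dkap_pow j t).
Proof.
move=> j0 t0 td.
have H dk : is_derive t 1 (kap d) dk -> is_derive t 1 (fun t => kap d t ^+ j) (j%:R * kap d t ^+ j.-1 * dk).
  move=> hk; elim: j {j0} => [|j IH].
    by rewrite !mul0r; under eq_fun do rewrite expr0; exact: is_derive_cst_pt.
  under eq_fun do rewrite exprS.
  apply: (is_derive_eq (is_deriveM_pt hk IH)).
  case: j {IH} => [|j]; first by rewrite /= !expr0 !mul0r mulr0 addr0 !mulr1 mul1r.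
  by rewrite /= -(natr1 j.+1) exprS; ring.
rewrite /dkap_pow patchE.
have [t1|t1] := ltP `|t| d.
  rewrite ifT; last by rewrite inE /punctured /= normr_gt0 t0 t1.
  have hk : is_derive t 1 (kap d) (d ^- 2).
    apply: (@is_derive_local _ _ (fun t => d ^- 2 * t) t (d - `|t|)); first by rewrite subr_gt0.
      move=> s st; rewrite kap_in 1?mulrC//.
      by rewrite -[s](subrK t) (le_trans (ler_normD _ _))//; lra.
    have := is_deriveZ_pt (d ^- 2) (@is_derive_id _ _ t 1); rewrite mulr1; exact.
  apply: (is_derive_eq (H _ hk)); rewrite /jump.
  by case: j j0 {H} => // j _; rewrite /= !exprS expr0; ring.
rewrite ifF; last by apply/negP; rewrite inE /punctured/= => /andP[_]; rewrite ltNge t1.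
have t2 : d < `|t| by rewrite lt_neqAle eq_sym td.
have hk : is_derive t 1 (kap d) (- t ^- 2).
  apply: (@is_derive_local _ _ (fun t => t^-1) t (`|t| - d)); first by rewrite subr_gt0.
    move=> s st; rewrite kap_out//.
    have := ler_normD s (t - s); rewrite addrCA subrr addr0 distrC; lra.
  have h := @is_deriveV R id t 1 1 t0 (@is_derive_id _ _ t 1).
  apply: (is_derive_eq h); rewrite /GRing.scale /= mulr1//.
apply: (is_derive_eq (H _ hk)); rewrite addr0 kap_out//.
have -> : t ^- 2 = t^-1 * t^-1 by rewrite -exprVn expr2.
by case: j j0 {H} => // j _; rewrite /= !exprS; ring.
Qed.

(** The derivative falls on the kernel and never on [w]: what results is a far term with one more
    power of decay and a local term with bounded kernel. *)
Lemma pair_int_kap_derive j (x : R) : (0 < j)%N ->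
  is_derive x 1 (Q j) (- j%:R * Q j.+1 x + local_op (jump j) (fun=> 0) d w x).
Proof.
move=> j0.
have i1 : pintble (fun t => - j%:R * kap d t ^+ j.+1) x.
  apply: eq_intble (intbleZl (- j%:R) measurableT (@kap_pow_pintble j.+1 x isT)) => // y.
  by ring.
have i2 : pintble (jump j \_ (punctured d)) x.
  by apply: pintble_intble; apply: (proj1 (intble_restrict _ _)); [exact: measurable_punctured|exact: intble_jump].
have i3 : pintble (dkap_pow j) x.
  by apply: eq_intble (intbleD measurableT i1 i2) => // y; rewrite /dkap_pow; ring.
have -> : - j%:R * Q j.+1 x + local_op (jump j) (fun=> 0) d w x = pair_int (dkap_pow j) x.
  have -> : local_op (jump j) (fun=> 0) d w x = pair_int (jump j \_ (punctured d)) x.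
    rewrite pair_int_loc; last exact: intble_jump.
    by apply: eq_Rintegral => t _; rewrite mul0r addr0.
  rewrite -pair_intZ; last exact: kap_pow_pintble.
  by rewrite -pair_intD.
apply: is_deriveZ_pt.
(* The [y] for which [x - y] or [x + y] is [0], [d] or [- d]. *)
have [mN N0] := finite_null [:: x; - x; x - d; x + d; - x - d; - x + d].
pose X := `|x| + 1.
apply: (@dui_null _ _ _ x 1 _ (fun y => j%:R * d^-1 ^+ j.-1 * envC d X * (1 + y ^+ 2)^-1
   + j%:R * d^-1 ^+ j.-1 * envC d X * (1 + y ^+ 2)^-1) mN N0) => //.
- by move=> z _; exact: kap_pow_pintble.
- by apply: intbleD => //; apply: intbleZl => //; exact: intble_oneDsqrV.
- move=> z y zx.
  have xX : `|x| <= X by rewrite lerDl.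
  have zX : `|z| <= X.
    by rewrite -[z](subrK x) (le_trans (ler_normD _ _))// addrC lerD2l ltW.
  rewrite -mulrBl; apply: (le_trans (mul_w_le _ _)).
  have h1 := @kap_pow_lip _ d d0 X x z y j xX zX.
  have h2 := @kap_pow_lip _ d d0 X x z (- y) j xX zX.
  rewrite !opprK sqrrN in h2.
  rewrite opprD addrACA mulrDr; apply: (le_trans (ler_normD _ _)).
  exact: lerD.
- move=> y yN.
  clear N0 mN.
  have [y1 y2 y3 y4 [y5 y6]] : [/\ y != x, y != - x, y != x - d, y != x + d & y != - x - d /\ y != - x + d].
    by move/negP: yN; rewrite /= !inE !negb_or => /and5P[? ? ? ? /andP[? ?]].
  under eq_fun do rewrite mulrC; rewrite [X in is_derive _ _ _ X]mulrC.
  apply: is_deriveZ_pt; apply: is_deriveD_pt.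
    apply: (@is_derive_shift_pt _ (fun t => kap d t ^+ j)); apply: kap_pow_derive => //.
      by rewrite subr_eq0 eq_sym.
    by apply: norm_neq; [apply: contra_neq y3|apply: contra_neq y4] => h; lra.
  apply: (@is_derive_shift_pt _ (fun t => kap d t ^+ j)); apply: kap_pow_derive => //.
    by rewrite addrC addr_eq0.
  by apply: norm_neq; [apply: contra_neq y6|apply: contra_neq y5] => h; lra.
Qed.

End far.
End PairIntegral.

(** * The logarithmic potential and its regularisation *)

Section LogPotential.
Variable R : realType.
Notation mu := (@lebesgue_measure R).
Notation intble D f := (mu.-integrable D (EFin \o f)).

Lemma is_derive_unique (f : R -> R) (x a b : R) : is_derive x 1 f a -> is_derive x 1 f b -> a = b.
Proof. by move=> [_ <-] [_ <-]. Qed.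

(** [ln |t|] as one differentiable formula on both sides of 0; since [ln 0 = 0], it is 0 at 0. *)
Definition log_abs (t : R) : R := 2^-1 * ln (t ^+ 2).

Lemma log_absE t : t != 0 -> log_abs t = ln `|t|.
Proof.
move=> t0; rewrite /log_abs -(real_normK (num_real t)) expr2 lnM ?posrE ?normr_gt0//; lra.
Qed.

Lemma ell_even (e t : R) : ell e (- t) = ell e t.
Proof. by rewrite /ell normrN sqrrN. Qed.

Section log_defect.
Variable e : R.
Hypothesis e0 : 0 < e.

Definition log_defect (t : R) : R := log_abs t - ell e t.

Lemma log_defect_out t : e <= `|t| -> log_defect t = 0.
Proof.
rewrite /log_defect /ell => et; case: leP => [te|_]; last by rewrite subrr.
have {et te} te : `|t| = e by apply/eqP; rewrite eq_le et te.
have t0 : t != 0 by rewrite -normr_gt0 te.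
rewrite log_absE// -(real_normK (num_real t)) te -mulrA divff ?gt_eqF ?exprn_gt0//; lra.
Qed.

(** With [u = e / |t|] the defect is at most [ln u + 1/2], and [ln u <= 2 * sqrt u] because
    [ln s < s]. The power -1/2 is integrable, and the factor [e ^ (1/2)] makes the integral of order
    [e]. *)
Lemma log_defect_bound t : punctured e t ->
  `|log_defect t| <= 3 * e `^ 2^-1 * `|t| `^ (2^-1 - 1).
Proof.
move=> /andP[t0 te].
have tn : t != 0 by rewrite -normr_gt0.
rewrite /log_defect /ell (ltW te) log_absE// -(real_normK (num_real t)).
set T := `|t| in t0 te *.
pose u := e / T.
have u1 : 1 < u by rewrite ltr_pdivlMr// mul1r.
have u0 : 0 < u by apply: lt_trans u1.
pose s := u `^ 2^-1.
have s1 : 1 <= s.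
  have := @ge0_ler_powR R 2^-1 _ 1 u; rewrite powR1; apply; rewrite ?nnegrE ?ltW//.
have lu : ln u <= 2 * s.
  have : ln s < s by apply: ln_sublinear; apply: lt_le_trans s1.
  rewrite /s ln_powR; lra.
have lE : ln e = ln u + ln T by rewrite -lnM ?posrE// /u divfK// gt_eqF.
have sE : e `^ 2^-1 * T `^ (2^-1 - 1) = s.
  have -> : e = u * T by rewrite /u divfK// gt_eqF.
  rewrite powRM ?ltW// -mulrA -powR_split//.
  by rewrite (_ : 2^-1 + (2^-1 - 1) = 0) ?powRr0 ?mulr1//; lra.
rewrite [X in _ <= X](_ : _ = 3 * s); last by rewrite -sE mulrA.
have q0 : 0 <= 2^-1 * T ^+ 2 / e ^+ 2 by rewrite divr_ge0 ?sqr_ge0// mulr_ge0 ?sqr_ge0// invr_ge0.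
have q1 : 2^-1 * T ^+ 2 / e ^+ 2 <= 2^-1.
  rewrite -mulrA ger_pMr// ler_pdivrMr ?exprn_gt0// mul1r lerXn2r ?nnegrE ?ltW//.
have lu0 : 0 <= ln u by rewrite ln_ge0// ltW.
rewrite lE ler_norml; apply/andP; split; lra.
Qed.

Lemma log_abs_measurable : measurable_fun setT log_abs.
Proof.
apply: measurable_funM; first exact: measurable_cst.
apply: (measurableT_comp (@measurable_ln R)).
exact: measurable_funX.
Qed.

Lemma ell_measurable : measurable_fun setT (ell e).
Proof.
apply: continuous_measurable_fun => t; exact: (is_derive_cont (ell_derive e0 t)).
Qed.

Definition log_defect0 : R -> R := log_defect \_ (punctured e).

Lemma log_defect0_intble : intble setT log_defect0 /\
  \int[mu]_t `|log_defect0 t| <= 12 * e.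
Proof.
have mD := @measurable_punctured R e.
have h0 : 0 < 2^-1 :> R by rewrite invr_gt0.
have [i1 l1] := @punctured_powR R 2^-1 e h0 e0.
have md : measurable_fun setT log_defect.
  by apply: measurable_funB; [exact: log_abs_measurable|exact: ell_measurable].
have i2 : intble (punctured e) (fun t => 3 * e `^ 2^-1 * `|t| `^ (2^-1 - 1)) by exact: intbleZl.
have i3 : intble (punctured e) log_defect.
  by apply: (le_intble mD _ i2) => [|t]; [exact: measurable_funTS|exact: log_defect_bound].
split; first exact: (proj1 (intble_restrict _ _)).
have -> : \int[mu]_t `|log_defect0 t| = \int[mu]_(t in punctured e) `|log_defect t|.
  rewrite [RHS]Rintegral_mkcond; apply: eq_Rintegral => t _.
  by rewrite /log_defect0 !patchE; case: ifP => //; rewrite normr0.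
apply: (@le_trans _ _ (\int[mu]_(t in punctured e) (3 * e `^ 2^-1 * `|t| `^ (2^-1 - 1)))).
  apply: le_Rintegral => //; first exact: (@integrable_norm _ _ _ mu _ log_defect i3).
  exact: log_defect_bound.
rewrite RintegralZl//.
have e2 : e `^ 2^-1 * e `^ 2^-1 = e.
  by rewrite -powR_split// (_ : 2^-1 + 2^-1 = 1) ?powRr1 ?ltW//; lra.
have := ler_wpM2l (mulr_ge0 (ler0n R 3) (powR_ge0 e 2^-1)) l1.
rewrite invrK => /le_trans; apply.
have -> : 3 * e `^ 2^-1 * (2 * (e `^ 2^-1 * 2)) = 12 * (e `^ 2^-1 * e `^ 2^-1) by ring.
by rewrite e2.
Qed.

Lemma log_abs_split t : t != 0 -> log_abs t = ell e t + log_defect0 t.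
Proof.
move=> t0; rewrite /log_defect0 patchE; case: ifPn => [_|].
  by rewrite /log_defect; lra.
rewrite notin_setE /punctured /= normr_gt0 t0 /= => /negP; rewrite -leNgt => et.
have : log_defect t = 0 := log_defect_out et.
by rewrite /log_defect /point/= => h; lra.
Qed.

End log_defect.

Variable w : R -> R.
Hypothesis wev : forall x, w (- x) = w x.
Hypothesis wb : forall x, `|w x| <= 1.
Variable Cw : R.
Hypothesis Cw0 : 0 <= Cw.
Hypothesis wlip : forall x y, `|w x - w y| <= Cw * `|x - y|.

Let wc : continuous w. Proof. exact: lip_continuous wlip. Qed.
Let wm : measurable_fun setT w. Proof. exact: continuous_measurable_fun. Qed.

Lemma w_holder : holder setT w.
Proof.
apply: (@holder_lip R setT w (1 + Cw)); first by rewrite addr_ge0.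
  by move=> x _; apply: (le_trans (wb x)); rewrite lerDl.
by move=> x y _ _; apply: (le_trans (wlip x y)); rewrite ler_wpM2r// lerDr.
Qed.

Notation Q d j := (pair_int w (fun t => kap d t ^+ j)).

(** For even [w] this is [pi * Top w x] ([Top_log_pot]): half of an integral over the whole line,
    with the kernel split into logarithms of translates. *)
Definition log_pot x : R :=
  2^-1 * \int[mu]_y ((log_abs (x - y) + log_abs (x + y) - 2 * log_abs y) * w y).
Definition reg_pot e x : R :=
  2^-1 * \int[mu]_y ((ell e (x - y) + ell e (x + y) - 2 * ell e y) * w y).

Section reg_pot.
Variable e : R.
Hypothesis e0 : 0 < e.

Let K X : R := 2 * (X + 1) * (1%:R * e^-1 ^+ 1.-1 + e^-1 ^+ (1 - 2)) * envC e X.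

Lemma ell_pair_lip (X x z y : R) : `|x| <= X -> `|z| <= X ->
  `|(ell e (z - y) + ell e (z + y)) - (ell e (x - y) + ell e (x + y))| <=
  K X * (1 + y ^+ 2)^-1 * `|z - x|.
Proof.
move=> xX zX.
apply: (@lip_deriv R [set s | `|s| <= X] (fun s => ell e (s - y) + ell e (s + y))
  (fun s => kap e (s - y) + kap e (s + y))) => //.
- move=> a b c /= aX bX ac cb; rewrite ler_norml.
  by move: aX bX; rewrite !ler_norml => /andP[? ?] /andP[? ?]; apply/andP; split; lra.
- move=> s _; apply: is_deriveD_pt; apply: is_derive_shift_pt; exact: ell_derive.
- move=> s sX; have := @kap_pow_pair_le R e e0 X s y 1 sX isT.
  by rewrite !expr1.
Qed.

Lemma reg_pot_intble x :
  intble setT (fun y => (ell e (x - y) + ell e (x + y) - 2 * ell e y) * w y).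
Proof.
apply: (le_intble measurableT _ (intbleZl (K `|x| * `|x|) measurableT (@intble_oneDsqrV R))).
  apply: measurable_funM => //; apply: measurable_funB.
    apply: measurable_funD; first by apply: reflect_fun_measurable; exact: ell_measurable.
    by apply: shift_measurable; exact: ell_measurable.
  by apply: measurable_funM => //; exact: ell_measurable.
move=> y _; apply: (le_trans (mul_w_le wb _ _)).
have x0 : `|0 : R| <= `|x| by rewrite normr0.
have := ell_pair_lip y x0 (lexx `|x|).
rewrite sub0r add0r ell_even subr0.
have -> : ell e y + ell e y = 2 * ell e y by ring.
move=> /le_trans; apply; lra.
Qed.

Lemma reg_pot_derive (x : R) : is_derive x 1 (reg_pot e) (Q e 1 x).
Proof.
apply: is_deriveZ_pt.
pose X := `|x| + 1.
apply: (@dui R setT _ x 1 _ (fun y => K X * (1 + y ^+ 2)^-1)) => //.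
- by move=> z _; exact: reg_pot_intble.
- by apply: intbleZl => //; exact: intble_oneDsqrV.
- move=> z y zx _.
  have xX : `|x| <= X by rewrite lerDl.
  have zX : `|z| <= X.
    by rewrite -[z](subrK x) (le_trans (ler_normD _ _))// addrC lerD2l ltW.
  rewrite -mulrBl; apply: (le_trans (mul_w_le wb _ _)).
  rewrite [X in _ <= X]mulrC; apply: le_trans (ell_pair_lip y xX zX).
  by rewrite opprD opprK addrA -[X in `|X|]addrA; rewrite le_eqVlt; apply/predU1l; congr (`| _ |); ring.
- move=> y _; rewrite !expr1.
  under eq_fun do rewrite mulrC; rewrite [X in is_derive _ _ _ X]mulrC.
  apply: is_deriveZ_pt; rewrite -[X in is_derive _ _ _ X]addr0.
  apply: (@is_deriveD_pt _ (fun z => ell e (z - y) + ell e (z + y)) (fun=> - (2 * ell e y))).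
  by apply: is_deriveD_pt; apply: is_derive_shift_pt; exact: ell_derive.
Qed.

Let dint x y := (log_defect0 e (x - y) + log_defect0 e (x + y) - 2 * log_defect0 e y) * w y.

(** The error is uniform in [x]: each logarithm is off by [12 * e] in [L^1], the last one counts
    twice, and half of the total is [24 * e]. *)
Lemma log_pot_reg (x : R) :
  intble setT (fun y => (log_abs (x - y) + log_abs (x + y) - 2 * log_abs y) * w y) /\
  `|log_pot x - reg_pot e x| <= 24 * e.
Proof.
have [i1 l1] := log_defect0_intble e0.
have a1 := @integrable_norm _ _ _ mu setT _ i1.
have i2 : intble setT (fun y => `|log_defect0 e (x - y)| + `|log_defect0 e (x + y)| + 2 * `|log_defect0 e y|).
  apply: intbleD => //; last exact: intbleZl.
  by apply: intbleD => //; [exact: (reflect_intble x a1)|exact: (shift_intble x a1)].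
have md := intble_meas i1.
have m3 : measurable_fun setT (dint x).
  apply: measurable_funM => //; apply: measurable_funB; last exact: measurable_funM.
  by apply: measurable_funD; [exact: reflect_fun_measurable|exact: shift_measurable].
have b3 y : setT y -> `|dint x y| <= `|log_defect0 e (x - y)| + `|log_defect0 e (x + y)| + 2 * `|log_defect0 e y|.
  move=> _; apply: (le_trans (mul_w_le wb _ _)).
  apply: (le_trans (ler_normB _ _)); rewrite normrM normr_nat lerD2r; exact: ler_normD.
have i3 : intble setT (dint x) := le_intble measurableT m3 i2 b3.
have [mN N0] := finite_null [:: 0; x; - x].
have mL : measurable_fun setT (fun y : R => (log_abs (x - y) + log_abs (x + y) - 2 * log_abs y) * w y).
  have mlog := @log_abs_measurable.
  apply: measurable_funM => //; apply: measurable_funB; last exact: measurable_funM.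
  by apply: measurable_funD; [exact: reflect_fun_measurable|exact: shift_measurable].
have EL y : ~ [set y | y \in [:: 0; x; - x]] y ->
   (log_abs (x - y) + log_abs (x + y) - 2 * log_abs y) * w y =
   (ell e (x - y) + ell e (x + y) - 2 * ell e y) * w y + dint x y.
  move=> /negP; rewrite /= !inE !negb_or => /and3P[y0 yx ynx].
  have h1 : x - y != 0 by rewrite subr_eq0 eq_sym.
  have h2 : x + y != 0 by rewrite addrC addr_eq0.
  by rewrite (log_abs_split e0 h1) (log_abs_split e0 h2) (log_abs_split e0 y0) /dint; ring.
have [i4 E] := ae_int mN N0 mL (intbleD measurableT (reg_pot_intble x) i3) EL.
split => //.
have -> : log_pot x - reg_pot e x = 2^-1 * \int[mu]_y dint x y.
  rewrite /log_pot E RintegralD//; last exact: reg_pot_intble.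
  by rewrite /reg_pot; ring.
rewrite normrM ger0_norm ?invr_ge0//.
have := le_norm_int measurableT m3 i2 b3.
rewrite RintegralD//; [|apply: intbleD => //; [exact: (reflect_intble x a1)|exact: (shift_intble x a1)]|exact: intbleZl].
rewrite RintegralD//; [|exact: (reflect_intble x a1)|exact: (shift_intble x a1)].
rewrite (@reflect_int _ x (fun y => `|log_defect0 e y|))// (@shift_int _ (fun y => `|log_defect0 e y|) x)//.
rewrite RintegralZl//.
lra.
Qed.

End reg_pot.
End LogPotential.

(** * The derivative of the logarithmic potential *)

Section HilbertTransform.
Variable R : realType.
Notation mu := (@lebesgue_measure R).
Notation intble D f := (mu.-integrable D (EFin \o f)).

Lemma punctured_int_cst (c e : R) : 0 <= c -> 0 < e -> \int[mu]_(t in punctured e) c <= 2 * e * c.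
Proof.
move=> c0 e0; have [i1 l1] := @punctured_powR R 1 e ltr01 e0.
have mD := @measurable_punctured R e.
apply: (@le_trans _ _ (c * \int[mu]_(t in punctured e) `|t| `^ (1 - 1))).
  rewrite -RintegralZl//; apply: le_Rintegral => //.
  - exact: punctured_intble_cst.
  - exact: intbleZl.
  - by move=> t _; rewrite subrr powRr0 mulr1.
have := ler_wpM2l c0 l1; rewrite divr1 powRr1 ?(ltW e0)//; lra.
Qed.

Section kernel_diff.
Variables (d : R) (k : R -> R).
Hypothesis d0 : 0 < d.
Hypothesis mk : measurable_fun (punctured d) k.
Hypothesis kb : forall t, punctured d t -> `|k t| <= `|t|^-1.

(** Used with [k = 1/t] and [k = kap e]; the factor 1/2 is the one in [pair_int_loc_odd]. *)
Definition kernel_diff t := 2^-1 * (k t - kap d t).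

Lemma kernel_diff_measurable : measurable_fun (punctured d) kernel_diff.
Proof.
apply: measurable_funM => //; apply: measurable_funB => //; apply: measurable_funTS.
by apply: continuous_measurable_fun; exact: kap_continuous.
Qed.

Lemma kernel_diff_measurableN : measurable_fun (punctured d) (fun t => - kernel_diff t).
Proof.
rewrite (_ : (fun t => - kernel_diff t) = (fun t => -1 * kernel_diff t)); last first.
  by apply/funext => t; rewrite mulN1r.
by apply: measurable_funM => //; exact: kernel_diff_measurable.
Qed.

Lemma kernel_diff_bound t : punctured d t -> `|kernel_diff t| <= `|t|^-1.
Proof.
move=> Dt; have t0 : t != 0 by case/andP: Dt; rewrite normr_gt0.
rewrite /kernel_diff normrM ger0_norm ?invr_ge0//.
have := kb Dt; have := kap_lenorm d0 t0; have := ler_normB (k t) (kap d t).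
lra.
Qed.

Lemma kernel_diff_kM t u v : punctured d t ->
  `|kernel_diff t * u + - kernel_diff t * v| <= 1 * (`|u - v| / `|t|) + 1 * (`|u| + `|v|).
Proof.
move=> Dt; rewrite mulNr -mulrBr normrM !mul1r.
have := ler_wpM2r (normr_ge0 (u - v)) (kernel_diff_bound Dt).
rewrite [_^-1 * _]mulrC; have := normr_ge0 u; have := normr_ge0 v; lra.
Qed.

End kernel_diff.

Lemma inv_measurable d : measurable_fun (punctured d) (@GRing.inv R).
Proof.
apply: (@measurable_funS _ _ _ _ (~` [set (0 : R)])).
- by apply: measurableC; exact: measurable_set1.
- by move=> t /andP[+ _]; rewrite normr_gt0 => /eqP.
apply: open_continuous_measurable_fun.
  by apply: closed_openC; exact: closed_eq.
by move=> t; rewrite inE => /eqP t0; exact: inv_continuous.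
Qed.

Lemma inv_bound d (t : R) : punctured d t -> `|t^-1| <= `|t|^-1.
Proof. by move=> _; rewrite normfV. Qed.

Variable w : R -> R.
Hypothesis wev : forall x, w (- x) = w x.
Hypothesis wb : forall x, `|w x| <= 1.
Variable Cw : R.
Hypothesis Cw0 : 0 <= Cw.
Hypothesis wlip : forall x y, `|w x - w y| <= Cw * `|x - y|.

Let wc : continuous w. Proof. exact: lip_continuous wlip. Qed.
Let wm : measurable_fun setT w. Proof. exact: continuous_measurable_fun. Qed.

Notation Q d j := (pair_int w (fun t => kap d t ^+ j)).

(* [near_part] is the part over [|x - y| < d] of the principal value integral of
   [w y / (x - y)], up to the contribution of [kap d] that is moved to [Q d 1]. *)
Definition near_part d f x :=
  local_op (kernel_diff d GRing.inv) (fun t => - kernel_diff d GRing.inv t) d f x.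

(** Principal value of the integral of [w y / (x - y)]. It does not depend on [d] ([hilbert_indep]),
    so each use picks a convenient radius. *)
Definition hilbert d x := Q d 1 x + near_part d w x.

Lemma near_part_Cn d (U V : set R) n f : 0 < d -> open U -> open V -> convex U -> convex V ->
  (forall x t, V x -> `|t| < d -> U (x + t)) -> Cn U n f -> Cn V n (near_part d f).
Proof.
move=> d0 oU oV cU cV VU; have mD := @measurable_punctured R d.
apply: (@local_op_Cn R _ _ d 1) => //.
- by apply: kernel_diff_measurable => //; exact: inv_measurable.
- by apply: kernel_diff_measurableN => //; exact: inv_measurable.
- by move=> t u v Dt; apply: kernel_diff_kM => // s; exact: inv_bound.
Qed.

Lemma near_part_holder d : 0 < d -> holder setT (near_part d w).
Proof.
move=> d0; apply: (@near_part_Cn d setT setT 0) => //; try exact: openT.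
exact: (w_holder wb Cw0 wlip).
Qed.

(** Beyond [d] both [kap e] and [kap d] are [1/t]; their difference is an odd bounded kernel of
    compact support. *)
Lemma Q_cut e d x : 0 < e -> e <= d ->
  Q e 1 x = Q d 1 x + local_op (kernel_diff d (kap e)) (fun t => - kernel_diff d (kap e) t) d w x.
Proof.
move=> e0 ed; have d0 : 0 < d := lt_le_trans e0 ed.
have mD := @measurable_punctured R d.
pose c t := kap e t - kap d t.
have ic : intble (punctured d) c.
  apply: (@le_intble R _ _ (fun=> e^-1 + d^-1)) => //.
  - apply: measurable_funTS; apply: measurable_funB.
      by apply: continuous_measurable_fun; exact: kap_continuous.
    by apply: continuous_measurable_fun; exact: kap_continuous.
  - exact: punctured_intble_cst.
  - by move=> t _; rewrite (le_trans (ler_normB _ _))// lerD// kap_led.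
have E : (fun t => kap e t ^+ 1) = (fun t => kap d t ^+ 1 + (c \_ (punctured d)) t).
  apply/funext => t; rewrite !expr1 patchE; case: ifPn => [_|]; first by rewrite /c addrC subrK.
  rewrite notin_setE /punctured /= => /negP; rewrite negb_and -!leNgt => /orP[|dt].
    by rewrite normr_le0 => /eqP ->; rewrite /kap !mul0r addr0.
  by rewrite !kap_out ?addr0// (le_trans ed).
rewrite E pair_intD//.
- by congr (_ + _); rewrite pair_int_loc_odd// => t; rewrite /c !kapN; ring.
- exact: kap_pow_pintble.
- by apply: pintble_intble => //; apply: (proj1 (intble_restrict _ _)).
Qed.

(** The kernels [kap e] and [1/t] differ only for [|t| < e], by at most [2 / |t|], and [w] varies
    there by [2 * Cw * |t|]. With the factor 1/2 the integrand stays below [2 * Cw] on a set of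
    length [2 * e]. *)
Lemma hilbert_approx e d x : 0 < e -> e <= d -> `|Q e 1 x - hilbert d x| <= 4 * Cw * e.
Proof.
move=> e0 ed; have d0 : 0 < d := lt_le_trans e0 ed.
have mD := @measurable_punctured R d; have mE := @measurable_punctured R e.
have wH := w_holder wb Cw0 wlip.
have mke : measurable_fun setT (kap e) by apply: continuous_measurable_fun; exact: kap_continuous.
have i1 : intble (punctured d) (fun t => kernel_diff d GRing.inv t * w (x - t) + - kernel_diff d GRing.inv t * w (x + t)).
  apply: (@intble_local_integrand R _ _ d 1 _ _ _ _ _ setT setT) => //; try exact: openT.
  - by apply: kernel_diff_measurable => //; exact: inv_measurable.
  - by apply: kernel_diff_measurableN => //; exact: inv_measurable.
  - by move=> t u v Dt; apply: kernel_diff_kM => // s; exact: inv_bound.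
have i2 : intble (punctured d) (fun t => kernel_diff d (kap e) t * w (x - t) + - kernel_diff d (kap e) t * w (x + t)).
  apply: (@intble_local_integrand R _ _ d 1 _ _ _ _ _ setT setT) => //; try exact: openT.
  - by apply: kernel_diff_measurable => //; exact: measurable_funTS.
  - by apply: kernel_diff_measurableN => //; exact: measurable_funTS.
  - move=> t u v Dt; apply: kernel_diff_kM => // s Ds; apply: kap_lenorm => //.
    by case/andP: Ds; rewrite normr_gt0.
rewrite (Q_cut _ e0 ed) /hilbert /near_part /local_op opprD addrACA subrr add0r -RintegralB//.
apply: (@le_trans _ _ (\int[mu]_(t in punctured d) ((fun=> 2 * Cw) \_ (punctured e)) t)).
  apply: le_norm_int => //.
  - by apply: measurable_funB; [exact: (intble_meas i2)|exact: (intble_meas i1)].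
  - apply: intbleS => //; apply: (proj1 (intble_restrict _ _)) => //.
    exact: punctured_intble_cst.
  - move=> t Dt; have t0 : 0 < `|t| by case/andP: Dt.
    have -> : kernel_diff d (kap e) t * w (x - t) + - kernel_diff d (kap e) t * w (x + t) -
      (kernel_diff d GRing.inv t * w (x - t) + - kernel_diff d GRing.inv t * w (x + t)) =
      2^-1 * (kap e t - t^-1) * (w (x - t) - w (x + t)) by rewrite /kernel_diff; ring.
    rewrite patchE; case: ifPn => [_|].
      rewrite !normrM ger0_norm ?invr_ge0//.
      have h1 : `|kap e t - t^-1| <= 2 * `|t|^-1.
        have := @kap_lenorm R e e0 t; rewrite -normr_gt0 => /(_ t0).
        have := ler_normB (kap e t) t^-1; rewrite normfV; lra.
      have h2 : `|w (x - t) - w (x + t)| <= Cw * (2 * `|t|).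
        apply: (le_trans (wlip _ _)); rewrite (_ : x - t - (x + t) = - (2 * t)); last by ring.
        by rewrite normrN normrM normr_nat.
      apply: (@le_trans _ _ (2^-1 * (2 * `|t|^-1) * (Cw * (2 * `|t|)))).
        by apply: ler_pM => //; rewrite ler_pM2l.
      by rewrite le_eqVlt; apply/predU1l; field; rewrite gt_eqF.
    rewrite notin_setE /punctured /= t0 /= => /negP; rewrite -leNgt => et.
    by rewrite kap_out// subrr mulr0 mul0r normr0.
rewrite -Rintegral_mkcondr.
have -> : punctured d `&` punctured e = punctured e.
  apply/seteqP; split => t /=; first by case.
  by move=> /andP[h1 h2]; split; rewrite /punctured/= h1 ?h2 ?(lt_le_trans h2 ed).
have c0 : 0 <= 2 * Cw by rewrite mulr_ge0.
have := punctured_int_cst c0 e0; lra.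
Qed.

Lemma hilbert_cont d x : 0 < d -> {for x, continuous (hilbert d)}.
Proof.
move=> d0; apply: continuousD.
  exact: (is_derive_cont (@pair_int_kap_derive R w wev wb wm d d0 1 x isT)).
exact: (holder_cont (@openT _) (near_part_holder d0)).
Qed.

(** As [e] tends to 0, [reg_pot w e] converges uniformly to [log_pot w] and its derivative uniformly
    to the continuous [hilbert d]. The limit is taken inside the increment estimate, with [r] fixed
    beforehand by continuity. *)
Theorem log_pot_derive d (x : R) : 0 < d -> is_derive x 1 (log_pot w) (hilbert d x).
Proof.
move=> d0; apply/is_derive_epsP => eps eps0.
have /cvgrPdist_le/(_ eps eps0) := hilbert_cont d0 (x := x).
move=> /nbhs_ballP[r r0 Hr].
exists r => // h hr.
(* 48 is the 24 of [log_pot_reg] at both endpoints; the other term is [hilbert_approx] along the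
   increment. *)
have key e : 0 < e -> e <= d ->
    `|log_pot w (x + h) - log_pot w x - h * hilbert d x| <= eps * `|h| + (48 + 4 * Cw * `|h|) * e.
  move=> e0 ed.
  have [_ h1] := log_pot_reg wb wlip e0 (x + h).
  have [_ h2] := log_pot_reg wb wlip e0 x.
  (* Without the tangent the slope on the segment is at most [eps + 4 * Cw * e]. *)
  pose g s := reg_pot w e s - hilbert d x * s.
  have h3 : `|g (x + h) - g x| <= (eps + 4 * Cw * e) * `|x + h - x|.
    apply: (@lip_deriv R [set s | `|s - x| <= `|h|] g (fun s => Q e 1 s - hilbert d x * 1)).
    - move=> a b c /= aX bX ac cb; rewrite ler_norml.
      by move: aX bX; rewrite !ler_norml => /andP[? ?] /andP[? ?]; apply/andP; split; lra.
    - move=> s _; apply: is_deriveB; first exact: (reg_pot_derive wb wlip e0 s).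
    - move=> s /= sh; rewrite mulr1.
      have h4 := hilbert_approx s e0 ed.
      have : `|hilbert d x - hilbert d s| <= eps.
        by apply: Hr; rewrite /ball /= distrC (le_lt_trans sh).
      have -> : Q e 1 s - hilbert d x = (Q e 1 s - hilbert d s) + - (hilbert d x - hilbert d s) by ring.
      move=> h5; apply: (le_trans (ler_normD _ _)); rewrite normrN; lra.
    - by rewrite /= addrC addKr.
    - by rewrite /= subrr normr0.
  have E : log_pot w (x + h) - log_pot w x - h * hilbert d x =
    (log_pot w (x + h) - reg_pot w e (x + h)) + - (log_pot w x - reg_pot w e x) + (g (x + h) - g x).
    by rewrite /g; ring.
  rewrite E; apply: (le_trans (ler_normD _ _)); have := ler_normD (log_pot w (x + h) - reg_pot w e (x + h)) (- (log_pot w x - reg_pot w e x)).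
  rewrite normrN; move: h3; have -> : x + h - x = h by ring.
  nra.
(* A failure by [A - B] contradicts [key] for an [e] with [c * e <= (A - B) / 2]. *)
rewrite leNgt; apply/negP => lt1.
set A := `|_| in key lt1; set B := eps * `|h| in key lt1.
pose c := 48 + 4 * Cw * `|h|.
have c0 : 0 < c by rewrite /c ltr_wpDr// !mulr_ge0.
pose e := Num.min d ((A - B) / (2 * c)).
have AB : 0 < A - B by rewrite subr_gt0.
have e0 : 0 < e by rewrite lt_min d0 divr_gt0// mulr_gt0.
have ed : e <= d by rewrite ge_min lexx.
have := key e e0 ed; rewrite -/c.
have : c * e <= (A - B) / 2.
  rewrite mulrC -ler_pdivlMr// ge_min; apply/orP; right.
  by rewrite le_eqVlt; apply/predU1l; field; rewrite gt_eqF.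
lra.
Qed.

End HilbertTransform.

(** * Boundedness and regularity of the Hilbert transform *)

Section FarPart.
Variable R : realType.
Notation mu := (@lebesgue_measure R).
Notation intble D f := (mu.-integrable D (EFin \o f)).

(** Stands in for [mx d t ^- 2], up to a factor 4, because its antiderivative is explicit; its
    integral scales like [1 / d]. *)
Definition lap (d t : R) : R := ((`|t| + d) ^+ 2)^-1.

Lemma lap_int d : 0 < d -> intble setT (lap d) /\ \int[mu]_t lap d t <= 2 / d.
Proof.
move=> d0.
have pos t : 0 < `|t| + d by rewrite ltr_wpDl.
have lc : continuous (lap d).
  move=> t; apply: (@continuous_comp _ _ _ (fun t => (`|t| + d) ^+ 2) (@GRing.inv R)).
    apply: (@continuous_comp _ _ _ (fun t => `|t| + d) (fun z => z ^+ 2)); last exact: exprn_continuous.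
    by apply: cvgD; [exact: norm_continuous|exact: cvg_cst].
  by apply: inv_continuous; rewrite expf_neq0// gt_eqF.
have l0 t : 0 <= lap d t by rewrite /lap invr_ge0 sqr_ge0.
have half : (\int[mu]_(t in `[0%R, +oo[) (lap d t)%:E = (d^-1)%:E)%E.
  have der (t : R) : 0 < t -> is_derive t 1 (fun t => - (t + d)^-1) (lap d t).
    move=> t0; have td : t + d != 0 by rewrite gt_eqF// addr_gt0.
    have h1 : is_derive t 1 (fun t => t + d) 1.
      by rewrite -[X in is_derive _ _ _ X]addr0; apply: is_deriveD_pt.
    have h2 := is_deriveN (@is_deriveV R (fun t => t + d) t 1 _ td h1).
    apply: (is_derive_eq h2); rewrite /lap ger0_norm ?ltW// /GRing.scale /=.
    by rewrite mulr1 opprK.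
  rewrite (@ge0_continuous_FTC2y R (lap d) (fun t => - (t + d)^-1) 0 0).
  - by rewrite -EFinB !add0r opprK.
  - by move=> x _.
  - by apply: continuous_subspaceT.
  - rewrite -[X in _ --> X]oppr0; apply: cvgN; apply/gtr0_cvgV0; last by apply: cvg_addrr.
    by near=> t; rewrite ltr_wpDl//; near: t; exact: nbhs_pinfty_ge.
  - by move=> t t0; have [] := der t t0.
  - apply: cvg_at_right_filter; apply: cvgN; apply: cvgV; first by rewrite add0r gt_eqF.
    by apply: cvgD; [exact: cvg_id|exact: cvg_cst].
  - by move=> t; rewrite in_itv/= andbT => t0; rewrite derive1E; have [] := der t t0.
have full : (\int[mu]_t (lap d t)%:E = (2 / d)%:E)%E.
  rewrite ge0_symfun_integralT//; last by move=> t /=; rewrite /lap normrN.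
  have -> : [set x : R | 0 <= x] = `[0, +oo[%classic.
    by apply/seteqP; split => x /=; rewrite in_itv/= andbT.
  by rewrite half.
split; last by rewrite /Rintegral full.
apply/integrableP; split; first by apply/measurable_EFinP; exact: continuous_measurable_fun.
rewrite (@eq_integral _ _ _ mu _ (fun t : R => (lap d t)%:E)) ?full ?ltry//.
by move=> y _; rewrite /= ger0_norm.
Unshelve. all: end_near. Qed.

Lemma mx_lap d t : 0 < d -> (mx d t ^+ 2)^-1 <= 4 * lap d t.
Proof.
move=> d0; have m0 := mx_gt0 d0 t.
have p0 : 0 < `|t| + d by rewrite ltr_wpDl.
rewrite /lap ler_pdivlMr ?exprn_gt0// mulrC ler_pdivrMr ?exprn_gt0//.
have := mx_ged d t; have := mx_genorm d t => h1 h2.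
have : (`|t| + d) ^+ 2 <= (2 * mx d t) ^+ 2.
  by rewrite ler_sqr ?nnegrE ?mulr_ge0 ?(ltW p0) ?(ltW m0)//; lra.
by rewrite exprMn; lra.
Qed.

Variable w : R -> R.
Hypothesis wev : forall x, w (- x) = w x.
Hypothesis wb : forall x, `|w x| <= 1.
Variable Cw : R.
Hypothesis Cw0 : 0 <= Cw.
Hypothesis wlip : forall x y, `|w x - w y| <= Cw * `|x - y|.

Let wc : continuous w. Proof. exact: lip_continuous wlip. Qed.
Let wm : measurable_fun setT w. Proof. exact: continuous_measurable_fun. Qed.
Let wH : holder setT w. Proof. exact: (w_holder wb Cw0 wlip). Qed.

Notation Q d j := (pair_int w (fun t => kap d t ^+ j)).

(** Oddness gains the factor [2 * |x|], and the rest has integral of order [1 / d]: a constant bound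
    once [d] is comparable to [|x|]. *)
Lemma Q1_bound (d x : R) : 0 < d -> `|Q d 1 x| <= 8 * `|x| / d.
Proof.
move=> d0; have [il ll] := lap_int d0.
have b y : `|(kap d (x - y) ^+ 1 + kap d (x + y) ^+ 1) * w y| <= 4 * `|x| * (lap d (x - y) + lap d (x + y)).
  apply: (le_trans (mul_w_le wb _ _)); rewrite !expr1.
  have -> : kap d (x + y) = - kap d (- x - y) by rewrite -kapN; congr (kap d _); ring.
  apply: (le_trans (kap_lip d0 _ _)).
  have -> : x - y - (- x - y) = 2 * x by ring.
  rewrite normrM normr_nat.
  have -> : mx d (- x - y) = mx d (x + y) by rewrite /mx -normrN; congr (Num.max `| _ | _); ring.
  have h1 := mx_lap (x - y) d0; have h2 := mx_lap (x + y) d0.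
  have h3 : (mx d (x - y) * mx d (x + y))^-1 <= 2^-1 * ((mx d (x - y) ^+ 2)^-1 + (mx d (x + y) ^+ 2)^-1).
    rewrite invfM -!exprVn; set p := (mx d (x - y))^-1; set q := (mx d (x + y))^-1.
    have := sqr_ge0 (p - q); nra.
  have h4 : (mx d (x - y) * mx d (x + y))^-1 <= 2 * (lap d (x - y) + lap d (x + y)) by lra.
  have := ler_wpM2l (mulr_ge0 (ler0n R 2) (normr_ge0 x)) h4; lra.
have i1 : intble setT (fun y => lap d (x - y) + lap d (x + y)).
  by apply: intbleD => //; [exact: (reflect_intble x il)|exact: (shift_intble x il)].
rewrite /pair_int normrM ger0_norm ?invr_ge0//.
have mk : measurable_fun setT (fun y : R => (kap d (x - y) ^+ 1 + kap d (x + y) ^+ 1) * w y).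
  by apply: (@pair_measurable R w wm (fun t => kap d t ^+ 1)); exact: kap_pow_measurable.
have := le_norm_int measurableT mk (intbleZl (4 * `|x|) measurableT i1) (fun y _ => b y).
rewrite RintegralZl// RintegralD//; [|exact: (reflect_intble x il)|exact: (shift_intble x il)].
rewrite reflect_int// shift_int// => h.
have := ler_wpM2l (mulr_ge0 (ler0n R 4) (normr_ge0 x)) ll.
lra.
Qed.

Lemma near_part_bound d x B : 0 < d -> 0 <= B ->
  (forall t, `|t| < d -> `|w (x - t) - w (x + t)| <= B * `|t|) ->
  `|near_part d w x| <= 2 * d * B.
Proof.
move=> d0 B0 H; have mD := @measurable_punctured R d.
apply: (@le_trans _ _ (\int[mu]_(t in punctured d) B)); last exact: punctured_int_cst.
apply: le_norm_int => //.
- apply: (@measurable_local_integrand R _ _ d _ _ setT setT) => //; try exact: openT.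
  + by apply: kernel_diff_measurable => //; exact: inv_measurable.
  + by apply: kernel_diff_measurableN => //; exact: inv_measurable.
  + by move=> y _; exact: wc.
- exact: punctured_intble_cst.
- move=> t Dt; have /andP[t0 td] := Dt.
  rewrite mulNr -mulrBr normrM.
  have h1 := kernel_diff_bound d0 (@inv_bound R d) Dt.
  have h2 := H t td.
  have := ler_pM (normr_ge0 _) (normr_ge0 _) h1 h2.
  by rewrite mulrCA mulVf ?mulr1// gt_eqF.
Qed.

(** Both sides are the derivative of [log_pot w] at [x], which involves no radius. *)
Lemma hilbert_indep d e x : 0 < d -> 0 < e -> hilbert w d x = hilbert w e x.
Proof.
move=> d0 e0; apply: is_derive_unique (log_pot_derive wev wb Cw0 wlip x d0) _.
exact: (log_pot_derive wev wb Cw0 wlip x e0).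
Qed.

Lemma kap_pow_intble d j : 0 < d -> (2 <= j)%N -> intble setT (fun t => kap d t ^+ j).
Proof.
move=> d0 j2; have [il _] := lap_int d0.
apply: (le_intble measurableT _ (intbleZl (d^-1 ^+ (j - 2) * 4) measurableT il)).
  exact: kap_pow_measurable.
move=> t _; apply: (le_trans (kap_pow_le d0 t j2)).
rewrite -[X in _ <= X]mulrA; apply: ler_wpM2l; last exact: mx_lap.
by rewrite exprn_ge0// invr_ge0 ltW.
Qed.

Lemma Q_bound d j : 0 < d -> (2 <= j)%N -> exists C, forall x, `|Q d j x| <= C.
Proof.
move=> d0 j2; have ik := kap_pow_intble d0 j2.
exists (\int[mu]_t `|kap d t ^+ j|) => x.
rewrite pair_int_conv//; apply: le_norm_int => //.
- apply: measurable_funM; first exact: kap_pow_measurable.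
  exact: reflect_fun_measurable.
- exact: (@integrable_norm _ _ _ mu _ _ ik).
- by move=> t _; exact: mul_w_le.
Qed.

Lemma jump_op_Cn d j (U V : set R) n f : 0 < d -> open U -> open V -> convex U -> convex V ->
  (forall x t, V x -> `|t| < d -> U (x + t)) -> Cn U n f ->
  Cn V n (local_op (jump d j) (fun=> 0) d f).
Proof.
move=> d0 oU oV cU cV VU; have [M HM] := jump_bound d0 j.
have M0 : 0 <= M by apply: le_trans (HM 0).
apply: (@local_op_Cn R _ _ d M) => //.
- by apply: measurable_funTS; exact: jump_measurable.
- move=> t u v Dt; rewrite mul0r addr0 normrM.
  have h1 : `|jump d j t| * `|u| <= M * `|u| by rewrite ler_wpM2r.
  have h2 : 0 <= M * (`|u - v| / `|t|) by rewrite mulr_ge0// divr_ge0.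
  have h3 : 0 <= M * `|v| by rewrite mulr_ge0.
  lra.
Qed.

Lemma Q_deriv_bound d j : 0 < d -> (0 < j)%N ->
  exists C, forall x, `|- j%:R * Q d j.+1 x + local_op (jump d j) (fun=> 0) d w x| <= C.
Proof.
move=> d0 j0; have [C1 H1] := @Q_bound d j.+1 d0 j0.
have [|C2 H2] := @holder_bnd R setT (local_op (jump d j) (fun=> 0) d w).
  by apply: (@jump_op_Cn d j setT setT 0) => //; exact: openT.
exists (j%:R * C1 + C2) => x; apply: (le_trans (ler_normD _ _)); rewrite lerD ?H2//.
by rewrite mulNr normrN normrM normr_nat ler_wpM2l.
Qed.

(** The derivative is bounded for all [j >= 1], but integrability of the kernel bounds [Q d j]
    itself only for [j >= 2]; hence [B] is an input. *)
Lemma Q_holder d j B : 0 < d -> (0 < j)%N -> (forall x, `|Q d j x| <= B) -> holder setT (Q d j).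
Proof.
move=> d0 j0 HB; have [C HC] := Q_deriv_bound d0 j0.
apply: (@holder_deriv R setT _ _ B) => //.
  by move=> x _; exact: (pair_int_kap_derive wev wb wm d0 x j0).
by exists C => x _; exact: HC.
Qed.

(** Each derivative raises the power by one, so the induction runs over all [j] at once. *)
Lemma Q_Cn d j (U V : set R) n : 0 < d -> (2 <= j)%N -> open U -> open V -> convex U -> convex V ->
  (forall x t, V x -> `|t| < d -> U (x + t)) -> Cn U n w -> Cn V n (Q d j).
Proof.
move=> d0 + oU oV cU cV VU; elim: n j => [|n IH] j j2 wC.
  by have [C HC] := Q_bound d0 j2; apply: holder_sub (@Q_holder d j C d0 (ltnW j2) HC).
split; first by have [C HC] := Q_bound d0 j2; apply: holder_sub (@Q_holder d j C d0 (ltnW j2) HC).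
exists (fun x => - j%:R * Q d j.+1 x + local_op (jump d j) (fun=> 0) d w x).
  by move=> x _; exact: (pair_int_kap_derive wev wb wm d0 x (ltnW j2)).
apply: CnD; last by apply: (@jump_op_Cn d j U V n) => //; exact: CnS.
by apply: CnM; [exact: Cn_cst|apply: IH => //; [exact: ltnW|exact: CnS]].
Qed.

Hypothesis wloc : forall x t, 0 <= t -> t <= Num.max 1 `|x| / 2 ->
  `|w (x - t) - w (x + t)| <= Cw * t / Num.max 1 `|x|.

(** Cut at half of [X = max(1, |x|)]: the far part is at most [8 * |x| / (X / 2) <= 16], the near
    part at most [2 * (X / 2) * (Cw / X) = Cw]. *)
Lemma hilbert_bound d x : 0 < d -> `|hilbert w d x| <= 16 + Cw.
Proof.
have wl := @wloc x; move=> d0; set X := Num.max 1 `|x| in wl *.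
have X1 : 1 <= X by rewrite le_max lexx.
have Xx : `|x| <= X by rewrite le_max lexx orbT.
have X0 : 0 < X by lra.
have h0 : 0 < X / 2 by rewrite divr_gt0.
rewrite (@hilbert_indep d (X / 2))// /hilbert; apply: (le_trans (ler_normD _ _)).
apply: lerD.
  apply: (le_trans (Q1_bound x h0)); rewrite ler_pdivrMr//; lra.
have B0 : 0 <= Cw / X by rewrite divr_ge0// ltW.
apply: (le_trans (near_part_bound h0 B0 _)); last first.
  by rewrite le_eqVlt; apply/predU1l; field; rewrite gt_eqF.
move=> t tX; rewrite mulrAC.
have -> : `|w (x - t) - w (x + t)| = `|w (x - `|t|) - w (x + `|t|)|.
  have [t0|t0] := leP 0 t; first by rewrite (ger0_norm t0).
  by rewrite (ltr0_norm t0) opprK distrC.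
by apply: wl => //; exact: ltW.
Qed.

(** The kernel of [Q d 1] is not integrable; [Q d 1] is bounded as the Hilbert transform minus its
    near part. *)
Lemma hilbert_Cn d (U V : set R) n : 0 < d -> open U -> open V -> convex U -> convex V ->
  (forall x t, V x -> `|t| < d -> U (x + t)) -> Cn U n w -> Cn V n (hilbert w d).
Proof.
move=> d0 oU oV cU cV VU wC; apply: CnD; last exact: (near_part_Cn d0 oU oV cU cV VU wC).
have [C HC] := holder_bnd (near_part_holder wb Cw0 wlip d0).
have H : holder setT (Q d 1).
  apply: (@Q_holder d 1 (16 + Cw + C)) => // x.
  have -> : Q d 1 x = hilbert w d x - near_part d w x by rewrite /hilbert addrK.
  by apply: (le_trans (ler_normB _ _)); rewrite lerD ?hilbert_bound// HC.
case: n wC => [|n] wC; first exact: holder_sub H.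
split; first exact: holder_sub H.
exists (fun x => - 1%:R * Q d 2 x + local_op (jump d 1) (fun=> 0) d w x).
  by move=> x _; exact: (pair_int_kap_derive wev wb wm d0 x (j := 1)).
apply: CnD; last by apply: (@jump_op_Cn d 1 U V n) => //; exact: CnS.
by apply: CnM; [exact: Cn_cst|apply: (@Q_Cn d 2 U V n) => //; exact: CnS].
Qed.

End FarPart.

(** * Logarithmic growth of the potential *)

Section LogPotentialGrowth.
Variable R : realType.
Notation mu := (@lebesgue_measure R).
Notation intble D f := (mu.-integrable D (EFin \o f)).

Lemma inv_measurableT : measurable_fun setT (@GRing.inv R).
Proof.
have -> : [set: R] = [set (0 : R)] `|` ~` [set (0 : R)] by rewrite setUCr.
apply/measurable_funU => //; first exact: measurableC.
split; first exact: measurable_fun_set1.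
apply: open_continuous_measurable_fun.
  by apply: closed_openC; exact: closed_eq.
by move=> t; rewrite inE => /eqP t0; exact: inv_continuous.
Qed.

Lemma log_abs0 : log_abs (0 : R) = 0.
Proof. by rewrite /log_abs expr0n /= ln0// mulr0. Qed.

Section const.
Let one : R -> R := fun=> 1.
Let one_ev x : one (- x) = one x. Proof. by []. Qed.
Let one_b x : `|one x| <= 1. Proof. by rewrite normr1. Qed.
Let one_lip x y : `|one x - one y| <= 0 * `|x - y|. Proof. by rewrite subrr normr0 mul0r. Qed.
Let one_loc (x t : R) : 0 <= t -> t <= Num.max 1 `|x| / 2 ->
  `|one (x - t) - one (x + t)| <= 0 * t / Num.max 1 `|x|.
Proof. by move=> _ _; rewrite subrr normr0 !mul0r. Qed.
Let one_m : measurable_fun setT one. Proof. exact: measurable_cst. Qed.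

(* The Hilbert transform of [1] is linear in [x], because its derivative is translation
   invariant, and bounded: hence it vanishes. *)
Lemma log_pot1 x : log_pot one x = 0.
Proof.
have d0 : 0 < 1 :> R := ltr01.
have j1 : (0 < 1)%N by [].
pose Q := pair_int one (fun t => kap 1 t ^+ 1).
pose c := - 1%:R * pair_int one (fun t => kap 1 t ^+ 2) 0 + local_op (jump 1 1) (fun=> 0) 1 one 0.
have Qd (y : R) : is_derive y 1 Q c.
  have := @pair_int_kap_derive R one one_ev one_b one_m 1 d0 1 y j1.
  have ik := @kap_pow_intble R 1 2 d0 isT.
  by rewrite /c !pair_int_conv.
have near0 y : near_part 1 one y = 0.
  rewrite /near_part /local_op -[RHS](@Rintegral_set0 _ _ R mu (fun=> 0)).
  rewrite Rintegral_mkcond [RHS]Rintegral_mkcond; apply: eq_Rintegral => t _.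
  by rewrite !patchE; do 2 case: ifP => _; rewrite ?mulr1 ?subrr// /one !mulr1 subrr.
have hE y : hilbert one 1 y = Q y by rewrite /hilbert near0 addr0.
have Q0 : Q 0 = 0.
  rewrite /Q /pair_int -[RHS](mulr0 2^-1); congr (_ * _).
  rewrite -[RHS](@Rintegral_set0 _ _ R mu (fun=> 0)) [RHS]Rintegral_mkcond.
  apply: eq_Rintegral => t _.
  by rewrite patchE in_set0 !expr1 sub0r add0r kapN addNr mul0r.
have Qlin y : Q y = c * y.
  have H : forall a b : R, setT a -> setT b -> `|(Q a + - c * a) - (Q b + - c * b)| <= 0 * `|a - b|.
    apply: (@lip_deriv R setT (fun s => Q s + - c * s) (fun s => c + - c * 1)) => //.
    by move=> s _; rewrite mulr1 subrr normr0.
  have := H y 0 I I; rewrite Q0 mulr0 addr0 subr0 mul0r normr_le0 => /eqP; lra.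
have c0 : c = 0.
  apply/eqP; rewrite -normr_le0 leNgt; apply/negP => cpos.
  (* At [17 / |c|] the linear function has modulus 17, above the bound [16 + 0]. *)
  have := @hilbert_bound R one one_ev one_b 0 (lexx _) one_lip one_loc 1 (17 / `|c|) d0.
  rewrite hE Qlin normrM [`|17 / _|]ger0_norm ?divr_ge0// mulrC divfK ?gt_eqF//; lra.
have H : forall a b : R, setT a -> setT b -> `|log_pot one a - log_pot one b| <= 0 * `|a - b|.
  apply: (@lip_deriv R setT _ (hilbert one 1)) => //.
  - by move=> s _; exact: (log_pot_derive one_ev one_b (lexx _) one_lip s d0).
  - by move=> s _; rewrite hE Qlin c0 mul0r normr0.
have := H x 0 I I; rewrite mul0r normr_le0 subr_eq0 => /eqP ->.
rewrite /log_pot -[RHS](mulr0 2^-1); congr (_ * _).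
rewrite -[RHS](@Rintegral_set0 _ _ R mu (fun=> 0)) [RHS]Rintegral_mkcond.
apply: eq_Rintegral => t _.
rewrite patchE in_set0 sub0r add0r {1}/log_abs sqrrN -/(log_abs t) (_ : _ - _ = 0) ?mul0r//.
by rewrite mulr2n mulrDl mul1r subrr.
Qed.

End const.

Variable w : R -> R.
Hypothesis wev : forall x, w (- x) = w x.
Hypothesis wb : forall x, `|w x| <= 1.
Variable Cw : R.
Hypothesis Cw0 : 0 <= Cw.
Hypothesis wlip : forall x y, `|w x - w y| <= Cw * `|x - y|.

Let wc : continuous w. Proof. exact: lip_continuous wlip. Qed.
Let wm : measurable_fun setT w. Proof. exact: continuous_measurable_fun. Qed.

Definition log_kernel (x y : R) := log_abs (x - y) + log_abs (x + y) - 2 * log_abs y.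

Lemma log_kernel_even x y : log_kernel x (- y) = log_kernel x y.
Proof. by rewrite /log_kernel opprK {3}/log_abs sqrrN -/(log_abs y) [X in X - _]addrC. Qed.

Lemma log_kernelE x y : y != 0 -> x - y != 0 -> x + y != 0 ->
  log_kernel x y = ln `|(x ^+ 2 - y ^+ 2) / y ^+ 2|.
Proof.
move=> y0 h1 h2; rewrite /log_kernel !log_absE//.
rewrite subr_sqr !normrM normfV normrX.
rewrite lnM ?posrE ?mulr_gt0 ?normr_gt0// ?invr_gt0 ?exprn_gt0 ?normr_gt0//.
rewrite lnM ?posrE ?normr_gt0// lnV ?posrE ?exprn_gt0 ?normr_gt0//.
by rewrite expr2 lnM ?posrE ?normr_gt0//; lra.
Qed.

Lemma log_kernel_intble x : intble setT (fun y => log_kernel x y * w y).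
Proof. by have [] := log_pot_reg wb wlip (@ltr01 R) x. Qed.

Lemma Top_log_pot x : Top w x = pi^-1 * log_pot w x.
Proof.
rewrite /Top; congr (_ * _).
pose f y := ln `|(x ^+ 2 - y ^+ 2) / y ^+ 2| * w y.
have mf : measurable_fun setT f.
  apply: measurable_funM => //.
  apply: (measurableT_comp (@measurable_ln R)).
  apply: (@measurableT_comp _ _ _ _ _ _ (fun z : R => `|z|)).
    by apply: continuous_measurable_fun; exact: norm_continuous.
  apply: measurable_funM.
    by apply: measurable_funB => //; exact: measurable_funX.
  by apply: (measurableT_comp inv_measurableT); exact: measurable_funX.
have [mN N0] := finite_null [:: 0; x; - x].
have E y : ~ [set y | y \in [:: 0; x; - x]] y -> f y = log_kernel x y * w y.
  move=> /negP; rewrite /= !inE !negb_or => /and3P[y0 yx ynx].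
  rewrite log_kernelE//; first by rewrite subr_eq0 eq_sym.
  by rewrite addrC addr_eq0.
have [iF EF] := ae_int mN N0 mf (log_kernel_intble x) E.
rewrite (@even_half_int R f)//.
  by rewrite EF.
by move=> y; rewrite /f sqrrN wev.
Qed.

Hypothesis wdec : forall x y, 0 <= x -> x <= y -> w y <= w x.

(** Constants have zero potential ([log_pot1]), so [w] may be replaced by [w - c]. The kernel
    changes sign at [s = x / sqrt 2]; for [c = w s] monotonicity gives [w - c] the sign of the
    kernel. The integrand is then nonnegative, and [[0, 1/4]] alone yields the bound. *)
Lemma log_pot_growth x : 2 <= x -> (w 4^-1 - w 2^-1) * ln x / 8 <= log_pot w x.
Proof.
move=> x2; have x0 : 0 < x by lra.
pose s := Num.sqrt (x ^+ 2 / 2); pose c := w s.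
have s0 : 0 <= s by exact: sqrtr_ge0.
have s2 : s ^+ 2 = x ^+ 2 / 2 by rewrite sqr_sqrtr// divr_ge0// sqr_ge0.
pose g y := log_kernel x y * (w y - c).
have i1 := log_kernel_intble x.
have i0 : intble setT (fun y => log_kernel x y * 1).
  have b1 z : `|(fun _ : R => 1 : R) z| <= 1 by rewrite normr1.
  have l1 z1 z2 : `|(fun _ : R => 1 : R) z1 - (fun _ : R => 1 : R) z2| <= 0 * `|z1 - z2|.
    by rewrite subrr normr0 mul0r.
  by have [] := @log_pot_reg R (fun=> 1) b1 0 l1 1 ltr01 x.
have ig : intble setT g.
  apply: eq_intble (intbleB measurableT i1 (intbleZl c measurableT i0)) => // y.
  by rewrite /g; ring.
have Eg : log_pot w x = 2^-1 * \int[mu]_y g y.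
  have z : 2^-1 * \int[mu]_y (log_kernel x y * 1) = 0 by exact: (log_pot1 x).
  have z' : \int[mu]_y (log_kernel x y * 1) = 0 by lra.
  rewrite /log_pot; congr (_ * _).
  transitivity (\int[mu]_y (log_kernel x y * w y - c * (log_kernel x y * 1))).
    by rewrite RintegralB// ?RintegralZl// ?z' ?mulr0 ?subr0//; exact: intbleZl.
  by apply: eq_Rintegral => y _; rewrite /g; ring.
have lnx : 0 <= ln x by rewrite ln_ge0//; lra.
have g0 y : 0 <= g y.
  wlog y0 : y / 0 <= y.
    move=> H; have [|/ltW yn] := leP 0 y; first exact: H.
    by have := H (- y); rewrite /g log_kernel_even wev oppr_ge0; apply.
  have [ys|ys] := leP y s.
    apply: mulr_ge0; last by rewrite subr_ge0 wdec.
    have y2 : y ^+ 2 <= x ^+ 2 / 2 by rewrite -s2 lerXn2r.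
    have yx : y < x by nra.
    have [->|yn0] := eqVneq y 0.
      rewrite /log_kernel log_abs0 subr0 addr0 mulr0 subr0.
      by rewrite log_absE ?gt_eqF// gtr0_norm// addr_ge0.
    have yp : 0 < y by rewrite lt_neqAle eq_sym yn0.
    rewrite log_kernelE ?gt_eqF//; [|lra|lra].
    rewrite ln_ge0// ger0_norm; last first.
      by rewrite divr_ge0 ?sqr_ge0// subr_ge0; have := sqr_ge0 x; lra.
    by rewrite ler_pdivlMr ?exprn_gt0//; lra.
  have yp : 0 < y by exact: le_lt_trans ys.
  rewrite mulr_le0//; last by rewrite subr_le0 wdec// ltW.
  have y2 : x ^+ 2 / 2 < y ^+ 2 by rewrite -s2; nra.
  (* At [y = x] the default [log_abs 0 = 0] makes the kernel [ln 2 - ln x]. *)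
  have [->|yx] := eqVneq y x.
    rewrite /log_kernel subrr log_abs0 add0r !log_absE ?gt_eqF ?addr_gt0//.
    rewrite !gtr0_norm ?addr_gt0// -mulr2n -[X in ln X]mulr_natl lnM ?posrE//.
    have : ln (2 : R) <= ln x by rewrite ler_ln ?posrE//.
    lra.
  have h1 : x - y != 0 by rewrite subr_eq0 eq_sym.
  have h2 : x + y != 0 by rewrite gt_eqF// addr_gt0.
  have yn0 : y != 0 by rewrite gt_eqF.
  rewrite log_kernelE//.
  apply: ln_le0; rewrite ler_norml; apply/andP; split.
    by rewrite ler_pdivlMr ?exprn_gt0//; have := sqr_ge0 x; lra.
  by rewrite ler_pdivrMr ?exprn_gt0//; lra.
(* Here the kernel is at least [ln x], and [1/2 <= s] gives [c <= w 2^-1]. *)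
have gl y : `[0, 4^-1]%classic y -> (w 4^-1 - w 2^-1) * ln x <= g y.
  rewrite /= in_itv/= => /andP[y0 y4].
  have q0 : 0 <= w 4^-1 - w 2^-1 by rewrite subr_ge0 wdec//; lra.
  have q1 : w 4^-1 - w 2^-1 <= w y - c.
    have h1 : w 4^-1 <= w y by apply: wdec.
    have h2 : c <= w 2^-1.
      apply: wdec; first by lra.
      rewrite -(@ler_pXn2r _ 2)// ?nnegrE//.
      by rewrite s2; nra.
    lra.
  rewrite mulrC; apply: ler_pM => //.
  have [->|yn0] := eqVneq y 0.
    rewrite /log_kernel log_abs0 subr0 addr0 mulr0 subr0.
    by rewrite log_absE ?gt_eqF// gtr0_norm//; lra.
  have yp : 0 < y by rewrite lt_neqAle eq_sym yn0.
  have h1 : x - y != 0 by rewrite gt_eqF//; lra.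
  have h2 : x + y != 0 by rewrite gt_eqF//; lra.
  rewrite log_kernelE// ger0_norm; last by rewrite divr_ge0 ?sqr_ge0//; nra.
  have h3 : x <= (x ^+ 2 - y ^+ 2) / y ^+ 2.
    rewrite ler_pdivlMr ?exprn_gt0//.
    have : y ^+ 2 <= 16^-1 by nra.
    nra.
  by rewrite ler_ln ?posrE//; lra.
rewrite Eg.
have mI : measurable (`[0, 4^-1]%classic : set R) by exact: measurable_itv.
have iI : \int[mu]_(y in `[0, 4^-1]%classic) ((w 4^-1 - w 2^-1) * ln x) = (w 4^-1 - w 2^-1) * ln x / 4.
  have mE : mu (`[0, 4^-1]%classic : set R) = (4^-1)%:E.
    by rewrite lebesgue_measure_itv/= lte_fin invr_gt0 ltr0n /= sube0.
  apply: etrans (@Rintegral_cst _ _ _ mu _ mI _) _.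
  by congr (_ * _); exact: (congr1 fine mE).
have icst : intble `[0, 4^-1] (fun=> (w 4^-1 - w 2^-1) * ln x).
  apply: continuous_compact_integrable; first exact: segment_compact.
  by apply: continuous_subspaceT => y; exact: cvg_cst.
(* The prefactor 1/2 of [log_pot] times the length 1/4. *)
rewrite (_ : _ / 8 = 2^-1 * ((w 4^-1 - w 2^-1) * ln x / 4)); last by lra.
rewrite ler_pM2l ?invr_gt0// -iI.
apply: (@le_trans _ _ (\int[mu]_(y in `[0, 4^-1]%classic) g y)).
  by apply: le_Rintegral => //; exact: intbleS.
rewrite (@Rint_setU R `[0, 4^-1] (~` `[0, 4^-1]))//.
- by rewrite lerDl; apply: Rintegral_ge0.
- exact: measurableC.
- by rewrite setICr.
- by rewrite setUCr.
Qed.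

End LogPotentialGrowth.

(** * Profiles and fixed points *)

Section Profile.
Variable R : realType.
Variables (a : R) (w : R -> R).
Hypothesis Dw : in_Da a w.

Lemma Da_even x : w (- x) = w x. Proof. by case: Dw => [[_ h _ _] _]. Qed.
Lemma Da_w0 : w 0 = 1. Proof. by case: Dw => [[_ _ _ h] _]. Qed.
Lemma Da_ge0 x : 0 <= w x.
Proof. by case: Dw => [_ [[h _ _] _]]; have [] := h x; rewrite ge_max => /andP[]. Qed.
Lemma Da_le1 x : w x <= 1. Proof. by case: Dw => [_ [[h _ _] _]]; have [] := h x. Qed.
Lemma Da_lower x : 1 - x ^+ 2 <= w x.
Proof. by case: Dw => [_ [[h _ _] _]]; have [] := h x; rewrite ge_max => /andP[]. Qed.
Lemma Da_dec x y : 0 <= x -> x <= y -> w y <= w x.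
Proof. by case: Dw => [_ [[_ h _] _]]; exact: h. Qed.
Lemma Da_norm x : `|w x| <= 1. Proof. by rewrite ger0_norm ?Da_le1// Da_ge0. Qed.
Lemma Da_abs x : w `|x| = w x.
Proof. by have [x0|x0] := leP 0 x; [rewrite ger0_norm|rewrite ltr0_norm// Da_even]. Qed.

(** Convexity in [s = x^2]: the mean rate of decrease over [[x^2, y^2]] is at most that over
    [[0, x^2]], which [w 0 = 1] makes explicit. *)
Lemma Da_chord x y : 0 < x -> x <= y -> w x - w y <= (y ^+ 2 - x ^+ 2) * ((1 - w x) / x ^+ 2).
Proof.
move=> x0 xy; have y0 : 0 < y by exact: lt_le_trans xy.
have x2 : 0 < x ^+ 2 by rewrite exprn_gt0.
have y2 : 0 < y ^+ 2 by rewrite exprn_gt0.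
case: Dw => [_ [[_ _ h] _]].
have l0 : 0 <= x ^+ 2 / y ^+ 2 by rewrite divr_ge0 ?ltW.
have l1 : x ^+ 2 / y ^+ 2 <= 1 by rewrite ler_pdivrMr// mul1r; nra.
have := h (y ^+ 2) 0 (x ^+ 2 / y ^+ 2) (ltW y2) (lexx 0) l0 l1.
rewrite mulr0 addr0 divfK ?gt_eqF// sqrtr0 !sqrtr_sqr !gtr0_norm// Da_w0 mulr1.
set l := x ^+ 2 / y ^+ 2 => hl.
have lE : l * y ^+ 2 = x ^+ 2 by rewrite /l divfK// gt_eqF.
rewrite mulrA ler_pdivlMr//.
have : l * (1 - w y) <= 1 - w x by lra.
have w1 := Da_le1 x.
move=> h2; have := ler_wpM2r (ltW y2) h2; rewrite mulrAC lE => h3; lra.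
Qed.

(** The lower bound [1 - x^2 <= w x] makes the chord rate at most 1. *)
Lemma Da_quad x y : 0 <= x -> x <= y -> w x - w y <= y ^+ 2 - x ^+ 2.
Proof.
rewrite le_eqVlt => /predU1P[<- y0|x0 xy].
  by rewrite Da_w0; have := Da_lower y; rewrite !expr2; lra.
apply: (le_trans (Da_chord x0 xy)).
have x2 : 0 < x ^+ 2 by rewrite exprn_gt0.
rewrite ler_piMr//; first by rewrite subr_ge0; nra.
by rewrite ler_pdivrMr// mul1r; have := Da_lower x; lra.
Qed.

(** Nonnegativity of [w] makes the chord rate at most [x^-2], the better bound for large [x]. *)
Lemma Da_quad_far x y : 0 < x -> x <= y -> w x - w y <= (y ^+ 2 - x ^+ 2) / x ^+ 2.
Proof.
move=> x0 xy; apply: (le_trans (Da_chord x0 xy)).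
have x2 : 0 < x ^+ 2 by rewrite exprn_gt0.
rewrite ler_wpM2l//; first by rewrite subr_ge0; nra.
by rewrite ler_pdivrMr// mulVf ?gt_eqF//; have := Da_ge0 x; lra.
Qed.

(** For [y - x < 1] one has [y + x <= 3] if [x <= 1], and [y + x <= 3 * x^2] otherwise; longer steps
    follow from [0 <= w <= 1]. *)
Lemma Da_lip_pos x y : 0 <= x -> x <= y -> w x - w y <= 3 * (y - x).
Proof.
move=> x0 xy; have [h|h] := leP 1 (y - x).
  by have := Da_le1 x; have := Da_ge0 y; lra.
have [x1|x1] := leP x 1.
  by apply: (le_trans (Da_quad x0 xy)); nra.
have xp : 0 < x by lra.
apply: (le_trans (Da_quad_far xp xy)); rewrite ler_pdivrMr ?exprn_gt0//.
have -> : y ^+ 2 - x ^+ 2 = (y - x) * (y + x) by ring.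
rewrite -mulrA mulrCA ler_wpM2l ?subr_ge0//.
have : x <= x ^+ 2 by nra.
lra.
Qed.

(** The constant is that of [Da_loc], so that a single [Cw] serves both. *)
Lemma Da_lip x y : `|w x - w y| <= 16 * `|x - y|.
Proof.
have H (u v : R) : 0 <= u -> u <= v -> `|w u - w v| <= 16 * `|u - v|.
  move=> u0 uv; rewrite ger0_norm ?subr_ge0 ?Da_dec// distrC ger0_norm ?subr_ge0//.
  by apply: (le_trans (Da_lip_pos u0 uv)); rewrite ler_wpM2r ?subr_ge0// ler_nat.
have H2 (u v : R) : 0 <= u -> 0 <= v -> `|w u - w v| <= 16 * `|u - v|.
  move=> u0 v0; have [uv|/ltW uv] := leP u v; first exact: H.
  by rewrite distrC [X in _ * X]distrC; exact: H.
rewrite -(Da_abs x) -(Da_abs y); apply: (le_trans (H2 _ _ (normr_ge0 _) (normr_ge0 _))).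
by rewrite ler_wpM2l// ler_dist_dist.
Qed.

(** For [x > 1] the chord bound is [4 * x * t / (x - t)^2], and [t <= x / 2] gives
    [x <= 2 * (x - t)], hence [16 * t / x]. *)
Lemma Da_loc (x t : R) : 0 <= t -> t <= Num.max 1 `|x| / 2 ->
  `|w (x - t) - w (x + t)| <= 16 * t / Num.max 1 `|x|.
Proof.
wlog x0 : x / 0 <= x.
  move=> H; have [|/ltW xn] := leP 0 x; first exact: H.
  have := H (- x); rewrite oppr_ge0 normrN => /(_ xn) h t0 tX.
  have := h t0 tX; rewrite -[w (- x - t)]Da_even -[w (- x + t)]Da_even distrC.
  by rewrite !opprD !opprK.
move=> t0; rewrite (ger0_norm x0).
have [x1|x1] := leP x 1.
  move=> t2; rewrite divr1.
  have h1 := Da_lip (x - t) (x + t).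
  have [xt|xt] := leP 0 (x - t).
    have := @Da_lip_pos (x - t) (x + t) xt.
    rewrite ger0_norm ?subr_ge0 ?Da_dec//; [|lra].
    move=> h; have : x - t <= x + t by lra.
    by move=> /h; lra.
  rewrite -[w (x - t)]Da_even ger0_norm; last by rewrite subr_ge0 Da_dec//; lra.
  have hx : 0 <= - (x - t) by lra.
  have hy : - (x - t) <= x + t by lra.
  have := Da_lip_pos hx hy; lra.
move=> t2.
have xt : 0 < x - t by lra.
have xt2 : x - t <= x + t by lra.
rewrite ger0_norm ?subr_ge0 ?Da_dec ?(ltW xt)//.
apply: (le_trans (Da_quad_far xt xt2)).
rewrite ler_pdivrMr ?exprn_gt0// mulrAC ler_pdivlMr; last by lra.
have : x ^+ 2 <= 4 * (x - t) ^+ 2 by nra.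
nra.
Qed.

(** The condition on the left derivative enters here: equality would make [w] constant on
    [[1/4, 1/2]], with left derivative 0 at 1/2. *)
Lemma Da_drop : 0 < w 4^-1 - w 2^-1.
Proof.
rewrite subr_gt0 lt_neqAle Da_dec ?invr_ge0// ?lef_pV2 ?posrE ?ler_nat// andbT.
apply/eqP => E.
case: Dw => [_ [_ [l [hl l0]]]].
have e0 : 0 < Defs.eta a.
  by rewrite /Defs.eta invr_gt0 mulr_gt0 ?powR_gt0// exprn_gt0// ltr_wpDr.
have h0 : (fun h : R => (w (2^-1 + h) - w 2^-1) / h) @ (0 : R)^'- --> (0 : R).
  apply: cvg_near_cst; near=> h.
  have hn : h < 0 by near: h; exact: nbhs_left_lt.
  have h4 : - 4^-1 < h by near: h; apply: nbhs_left_gt; rewrite oppr_lt0 invr_gt0.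
  have -> : w (2^-1 + h) = w 2^-1.
    apply/eqP; rewrite eq_le; apply/andP; split; last by apply: Da_dec; lra.
    by rewrite E; apply: Da_dec; lra.
  by rewrite subrr mul0r.
have l00 : l = 0 by apply: (cvg_unique _ hl h0).
lra.
Unshelve. all: end_near. Qed.

End Profile.

Lemma continuous_pos_near (R : realType) (f : R -> R) (x : R) :
  {for x, continuous f} -> 0 < f x ->
  exists2 d : R, 0 < d & forall t, `|t - x| < d -> 0 < f t.
Proof.
move=> fc f0; have /cvgrPdist_lt/(_ _ f0) := fc.
move=> /nbhs_ballP[d /= d0 H]; exists d => // t tx.
have := H t; rewrite /ball /= distrC => /(_ tx).
by rewrite ltr_distl => /andP[_]; rewrite -ltrBlDr subrr.
Qed.

Lemma itv_sym_open (R : realType) (r : R) : open (`]- r, r[%classic : set R).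
Proof.
have -> : `]- r, r[%classic = ball (0 : R) r :> set R; last exact: ball_open.
by apply/seteqP; split => x; rewrite /= /ball /= in_itv /= sub0r normrN ltr_norml.
Qed.

(** * The bootstrap from the fixed point equation *)

Section FixedPoint.
Variable R : realType.
Variables (a : R) (w : R -> R).
Hypothesis a0 : a != 0.
Hypothesis Dw : in_Da a w.
Hypothesis fixw : forall x, Ra a w x = (w x)%:E.

Let wev := Da_even Dw.
Let wb := Da_norm Dw.
Let wlip := Da_lip Dw.
Let wloc := Da_loc Dw.
Let Cw0 : (0 : R) <= 16. Proof. by []. Qed.
Let hil := hilbert w 1.

(** [base], [slope] and [ibase] are the b, K and p of the overview. *)
Definition base x : R := 1 - a * Top w x / rop w.
Definition slope : R := a / (rop w * pi).
Definition ibase x : R := (base x)^-1.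

Lemma baseE x : base x = 1 - slope * log_pot w x.
Proof.
rewrite /base (Top_log_pot wev wb wlip) /slope.
by move: (rop w) (log_pot w x) => r P; rewrite invfM; ring.
Qed.

Lemma fixed_pos x : 0 < w x -> 0 < base x /\ w x = base x `^ a^-1.
Proof.
move=> w0; have := fixw x; rewrite /Ra -/(base x); case: ifP => b0.
  by move=> [<-].
by case: ifP => // _ [E]; rewrite -E ltxx in w0.
Qed.

(** For [a < 0] a nonpositive base would give [+oo], which is not a value of [w]. *)
Lemma fixed_neg : a < 0 -> forall x, 0 < w x.
Proof.
move=> an x; have := fixw x; rewrite /Ra -/(base x); case: ifP => b0.
  by move=> [<-]; exact: powR_gt0.
by rewrite ltNge (ltW an).
Qed.

Lemma base_powR x : 0 < w x -> base x = w x `^ a.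
Proof.
move=> /fixed_pos[b0 ->]; rewrite -powRrM mulVf// powRr1// ltW//.
Qed.

Lemma base_derive (x : R) : is_derive x 1 base (- slope * hil x).
Proof.
have -> : base = fun x => 1 + - slope * log_pot w x.
  by apply/funext => y; rewrite baseE mulNr.
have H := is_deriveZ_pt (- slope) (log_pot_derive wev wb Cw0 wlip x (@ltr01 R)).
by apply: (is_derive_eq (is_deriveD_pt (is_derive_cst_pt 1 x) H)); rewrite add0r.
Qed.

Lemma ibase_derive (x : R) : 0 < base x -> is_derive x 1 ibase (slope * hil x * (ibase x * ibase x)).
Proof.
move=> b0; have bD := base_derive x.
have H : is_derive x 1 ibase (- (base x) ^- 2 *: (- slope * hil x)).
  by apply: is_deriveV; rewrite gt_eqF.
apply: (is_derive_eq H); rewrite /GRing.scale /= /ibase -exprVn; ring.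
Qed.

Lemma powR_base_derive (x : R) : 0 < base x ->
  is_derive x 1 (fun x : R => base x `^ a^-1) (- slope / a * hil x * (base x `^ a^-1 * ibase x)).
Proof.
move=> b0; have bD := base_derive x.
have [d d0 Hd] := continuous_pos_near (is_derive_cont bD) b0.
apply: (@is_derive_local _ _ (fun x => expR (a^-1 * ln (base x))) x d) => //.
  by move=> t /Hd bt; rewrite /powR gt_eqF.
have lnD := is_derive_comp_pt bD (is_derive1_ln b0).
have := is_derive_comp_pt (is_deriveZ_pt a^-1 lnD) (is_derive_expR _).
move=> H; apply: (is_derive_eq H).
by rewrite /powR gt_eqF// /ibase; ring.
Qed.

Lemma w_cont : continuous w. Proof. exact: (lip_continuous wlip). Qed.

Lemma w_pos_near x : 0 < w x -> exists2 d, 0 < d & forall t, `|t - x| < d -> 0 < w t.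
Proof. by move=> w0; apply: continuous_pos_near => //; exact: w_cont. Qed.

Lemma profile_derive (x : R) : 0 < w x -> is_derive x 1 w (- slope / a * hil x * (w x * ibase x)).
Proof.
move=> w0; have [d d0 Hd] := w_pos_near w0.
have [b0 wE] := fixed_pos w0.
rewrite wE; apply: (is_derive_local d0 _ (powR_base_derive b0)) => t /Hd wt.
by have [] := fixed_pos wt.
Qed.

(** Start of the bootstrap: [w] is Lipschitz, and the derivative of [ibase] is bounded once [ibase]
    is; [16 + 16] is [hilbert_bound] with [Cw = 16]. *)
Lemma profile_Cn0 (V : set R) B : convex V -> (forall x, V x -> 0 < w x) ->
  (forall x, V x -> ibase x <= B) -> Cn V 0 w /\ Cn V 0 ibase.
Proof.
move=> cV Vw VB; split; first exact: holder_sub (w_holder wb Cw0 wlip).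
have nb x : V x -> `|ibase x| <= B.
  by move=> Vx; have [b0 _] := fixed_pos (Vw _ Vx); rewrite ger0_norm ?VB// invr_ge0 ltW.
apply: (holder_deriv cV nb (g := fun x => slope * hil x * (ibase x * ibase x))).
  by move=> x /Vw/fixed_pos[b0 _]; exact: ibase_derive.
exists (`|slope| * (16 + 16) * (B * B)) => x Vx.
rewrite !normrM !ler_pM ?mulr_ge0 ?normr_ge0 ?nb//.
exact: (hilbert_bound wev wb Cw0 wlip wloc).
Qed.

(** The Hilbert transform is cut at the margin [d] between [V] and [U], so on [V] it has the class
    that [w] has on [U]; the equations for [w'] and [p'] gain the derivative. *)
Lemma profile_CnS (U V : set R) d n : 0 < d -> open U -> open V -> convex U -> convex V ->
  (forall x t, V x -> `|t| < d -> U (x + t)) -> (forall x, U x -> 0 < w x) ->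
  Cn U n w -> Cn U n ibase -> Cn V n.+1 w /\ Cn V n.+1 ibase.
Proof.
move=> d0 oU oV cU cV VU Uw wC pC.
have VsU : V `<=` U by move=> x /(VU x 0); rewrite addr0 normr0; exact.
have hC : Cn V n hil.
  have -> : hil = hilbert w d.
    by apply/funext => x; exact: (hilbert_indep wev wb Cw0 wlip).
  exact: (hilbert_Cn wev wb Cw0 wlip wloc d0 oU oV cU cV VU wC).
have wV := Cn_sub VsU wC; have pV := Cn_sub VsU pC.
split; (split; first exact: Cn_holder wV || exact: Cn_holder pV).
  exists (fun x => - slope / a * hil x * (w x * ibase x)).
    by move=> x /VsU/Uw; exact: profile_derive.
  by apply: CnM; apply: CnM => //; exact: Cn_cst.
exists (fun x => slope * hil x * (ibase x * ibase x)).
  by move=> x /VsU/Uw/fixed_pos[b0 _]; exact: ibase_derive.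
by apply: CnM; apply: CnM => //; exact: Cn_cst.
Qed.

Lemma profile_Cn_neg n : a < 0 -> Cn setT n w.
Proof.
move=> an; have wp := fixed_neg an.
suff [] : Cn setT n w /\ Cn setT n ibase by [].
elim: n => [|n [IH1 IH2]]; last first.
  by apply: (@profile_CnS setT setT 1) => //; exact: openT.
apply: (@profile_Cn0 _ 1) => // x _.
(* [ibase] is [w ^ (- a)] with [- a > 0], and [w <= 1]. *)
have e1 : 1 `^ (- a) = 1 :> R by rewrite powR1.
rewrite /ibase base_powR// -powRN -[leRHS]e1.
by rewrite ge0_ler_powR ?nnegrE ?oppr_ge0 ?(ltW an) ?(ltW (wp x)) ?(Da_le1 Dw).
Qed.

(** Each order costs a slightly larger interval, so [r] varies in the induction. Continuity leaves
    room to enlarge [r] with [w] still positive, and monotonicity bounds [ibase] by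
    [w r ^ (- a)]. *)
Lemma profile_Cn_pos n r : 0 < a -> 0 < r -> 0 < w r -> Cn `]- r, r[%classic n w.
Proof.
move=> ap r0 w0.
suff [] : Cn `]- r, r[%classic n w /\ Cn `]- r, r[%classic n ibase by [].
have cI (s : R) : convex `]- s, s[%classic.
  move=> x y z; rewrite /= !in_itv /= => /andP[? ?] /andP[? ?] ? ?; apply/andP; split; lra.
have Iw (s : R) : 0 < w s -> forall x, `]- s, s[%classic x -> w s <= w x /\ 0 < w x.
  move=> ws x; rewrite /= in_itv /= => xs.
  have H : w s <= w x.
    by rewrite -(Da_abs Dw x) (Da_dec Dw)// ltW// ltr_norml.
  by split => //; exact: lt_le_trans H.
elim: n r r0 w0 => [|n IH] r r0 w0.
  apply: (@profile_Cn0 _ (w r `^ a)^-1) => // x /(Iw _ w0)[wr wx] //.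
  rewrite /ibase base_powR// lef_pV2 ?posrE ?powR_gt0//.
  by rewrite ge0_ler_powR ?nnegrE ?(ltW ap) ?(ltW wx) ?(ltW w0).
have [d d0 Hd] := w_pos_near w0.
pose s := r + d / 2.
have w1 : 0 < w s by apply: Hd; rewrite /s addrC addKr gtr0_norm; lra.
have s0 : 0 < s by rewrite /s; lra.
have [h1 h2] := IH s s0 w1.
apply: (@profile_CnS `]- s, s[%classic _ (d / 2)) ; rewrite ?divr_gt0//; do ?exact: itv_sym_open; do ?exact: cI.
  move=> x t; rewrite /= !in_itv /= ltr_norml /s => /andP[? ?] /andP[? ?].
  apply/andP; split; lra.
by move=> x /(Iw _ w1)[].
Qed.

End FixedPoint.

(** * Sobolev regularity and support *)

Section Derivatives.
Variable R : realType.
Implicit Types (U : set R) (f g : R -> R).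

Lemma is_derive_on U f g x l : open U -> (forall y, U y -> f y = g y) -> U x ->
  is_derive x (1 : R) f l -> is_derive x (1 : R) g l.
Proof.
move=> oU fg Ux fl; have /nbhs_ballP[d /= d0 H] := open_nbhs_nbhs (conj oU Ux).
apply: (is_derive_local d0 _ fl) => t tx.
by rewrite fg//; apply: H; rewrite /ball /= distrC.
Qed.

Lemma Cn_eq_on U n f g : open U -> (forall y, U y -> f y = g y) -> Cn U n f -> Cn U n g.
Proof.
move=> oU fg; have H : holder U f -> holder U g.
  move=> [al [C [a0 C0 h1 h2]]]; exists al, C; split => //.
    by move=> x Ux; rewrite -fg//; exact: h1.
  by move=> x y Ux Uy; rewrite -!fg//; exact: h2.
case: n => [|n]; first exact: H.
move=> [/H gH [f' ff' f'C]]; split => //; exists f' => // x Ux.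
by apply: (is_derive_on oU fg Ux); exact: ff'.
Qed.

Lemma Cn_is_derive U f n (x : R) : Cn U n.+1 f -> U x -> is_derive x 1 f (derive1 f x).
Proof. by move=> [_ [g fg _]] /fg[df _]; rewrite derive1E; exact: DeriveDef. Qed.

(** Replaces the witnesses hidden in [Cn] by iterates of [derive1], one family for all orders. *)
Lemma Cn_derive1 U f n : open U -> Cn U n.+1 f -> Cn U n (derive1 f).
Proof.
move=> oU [_ [g fg gC]]; apply: (Cn_eq_on oU _ gC) => x /fg[df <-].
by rewrite derive1E.
Qed.

Lemma Cn_derive1n U f j n : open U -> (forall n, Cn U n f) -> Cn U n (derive1n j f).
Proof.
move=> oU fC; elim: j n => [|j IH] n; first by rewrite derive1n0.
by rewrite derive1nS; exact: Cn_derive1.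
Qed.

Lemma Cn_is_derive1n U f j (x : R) : open U -> (forall n, Cn U n f) -> U x ->
  is_derive x 1 (derive1n j f) (derive1n j.+1 f x).
Proof.
by move=> oU fC Ux; rewrite derive1nS; apply: (@Cn_is_derive U _ 0) => //; exact: Cn_derive1n.
Qed.

Lemma nonincreasing_derive_le0 f (x l : R) : is_derive x 1 f l ->
  (forall y, x <= y -> f y <= f x) -> l <= 0.
Proof.
move=> /is_derive_epsP H fd; rewrite leNgt; apply/negP => l0.
have [d d0 Hd] := H (l / 2) (divr_gt0 l0 (ltr0n _ 2)).
have h0 : 0 < d / 2 by lra.
have hd : `|d / 2| < d by rewrite gtr0_norm//; lra.
have := Hd _ hd; have := fd (x + d / 2); rewrite lerDl ltW// => /(_ isT) h1.
rewrite (gtr0_norm h0) ler_norml => /andP[h2 _]; nra.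
Qed.

End Derivatives.

(** * Weak derivatives and square integrability *)

Section Sobolev.
Variable R : realType.
Notation mu := (@lebesgue_measure R).
Notation intble D f := (mu.-integrable D (EFin \o f)).
Implicit Types (f g F G : R -> R).

Lemma derive_LRcontinuous F f (a b : R) : (forall x : R, is_derive x 1 F (f x)) ->
  derivable_oo_LRcontinuous F a b.
Proof.
move=> dF; split.
- by move=> x _; case: (dF x).
- exact: (cvg_at_right_filter (is_derive_cont (dF _))).
- exact: (cvg_at_left_filter (is_derive_cont (dF _))).
Qed.

Lemma derive1_of F f (x : R) : (forall x : R, is_derive x 1 F (f x)) -> derive1 F x = f x.
Proof. by move=> dF; rewrite derive1E; case: (dF x). Qed.

Lemma int_by_parts F G f g (a b : R) : a < b ->
  (forall x : R, is_derive x 1 F (f x)) -> (forall x : R, is_derive x 1 G (g x)) ->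
  continuous f -> continuous g ->
  \int[mu]_(x in `[a, b]) (F x * g x) =
    (F b * G b - F a * G a) - \int[mu]_(x in `[a, b]) (f x * G x).
Proof.
move=> ab dF dG cf cg; apply: Rintegration_by_parts => //.
- exact: continuous_subspaceT.
- exact: derive_LRcontinuous dF.
- by move=> x _; exact: derive1_of.
- exact: continuous_subspaceT.
- exact: derive_LRcontinuous dG.
- by move=> x _; exact: derive1_of.
Qed.

Lemma int_derive F f (a b : R) : a < b -> (forall x : R, is_derive x 1 F (f x)) -> continuous f ->
  \int[mu]_(x in `[a, b]) f x = F b - F a.
Proof.
move=> ab dF cf; rewrite /Rintegral (@continuous_FTC2 R f F)//.
- exact: continuous_subspaceT.
- exact: derive_LRcontinuous dF.
- by move=> x _; exact: derive1_of.
Qed.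

Lemma Rint_restrict f (D : set R) : (forall x, ~ D x -> f x = 0) ->
  \int[mu]_x f x = \int[mu]_(x in D) f x.
Proof.
move=> f0; rewrite [RHS]Rintegral_mkcond; congr (Rintegral _ _ _).
apply/funext => x; rewrite patchE; case: ifPn => // /negP xD.
by rewrite f0// => Dx; apply: xD; rewrite inE.
Qed.

Lemma derive_weak_deriv f g : (forall x : R, is_derive x 1 f (g x)) -> continuous g -> weak_deriv f g.
Proof.
move=> fg cg phi D [D0 dD [M phi0]].
(* The added 1 puts the endpoints beyond [M], so the boundary terms vanish too. *)
pose N := `|M| + 1.
have N0 : 0 < N by rewrite ltr_wpDl.
have MN (x : R) : ~ `[- N, N]%classic x -> M < `|x|.
  move=> /= /negP; rewrite in_itv /= -ler_norml -ltNge => h.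
  by apply: le_lt_trans h; rewrite /N ler_wpDr// ler_norm.
have D10 (x : R) : M < `|x| -> D 1%N x = 0.
  move=> Mx; apply: (is_derive_unique (f := phi) (x := x)); first by rewrite -D0; exact: dD.
  have xM : 0 < `|x| - M by rewrite subr_gt0.
  apply: (is_derive_local xM _ (is_derive_cst_pt 0 x)) => t tx; apply: phi0.
  have := ler_dist_dist x t; rewrite distrC in tx.
  by rewrite ler_norml => /andP[_]; lra.
rewrite (@Rint_restrict _ `[- N, N]); last by move=> x /MN/D10 ->; rewrite mulr0.
rewrite (@Rint_restrict (fun x => g x * phi x) `[- N, N]); last first.
  by move=> x /MN/phi0 ->; rewrite mulr0.
have pN : phi N = 0 /\ phi (- N) = 0.
  have MN1 : M < `|N| by rewrite gtr0_norm// /N; have := ler_norm M; lra.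
  by split; apply: phi0; rewrite ?normrN.
have dphi (x : R) : is_derive x 1 phi (D 1%N x) by rewrite -D0; exact: dD.
have NN : - N < N by lra.
rewrite (int_by_parts NN fg dphi cg (fun x => is_derive_cont (dD 1%N x))).
by case: pN => -> ->; rewrite !mulr0 subrr sub0r.
Qed.

Lemma L2_of_bounded f C : continuous f ->
  (forall n : nat, (\int[mu]_(x in `[- n%:R, n%:R]) (f x * f x)) <= C) -> L2 f.
Proof.
move=> cf fC; have mf : measurable_fun setT f by exact: continuous_measurable_fun.
split => //.
have mf2 : measurable_fun setT (fun x : R => f x ^+ 2).
  by apply: measurable_funX.
pose F (n : nat) : set (measurableTypeR R) := `[- n%:R, n%:R]%classic.
have UF : \bigcup_n F n = setT.
  apply/seteqP; split => x //= _; exists (Num.truncn `|x|).+1 => //.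
  by rewrite /F /= in_itv /= -ler_norml ltW// truncnS_gt.
have nd : {homo F : n m / (n <= m)%N >-> (n <= m)%O}.
  move=> n m nm; apply/subsetPset => x; rewrite /F /= !in_itv/= -!ler_norml => h.
  by apply: (le_trans h); rewrite ler_nat.
have mF n : measurable_fun (F n) (fun t : R => (f t ^+ 2)%:E).
  by apply/measurable_EFinP; exact: measurable_funTS.
have c := @ge0_nondecreasing_set_cvg_integral _ _ _ F (fun t => (f t ^+ 2)%:E) mu nd
    (fun i => measurable_itv _) mF (fun _ x _ => sqr_ge0 (f x)).
rewrite -UF -(cvg_lim _ c)//.
apply: (@le_lt_trans _ _ C%:E); last exact: ltry.
apply: lime_le; first by apply/cvg_ex; eexists; exact: c.
apply: nearW => n.
have iF : intble `[- n%:R, n%:R] (fun x => f x * f x).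
  apply: continuous_compact_integrable; first exact: segment_compact.
  by apply: continuous_subspaceT => x; apply: cvgM; exact: cf.
have := fC n; rewrite -lee_fin /Rintegral fineK; last exact: (integrable_fin_num _ iF).
apply: le_trans; rewrite le_eqVlt; apply/predU1l.
by apply: eq_integral => x _; rewrite expr2.
Qed.

Section BoundedDerivatives.
Variable f : R -> R.
Hypothesis fC : forall n, Cn setT n f.
Hypothesis fev : forall x, f (- x) = f x.
Hypothesis fdec : forall x y, 0 <= x -> x <= y -> f y <= f x.
Hypothesis fge0 : forall x, 0 <= f x.
Let f_ (j : nat) : R -> R := derive1n j f.

Let df j (x : R) : is_derive x 1 (f_ j) (f_ j.+1 x).
Proof. by apply: (Cn_is_derive1n j openT fC). Qed.

Let cf j : continuous (f_ j).
Proof. by move=> x; exact: is_derive_cont (df j x). Qed.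

Let bf j : exists2 C, 0 <= C & forall x, `|f_ j x| <= C.
Proof.
have [C HC] := holder_bnd (Cn_holder (Cn_derive1n j 0 openT fC)).
by exists C => [|x]; [exact: le_trans (HC 0 I)|exact: HC].
Qed.

Lemma even_dec_derive_abs (x : R) :
  `|f_ 1 x| = if x <= 0 then f_ 1 x else - f_ 1 x.
Proof.
have sgn (y : R) : 0 <= y -> f_ 1 y <= 0.
  move=> y0; apply: (nonincreasing_derive_le0 (df 0 y)) => z; exact: fdec.
have odd1 (y : R) : f_ 1 (- y) = - f_ 1 y.
  have H := is_derive_comp_pt (is_deriveN (is_derive_id y (1 : R))) (df 0 (- y)).
  have E : (fun x => f_ 0 (- x)) = f_ 0 by apply/funext => z; exact: fev.
  rewrite E in H; have := is_derive_unique H (df 0 y); lra.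
case: ifPn => [x0|]; last by rewrite -ltNge => /ltW/sgn h; rewrite ler0_norm.
by rewrite ger0_norm// -[x]opprK odd1 oppr_ge0 sgn// oppr_ge0.
Qed.

(** Total variation: [f] rises by at most [f 0] left of 0 and falls by at most [f 0] right of it. *)
Lemma int_derive_abs (u v : R) : u < v -> \int[mu]_(x in `[u, v]) `|f_ 1 x| <= 2 * f 0.
Proof.
move=> uv.
(* an antiderivative of |f'| *)
pose W (x : R) := if x <= 0 then f x else 2 * f 0 + (-1) * f x.
have dN (x : R) : is_derive x 1 (fun x => 2 * f 0 + (-1) * f x) (- f_ 1 x).
  have H := is_deriveD_pt (is_derive_cst_pt (2 * f 0) x) (is_deriveZ_pt (-1) (df 0 x)).
  by apply: (is_derive_eq H); rewrite add0r mulN1r.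
have dW (x : R) : is_derive x 1 W `|f_ 1 x|.
  rewrite even_dec_derive_abs; have [x0|x0|->] := ltgtP x 0.
  - apply: (@is_derive_local _ W f x (- x)); rewrite ?oppr_gt0//; last exact: (df 0 x).
    by move=> t; rewrite ltr_norml /W => /andP[_ h]; rewrite ifT//; lra.
  - apply: (@is_derive_local _ W _ x x) (dN x) => // t.
    by rewrite ltr_norml /W => /andP[h _]; rewrite ifF//; apply/negbTE; rewrite -ltNge; lra.
  - have f10 : f_ 1 0 = 0.
      have := even_dec_derive_abs 0; rewrite lexx => h.
      apply/eqP; rewrite eq_le -{2}h normr_ge0 andbT.
      by apply: (nonincreasing_derive_le0 (df 0 0)) => z; exact: fdec.
    have := df 0 0; rewrite f10 => /is_derive_epsP H.
    apply/is_derive_epsP => e /H[d d0 Hd]; exists d => // h /Hd.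
    rewrite /W !mulr0 !subr0 add0r lexx; case: ifP => // _ H2.
    rewrite (_ : _ - _ = - (f h - f 0)) ?normrN// -[f h]/(f_ 0 h); lra.
have cn : continuous (fun x => `|f_ 1 x|) by move=> x; apply: cvg_norm; exact: cf.
rewrite (int_derive uv dW cn).
have f01 x : f x <= f 0.
  have [x0|x0] := leP 0 x; first exact: fdec.
  by rewrite -fev; apply: fdec => //; lra.
have W0 x : 0 <= W x <= 2 * f 0.
  have := f01 x; have := fge0 x; rewrite /W; case: ifP => _ ? ?; apply/andP; split; lra.
by have /andP[_ ?] := W0 v; have /andP[? _] := W0 u; lra.
Qed.

(** Integration by parts trades [f_ n.+2 * f_ m] for [f_ n.+1 * f_ m.+1] until a factor [f_ 1] is
    left, whose integral is the total variation. Only suprema and that variation enter, so the bound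
    is uniform in the interval. *)
Lemma int_derive_prod_bounded n m :
  exists C, forall u v, u < v -> `|\int[mu]_(x in `[u, v]) (f_ n.+1 x * f_ m x)| <= C.
Proof.
elim: n m => [|n IH] m.
  have [C C0 HC] := bf m; exists (C * (2 * f 0)) => u v uv.
  have cn : continuous (fun x => `|f_ 1 x|) by move=> x; apply: cvg_norm; exact: cf.
  have iN : intble `[u, v] (fun x => C * `|f_ 1 x|).
    apply: continuous_compact_integrable; first exact: segment_compact.
    by apply: continuous_subspaceT => x; apply: cvgM; [exact: cvg_cst|exact: cn].
  have i1 : intble `[u, v] (fun x => `|f_ 1 x|).
    apply: continuous_compact_integrable; first exact: segment_compact.
    exact: continuous_subspaceT.
  apply: (@le_trans _ _ (\int[mu]_(x in `[u, v]) (C * `|f_ 1 x|))).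
    apply: le_norm_int => //.
      apply: measurable_funTS; apply: continuous_measurable_fun => x.
      by apply: cvgM; exact: cf.
    by move=> x _; rewrite normrM mulrC ler_wpM2r.
  rewrite (@RintegralZl _ _ _ mu)//.
  by apply: ler_wpM2l => //; exact: int_derive_abs.
have [C HC] := IH m.+1; have [A A0 HA] := bf n.+1; have [B B0 HB] := bf m.
exists (2 * (B * A) + C) => u v uv.
under eq_Rintegral do rewrite mulrC.
rewrite (int_by_parts uv (df m) (df n.+1) (@cf m.+1) (@cf n.+2)).
under eq_Rintegral do rewrite mulrC.
apply: (le_trans (ler_normB _ _)); apply: lerD; last exact: HC.
apply: (le_trans (ler_normB _ _)); rewrite mulr2n mulrDl !mul1r.
by apply: lerD; rewrite normrM ler_pM.
Qed.

Lemma derive_inHk k : inHk k (f_ 1).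
Proof.
exists (fun j => f_ j.+1); split => // j _.
  have [C HC] := int_derive_prod_bounded j j.+1.
  (* The maximum with 0 covers the one-point interval at [n = 0], where [u < v] fails. *)
  apply: (@L2_of_bounded _ (Num.max C 0)) => // -[|n].
    by rewrite oppr0 set_itv1 Rintegral_set1 le_max lexx orbT.
  rewrite le_max; apply/orP; left; apply: (le_trans (ler_norm _)).
  by apply: HC; have : (0 : R) < n.+1%:R by []; lra.
exact: (derive_weak_deriv (df j.+1) (@cf j.+2)).
Qed.

Lemma derive_weak : weak_deriv f (f_ 1).
Proof. exact: (derive_weak_deriv (df 0) (@cf 1)). Qed.

End BoundedDerivatives.

End Sobolev.

(** * Finite support and interior smoothness for positive exponents *)

Section CompactSupport.
Variable R : realType.
Variables (a : R) (w : R -> R).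
Hypothesis a0 : 0 < a.
Hypothesis Dw : in_Da a w.
Hypothesis fixw : forall x, Ra a w x = (w x)%:E.

Lemma rop_ge0 : 0 <= rop w.
Proof.
rewrite /rop mulr_ge0 ?invr_ge0 ?pi_ge0//; apply: Rintegral_ge0 => y _.
by rewrite divr_ge0 ?sqr_ge0// subr_ge0 (Da_w0 Dw) (Da_le1 Dw).
Qed.

(** Were [slope] zero, in particular were [rop w] zero, [base] would be 1 and [w] constant, against
    [Da_drop]. *)
Lemma slope_gt0 : 0 < slope a w.
Proof.
rewrite lt_neqAle; apply/andP; split; last first.
  by rewrite /slope; apply: divr_ge0; [exact: ltW|apply: mulr_ge0; [exact: rop_ge0|exact: pi_ge0]].
apply/eqP => K0.
have w1 x : w x = 1.
  have := fixw x; rewrite /Ra -/(base a w x) (baseE Dw) -K0 mul0r subr0 ltr01.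
  by move=> -[<-]; rewrite powR1.
by have := Da_drop Dw; rewrite !w1 subrr ltxx.
Qed.

(** A positive [w] would keep [base] positive everywhere, against the growth of [log_pot]. *)
Lemma profile_zero : exists x, w x = 0.
Proof.
apply: contrapT => nz.
have wp x : 0 < w x.
  rewrite lt_neqAle (Da_ge0 Dw) andbT eq_sym; apply/eqP => wx; apply: nz; by exists x.
pose d := w 4^-1 - w 2^-1; have d0 : 0 < d := Da_drop Dw.
have K0 := slope_gt0.
(* Makes [slope * d * t / 8] exceed 1, hence the base at [expR t] negative; the added 1 also ensures
   [2 <= expR t]. *)
pose t := 8 / (d * slope a w) + 1.
have t1 : 1 <= t by rewrite /t lerDr divr_ge0// ltW// mulr_gt0.
have x2 : 2 <= expR t by have := expR_ge1Dx t; lra.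
have := log_pot_growth (Da_even Dw) (Da_norm Dw) (Da_lip Dw) (Da_dec Dw) x2.
rewrite expRK => h.
have [b0 _] := fixed_pos fixw (wp (expR t)).
move: b0; rewrite (baseE Dw) subr_gt0 => b1.
have := ler_wpM2l (ltW K0) h; rewrite -/d => h2.
have : slope a w * (d * t / 8) = 1 + slope a w * d / 8.
  by rewrite /t; field; rewrite !gt_eqF.
have : 0 < slope a w * d / 8 by apply: divr_gt0 => //; exact: mulr_gt0.
lra.
Qed.

Lemma Lsup_ge x : 0 < w x -> ((`|x|)%:E <= Lsup w)%E.
Proof. by move=> wx; apply: ereal_sup_ubound; exists `|x|; rewrite //= (Da_abs Dw). Qed.

Lemma Lsup_fin : (Lsup w < +oo)%E.
Proof.
have [y wy] := profile_zero.
apply: (@le_lt_trans _ _ (`|y|)%:E); last exact: ltry.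
apply: ge_ereal_sup => _ [x /= wx <-]; rewrite lee_fin.
rewrite leNgt; apply/negP => yx.
have := Da_dec Dw (normr_ge0 y) (ltW yx); rewrite (Da_abs Dw) wy leNgt => /negP; apply.
by apply: (lt_le_trans wx).
Qed.

Lemma zero_out_Lsup x : (Lsup w < (`|x|)%:E)%E -> w x = 0.
Proof.
move=> Lx; apply/eqP; rewrite eq_le (Da_ge0 Dw) andbT leNgt; apply/negP => /Lsup_ge.
by rewrite leNgt Lx.
Qed.

(** One family of iterated derivatives serves all the intervals []- y, y[] with [w y > 0], and these
    exhaust the open interval. *)
Lemma smooth_in_Lsup : smooth_on w (- Lsup w)%E (Lsup w).
Proof.
exists (fun n => derive1n n w); split => // n x Lx xL.
have : ((`|x|)%:E < Lsup w)%E.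
  have [x0|x0] := leP 0 x; first by rewrite ger0_norm.
  by rewrite ltr0_norm// EFinN lteNl.
move=> /ereal_sup_gt[_ [y /= wy <-]]; rewrite lte_fin => xy.
have y0 : 0 < y by exact: le_lt_trans xy.
apply: (@Cn_is_derive1n R `]- y, y[%classic); first exact: itv_sym_open.
  by move=> m; apply: (profile_Cn_pos (a := a)) => //; rewrite gt_eqF.
by rewrite /= in_itv /= -ltr_norml.
Qed.

End CompactSupport.

Theorem mainTheorem16 (R : realType) (a : R) (w : R -> R) :
  (a < 0 \/ 0 < a < 1) ->
  in_Da a w ->
  (forall x, Ra a w x = (w x)%:E) ->
  (a < 0 ->
     (forall x, 0 < w x) /\
     exists g : R -> R, weak_deriv w g /\ forall k : nat, inHk k g) /\
  (0 < a < 1 ->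
     (Lsup w < +oo)%E /\
     (forall x, (Lsup w < (`|x|)%:E)%E -> w x = 0) /\
     smooth_on w (- Lsup w)%E (Lsup w)).
Proof.
move=> _ Dw fixw; split.
  move=> an; split; first exact: fixed_neg fixw an.
  have wC n : Cn setT n w by apply: (profile_Cn_neg (a := a)) => //; rewrite lt_eqF.
  exists (derive1n 1 w); split.
    by apply: derive_weak.
  by apply: derive_inHk => //; [exact: Da_even Dw|exact: Da_dec Dw|exact: Da_ge0 Dw].
move=> /andP[ap _]; split; first exact: Lsup_fin ap Dw fixw.
by split; [exact: (zero_out_Lsup Dw)|exact: smooth_in_Lsup ap Dw fixw].
Qed.
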